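(* Let $m\ne0$ be real and let $g(z)=z^2$ or $g(z)=-\sin z$. Let $u_0\in H^{3/4}(\mathbb T)$ and $u_1\in H^{-1/4}(\mathbb T)$ be real valued, let $T>0$, and let $z\in\mathcal C([0,T],H^{3/4}(\mathbb T))\cap\mathcal C^1([0,T],H^{-1/4}(\mathbb T))$ be the unique real-valued solution of $$\partial_{tt}z-\Delta z+m^2z=g(z),\qquad z(0)=u_0,\quad\partial_tz(0)=u_1,$$ on the one-dimensional torus $\mathbb T$. For a step size $\tau>0$ let $u^0=u_0-i\langle\nabla\rangle_m^{-1}u_1$ and $$u^{\ell+1}=e^{\tau\mathcal L}\Big(u^\ell+\tau\,\mathcal B\big(F(u^\ell)\cdot\varphi_1(\tau\mathcal A)G(\overline{u^\ell})\big)\Big),\qquad\ell\ge0.$$ Then there exists $C_T>0$ (independent of $\tau$ and $n$) such that $$\|z(n\tau)-\operatorname{Re}u^n\|_{H^1}+\|\partial_tz(n\tau)+\langle\nabla\rangle_m\operatorname{Im}u^n\|_{L^2}\le C_T\,\tau,\qquad0\le n\tau\le T.$$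
   Context: $\langle\nabla\rangle_m=\sqrt{-\Delta+m^2}$ (Fourier multiplier), $\mathcal L=i\langle\nabla\rangle_m$, $\mathcal A=-\mathcal L+\overline{\mathcal L}=-2i\langle\nabla\rangle_m$, $\varphi_1(z)=(e^z-1)/z$, and $\varphi_1(\tau\mathcal A)$ is a Fourier multiplier acting componentwise on vector-valued functions; $Y\cdot Z=\sum_kY_kZ_k$. With $u=z-i\langle\nabla\rangle_m^{-1}\partial_tz$, so that $z=\operatorname{Re}u$ and $\partial_tz=-\langle\nabla\rangle_m\operatorname{Im}u$, the equation becomes $\partial_tu-\mathcal Lu=f(u,\overline u)$ with $f(u,\overline u)=-i\langle\nabla\rangle_m^{-1}g(\tfrac12(u+\overline u))$, and $f(v,w)=\mathcal B(F(v)\cdot G(w))$ where: - if $g(z)=z^2$: $f(v,w)=-\tfrac14i\langle\nabla\rangle_m^{-1}(v^2+w^2+2vw)$, $\mathcal B=-\tfrac i4\langle\nabla\rangle_m^{-1}$, $F(v)=(v^2,1,2v)$, $G(w)=(1,w^2,w)$; - if $g(z)=-\sin z$: $f(v,w)=i\langle\nabla\rangle_m^{-1}(\sin\tfrac v2\cos\tfrac w2+\cos\tfrac v2\sin\tfrac w2)$, $\mathcal B=i\langle\nabla\rangle_m^{-1}$, $F(v)=(\sin\tfrac v2,\cos\tfrac v2)$, $G(w)=(\cos\tfrac w2,\sin\tfrac w2)$. *)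

(* Defs.v *)
(* Conventions: T = R / 2 pi Z.  A periodic distribution is represented by its
   Fourier coefficients a : Z -> C, i.e. a stands for sum_k a_k e^{ikx}; this
   covers uniformly the functions in H^{3/4}(T) and the distributions in
   H^{-1/4}(T).  H^s(T) is the space of those a for which
   sum_k (1 + k^2)^s |a_k|^2 converges.  Since 3/4 > 1/2, the Fourier series of
   an element of H^{3/4}(T) converges absolutely, and nonlinear expressions are
   formed from the values of the resulting continuous function. *)
From Stdlib Require Import Reals ZArith List.
From Coquelicot Require Import Coquelicot.
Import ListNotations.

Open Scope R_scope.

Definition Cexp (z : C) : C :=
  (exp (Re z) * cos (Im z), exp (Re z) * sin (Im z)).

Definition Csin (z : C) : C :=
  ((Cexp (Ci * z) - Cexp (- (Ci * z))) / (2 * Ci))%C.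

Definition Ccos (z : C) : C :=
  ((Cexp (Ci * z) + Cexp (- (Ci * z))) / 2)%C.

(* Only used at nonzero arguments: the symbol of A never vanishes as m <> 0. *)
Definition phi1 (z : C) : C := ((Cexp z - 1) / z)%C.

Definition ex_ZSeries (a : Z -> R) : Prop :=
  ex_series (fun n : nat => a (Z.of_nat n)) /\
  ex_series (fun n : nat => a (- Z.of_nat (S n))%Z).

Definition ZSeries (a : Z -> R) : R :=
  Series (fun n : nat => a (Z.of_nat n)) +
  Series (fun n : nat => a (- Z.of_nat (S n))%Z).

Definition CZSeries (a : Z -> C) : C :=
  (ZSeries (fun k => Re (a k)), ZSeries (fun k => Im (a k))).

Definition distr : Type := Z -> C.

Definition to_fun (a : distr) (x : R) : C :=
  CZSeries (fun k => a k * Cexp (Ci * (IZR k * x)%R))%C.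

Definition fourier (h : R -> C) : distr :=
  fun k => (RtoC (/ (2 * PI)) *
            RInt (V := C_R_CompleteNormedModule)
              (fun x => (h x * Cexp (- (Ci * (IZR k * x)%R)))%C)
              0 (2 * PI))%C.

Definition multiplier (sigma : Z -> C) (a : distr) : distr :=
  fun k => (sigma k * a k)%C.

Definition conj_distr (a : distr) : distr := fun k => Cconj (a (- k)%Z).

Definition real_valued (a : distr) : Prop := forall k, conj_distr a k = a k.

Definition Re_distr (a : distr) : distr :=
  fun k => ((a k + conj_distr a k) / 2)%C.

Definition Im_distr (a : distr) : distr :=
  fun k => ((a k - conj_distr a k) / (2 * Ci))%C.

Definition sobolev_term (s : R) (a : distr) (k : Z) : R :=
  Rpower (1 + IZR k ^ 2) s * Cmod (a k) ^ 2.

Definition in_H (s : R) (a : distr) : Prop := ex_ZSeries (sobolev_term s a).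

(* Total function, meaningful only together with [in_H s a]. *)
Definition norm_H (s : R) (a : distr) : R := sqrt (ZSeries (sobolev_term s a)).

Definition continuous_H (s T : R) (z : R -> distr) : Prop :=
  forall t0, 0 <= t0 <= T ->
    in_H s (z t0) /\
    filterlim (fun t => norm_H s (fun k => z t k - z t0 k)%C)
      (within (fun t => 0 <= t <= T) (locally t0)) (locally 0).

(* [dz] is the time derivative of [z] in H^s on [0, T], one-sided at 0 and T.
   The membership clause makes the norm meaningful when the values of [z]
   themselves are not known to lie in H^s. *)
Definition derivative_H (s T : R) (z dz : R -> distr) : Prop :=
  forall t0, 0 <= t0 <= T ->
    let rem t : distr :=
      fun k => ((z t k - z t0 k) / (t - t0)%R - dz t0 k)%C in
    (forall t, 0 <= t <= T -> t <> t0 -> in_H s (rem t)) /\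
    filterlim (fun t => norm_H s (rem t))
      (within (fun t => 0 <= t <= T) (locally' t0)) (locally 0).

Inductive nonlinearity : Set := Square | MinusSine.

Definition g (nl : nonlinearity) (y : R) : R :=
  match nl with
  | Square => y ^ 2
  | MinusSine => - sin y
  end.

Definition bracket (m : R) (k : Z) : R := sqrt (IZR k ^ 2 + m ^ 2).

Definition symbL (m : R) (k : Z) : C := (Ci * bracket m k)%C.

Definition symbA (m : R) (k : Z) : C := (- symbL m k + Cconj (symbL m k))%C.

Definition symbB (nl : nonlinearity) (m : R) (k : Z) : C :=
  match nl with
  | Square => (- (Ci / 4) * / bracket m k)%C
  | MinusSine => (Ci * / bracket m k)%C
  end.

Definition F (nl : nonlinearity) : list (C -> C) :=
  match nl with
  | Square => [fun v => (v ^ 2)%C; fun _ => RtoC 1; fun v => (2 * v)%C]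
  | MinusSine => [fun v => Csin (v / 2); fun v => Ccos (v / 2)]
  end.

Definition G (nl : nonlinearity) : list (C -> C) :=
  match nl with
  | Square => [fun _ => RtoC 1; fun w => (w ^ 2)%C; fun w => w]
  | MinusSine => [fun w => Ccos (w / 2); fun w => Csin (w / 2)]
  end.

Definition dot (Y Z : list C) : C :=
  fold_right Cplus (RtoC 0) (map (fun p => (fst p * snd p)%C) (combine Y Z)).

(* The function F(u) . phi_1(tau A) G(conj u) on the torus. *)
Definition FphiG (nl : nonlinearity) (m tau : R) (u : distr) (x : R) : C :=
  dot
    (map (fun Fj => Fj (to_fun u x)) (F nl))
    (map (fun Gj =>
            to_fun
              (multiplier (fun k => phi1 (tau * symbA m k))
                 (fourier (fun y => Gj (to_fun (conj_distr u) y)))) x)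
         (G nl)).

Definition step (nl : nonlinearity) (m tau : R) (u : distr) : distr :=
  multiplier (fun k => Cexp (tau * symbL m k))
    (fun k => u k +
       tau * multiplier (symbB nl m) (fourier (FphiG nl m tau u)) k)%C.

Definition u_init (m : R) (u0 u1 : distr) : distr :=
  fun k => (u0 k - Ci * multiplier (fun j => / bracket m j) u1 k)%C.

Fixpoint u_num (nl : nonlinearity) (m tau : R) (u0 u1 : distr) (n : nat)
  : distr :=
  match n with
  | O => u_init m u0 u1
  | S l => step nl m tau (u_num nl m tau u0 u1 l)
  end.

(* [z], with time derivative [dz], is a real-valued solution in
   C([0,T], H^{3/4}) /\ C^1([0,T], H^{-1/4}).  The equation is required for
   0 < t < T as an identity between distributions on the torus, i.e. Fourier
   coefficient by Fourier coefficient: dz is differentiable with derivative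
   Delta z - m^2 z + g(z). *)
Definition is_solution (nl : nonlinearity) (m T : R) (u0 u1 : distr)
    (z dz : R -> distr) : Prop :=
  continuous_H (3 / 4) T z /\
  derivative_H (- 1 / 4) T z dz /\
  continuous_H (- 1 / 4) T dz /\
  (forall t, 0 <= t <= T -> real_valued (z t)) /\
  (forall t k, 0 < t < T ->
     is_derive (K := R_AbsRing) (V := C_R_NormedModule) (fun s => dz s k) t
       (- (IZR k ^ 2)%R * z t k - (m ^ 2)%R * z t k
        + fourier (fun x => RtoC (g nl (Re (to_fun (z t) x)))) k)%C) /\
  (forall k, z 0 k = u0 k) /\
  (forall k, dz 0 k = u1 k).

(* Main.v *)
Require Import Defs.
From Stdlib Require Import Reals ZArith Lra Lia Psatz List FunctionalExtensionality.
From Coquelicot Require Import Coquelicot.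
Import ListNotations.
Open Scope R_scope.

(** Let [U] be the solution of the first order system [u_t = L u + B N(u)], where
    [N(u) = F(u) . G(conj u)], let [v = U(t_n)], and write [w_k] for the symbol
    [sqrt (k^2 + m^2)].  In the filtered variable
    [e^{-sL} U(t_n + s)] the linear part disappears, and the derivative is
    [B e^{-sL} N(U(t_n + s))].  The scheme replaces it by
    [B (F(v) . e^{sA} G(conj v))], whose integral over a step of length [tau] is
    [tau B (F(v) . phi_1(tau A) G(conj v))].

    The two integrands differ by [O(s)], measured in L^2 before [B] is applied.
    As [B] gains one derivative, the filtered solution moves by [O(s)] in H^1
    ([free_flow_error]), so [U(t_n + s)] may be replaced by [e^{sL} v].  It
    remains to freeze the flow on products of functions in H^{3/4}.  On a
    product of the modes [l] and [j] this changes a phase by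
    [s (w_l + w_j - w_(l+j))], where the bracket is at most a multiple of the
    lower of the two frequencies ([bracket_defect]).  The loss is therefore half
    a derivative on each factor, and H^{1/4} x H^{1/4} is mapped to L^2, which
    on Fourier coefficients is a Schur test ([schur_defect],
    [wball_flow_conv_defect]).  The same estimate, applied to one factor after
    the other in the exponential series, shows that superposition with the
    exponential, hence with the sine and the cosine, commutes with the flow up
    to [O(s)] in L^2 ([tame_exp]).  Hence the local error is [O(tau^2)] in H^1
    ([local_error]), although the solution
    itself is only in H^{3/4}.

    The scheme is stable in H^1 with constants that depend on the size of its
    iterates in H^{3/4} ([step_stability]).  The exact solution is bounded there
    and the error in H^1 controls the difference, so a discrete Gronwall
    argument gives the global bound [O(tau)] ([error_recursion]).  Real and
    imaginary parts of the error are the two quantities in the theorem.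

    Everything takes place on Fourier coefficients.  Sobolev balls are described
    by bounds on partial sums ([wball]), and time integrals are replaced by a
    mean value inequality for finitely many coefficients ([wball_mvt]). *)

#[local] Hint Resolve Cmod_ge_0 pow2_ge_0 Rabs_pos : core.

(** * Sums over symmetric ranges of integers *)

Fixpoint zsum (N : nat) (a : Z -> R) : R :=
  match N with
  | O => a 0%Z
  | S n => zsum n a + (a (Z.of_nat (S n)) + a (- Z.of_nat (S n))%Z)
  end.

Lemma zsum_ext N a b :
  (forall k, (Z.abs k <= Z.of_nat N)%Z -> a k = b k) -> zsum N a = zsum N b.
Proof.
  induction N as [|N IH]; intros H; cbn [zsum].
  - apply H; lia.
  - rewrite IH, !H; try lia; auto. intros k Hk; apply H; lia.
Qed.

Lemma zsum_le N a b :
  (forall k, (Z.abs k <= Z.of_nat N)%Z -> a k <= b k) -> zsum N a <= zsum N b.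
Proof.
  induction N as [|N IH]; intros H; cbn [zsum].
  - apply H; lia.
  - pose proof (H (Z.of_nat (S N)) ltac:(lia)).
    pose proof (H (- Z.of_nat (S N))%Z ltac:(lia)).
    assert (zsum N a <= zsum N b) by (apply IH; intros; apply H; lia). lra.
Qed.

Lemma zsum_plus N a b : zsum N (fun k => a k + b k) = zsum N a + zsum N b.
Proof. induction N as [|N IH]; cbn [zsum]; [|rewrite IH]; ring. Qed.

Lemma zsum_scal N c a : zsum N (fun k => c * a k) = c * zsum N a.
Proof. induction N as [|N IH]; cbn [zsum]; [|rewrite IH]; ring. Qed.

Lemma zsum_zero N : zsum N (fun _ => 0) = 0.
Proof. induction N as [|N IH]; cbn [zsum]; [|rewrite IH]; ring. Qed.

Lemma zsum_ge0 N a : (forall k, 0 <= a k) -> 0 <= zsum N a.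
Proof. intros H; rewrite <- (zsum_zero N); apply zsum_le; auto. Qed.

Lemma zsum_mono N N' a :
  (forall k, 0 <= a k) -> (N <= N')%nat -> zsum N a <= zsum N' a.
Proof.
  intros H; induction 1 as [|N' _ IH]; cbn [zsum]; [lra|].
  pose proof (H (Z.of_nat (S N'))). pose proof (H (- Z.of_nat (S N'))%Z). lra.
Qed.

Lemma zsum_ge_term N a k :
  (forall j, 0 <= a j) -> (Z.abs k <= Z.of_nat N)%Z -> a k <= zsum N a.
Proof.
  intros H; induction N as [|N IH]; intros Hk; cbn [zsum].
  - replace k with 0%Z by lia; lra.
  - pose proof (H (Z.of_nat (S N))). pose proof (H (- Z.of_nat (S N))%Z).
    pose proof (zsum_ge0 N a H).
    destruct (Z_le_gt_dec (Z.abs k) (Z.of_nat N)) as [h|h]; [specialize (IH h); lra|].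
    destruct (Z.abs_spec k) as [[_ e]|[_ e]].
    + replace k with (Z.of_nat (S N)) by lia; lra.
    + replace k with (- Z.of_nat (S N))%Z by lia; lra.
Qed.

Lemma zsum_swap N M (a : Z -> Z -> R) :
  zsum N (fun k => zsum M (fun l => a k l)) = zsum M (fun l => zsum N (fun k => a k l)).
Proof.
  induction N as [|N IH]; cbn [zsum]; [reflexivity|].
  now rewrite IH, !zsum_plus.
Qed.

Lemma zsum_neg N a : zsum N (fun k => a (- k)%Z) = zsum N a.
Proof.
  induction N as [|N IH]; cbn [zsum]; [reflexivity|].
  rewrite IH, Z.opp_involutive; ring.
Qed.

Lemma zsum_succ N a :
  zsum N (fun k => a (k + 1)%Z)
  = zsum N a + (a (Z.of_nat (S N)) - a (- Z.of_nat N)%Z).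
Proof.
  induction N as [|N IH].
  - cbn [zsum]. change (0 + 1)%Z with 1%Z. change (- Z.of_nat 0)%Z with 0%Z.
    change (Z.of_nat 1) with 1%Z. ring.
  - cbn [zsum]. rewrite IH.
    replace (Z.of_nat (S N) + 1)%Z with (Z.of_nat (S (S N))) by lia.
    replace (- Z.of_nat (S N) + 1)%Z with (- Z.of_nat N)%Z by lia. ring.
Qed.

Lemma zsum_shift_le N (l : Z) a :
  (forall k, 0 <= a k) ->
  zsum N (fun k => a (k - l)%Z) <= zsum (N + Z.abs_nat l) a.
Proof.
  intros Ha.
  (* It suffices to shift upwards, since [zsum] is invariant under reflection. *)
  assert (up : forall (n : nat) b, (forall k, 0 <= b k) ->
             zsum N (fun k => b (k + Z.of_nat n)%Z) <= zsum (N + n) b).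
  { clear a Ha. induction n as [|n IH]; intros b b_pos.
    - rewrite Nat.add_0_r. right; apply zsum_ext; intros; f_equal; lia.
    - rewrite (zsum_ext N _ (fun k => (fun j => b (j + 1)%Z) (k + Z.of_nat n)%Z))
        by (intros; f_equal; lia).
      eapply Rle_trans; [apply (IH (fun j => b (j + 1)%Z)); auto|].
      rewrite zsum_succ, Nat.add_succ_r; cbn [zsum].
      pose proof (b_pos (- Z.of_nat (N + n))%Z).
      pose proof (b_pos (- Z.of_nat (S (N + n)))%Z). lra. }
  destruct (Z_le_gt_dec l 0) as [h|h].
  - rewrite (zsum_ext N _ (fun k => a (k + Z.of_nat (Z.abs_nat l))%Z))
      by (intros; f_equal; lia).
    now apply up.
  - rewrite <- zsum_neg, <- (zsum_neg (N + _) a).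
    rewrite (zsum_ext N _ (fun k => (fun j => a (- j)%Z) (k + Z.of_nat (Z.abs_nat l))%Z))
      by (intros; f_equal; lia).
    apply (up (Z.abs_nat l) (fun j => a (- j)%Z)); auto.
Qed.

Lemma zsum_cauchy_schwarz N a b :
  zsum N (fun k => a k * b k) ^ 2
  <= zsum N (fun k => a k ^ 2) * zsum N (fun k => b k ^ 2).
Proof.
  (* The discriminant of the nonnegative quadratic sum (t a + s b)^2. *)
  set (A := zsum N (fun k => a k ^ 2)). set (B := zsum N (fun k => b k ^ 2)).
  set (P := zsum N (fun k => a k * b k)).
  assert (q : forall s t, 0 <= t ^ 2 * A + 2 * (t * s) * P + s ^ 2 * B).
  { intros s t. unfold A, B, P. rewrite <- !zsum_scal, <- !zsum_plus.
    apply zsum_ge0; intros k.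
    replace (_ + _) with ((t * a k + s * b k) ^ 2) by ring. apply pow2_ge_0. }
  assert (hA : 0 <= A) by (apply zsum_ge0; auto).
  assert (hB : 0 <= B) by (apply zsum_ge0; auto).
  pose proof (q A (- P)) as h1. pose proof (q (- P) B) as h2.
  assert (h1' : 0 <= A * (A * B - P ^ 2)) by nra.
  assert (h2' : 0 <= B * (A * B - P ^ 2)) by nra.
  destruct (Rle_lt_or_eq_dec _ _ hA) as [pA|zA]; [nra|].
  destruct (Rle_lt_or_eq_dec _ _ hB) as [pB|zB]; [nra|].
  rewrite <- zA, <- zB in *.
  pose proof (q 1 1). pose proof (q 1 (-1)). nra.
Qed.

Lemma zsum_minkowski N a b A B :
  0 <= A -> 0 <= B ->
  zsum N (fun k => a k ^ 2) <= A ^ 2 -> zsum N (fun k => b k ^ 2) <= B ^ 2 ->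
  zsum N (fun k => (a k + b k) ^ 2) <= (A + B) ^ 2.
Proof.
  intros hA hB ha hb.
  rewrite (zsum_ext N _ (fun k => a k ^ 2 + (2 * (a k * b k) + b k ^ 2)))
    by (intros; ring).
  rewrite !zsum_plus, zsum_scal.
  pose proof (zsum_cauchy_schwarz N a b) as cs.
  assert (0 <= zsum N (fun k => a k ^ 2)) by (apply zsum_ge0; auto).
  assert (0 <= zsum N (fun k => b k ^ 2)) by (apply zsum_ge0; auto).
  assert (zsum N (fun k => a k * b k) <= A * B).
  { apply Rsqr_incr_0_var; [|nra]. unfold Rsqr.
    assert (zsum N (fun k => a k ^ 2) * zsum N (fun k => b k ^ 2) <= A ^ 2 * B ^ 2)
      by (apply Rmult_le_compat; auto).
    nra. }
  nra.
Qed.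

(** Componentwise, like [CZSeries], so that limits of real sums can be used as
    they are. *)
Definition czsum (N : nat) (a : Z -> C) : C :=
  (zsum N (fun k => Re (a k)), zsum N (fun k => Im (a k))).

Lemma czsum_0 a : czsum 0 a = a 0%Z.
Proof. symmetry; apply surjective_pairing. Qed.

Lemma czsum_S N a :
  czsum (S N) a
  = (czsum N a + (a (Z.of_nat (S N)) + a (- Z.of_nat (S N))%Z))%C.
Proof. reflexivity. Qed.

Lemma czsum_ext N a b :
  (forall k, (Z.abs k <= Z.of_nat N)%Z -> a k = b k) -> czsum N a = czsum N b.
Proof.
  intros H; unfold czsum; f_equal; apply zsum_ext; intros k Hk; now rewrite H.
Qed.

Lemma czsum_plus N a b : czsum N (fun k => (a k + b k)%C) = (czsum N a + czsum N b)%C.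
Proof. unfold czsum; cbn; now rewrite !zsum_plus. Qed.

Lemma czsum_scal N c a : czsum N (fun k => (c * a k)%C) = (c * czsum N a)%C.
Proof.
  induction N as [|N IH]; [unfold czsum; cbn; now apply injective_projections|].
  rewrite !czsum_S, IH; ring.
Qed.

Lemma Cmod_czsum_le N a : Cmod (czsum N a) <= zsum N (fun k => Cmod (a k)).
Proof.
  induction N as [|N IH].
  - unfold czsum; cbn. rewrite <- surjective_pairing. lra.
  - rewrite czsum_S; cbn [zsum].
    eapply Rle_trans; [apply Cmod_triangle|].
    apply Rplus_le_compat; [exact IH|apply Cmod_triangle].
Qed.

Lemma Re_le_Cmod z : Rabs (Re z) <= Cmod z.
Proof.
  apply Rle_trans with (2 := Rmax_Cmod z). apply Rmax_l.
Qed.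

Lemma Im_le_Cmod z : Rabs (Im z) <= Cmod z.
Proof.
  apply Rle_trans with (2 := Rmax_Cmod z). apply Rmax_r.
Qed.

Lemma Cmod_sqr z : Cmod z ^ 2 = Re z ^ 2 + Im z ^ 2.
Proof.
  unfold Cmod. rewrite <- Rsqr_pow2, Rsqr_sqrt; [reflexivity|].
  apply Rplus_le_le_0_compat; apply pow2_ge_0.
Qed.

Lemma zsum_split N a :
  zsum (S N) a = sum_n (fun n => a (Z.of_nat n)) (S N)
             + sum_n (fun n => a (- Z.of_nat (S n))%Z) N.
Proof.
  rewrite !sum_n_Reals.
  induction N as [|N IH].
  - cbn. ring.
  - cbn [zsum sum_f_R0] in *. rewrite IH. ring.
Qed.

(** * Absolutely convergent series over the integers *)

Lemma ex_series_nonneg_bounded (u : nat -> R) M :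
  (forall n, 0 <= u n) -> (forall n, sum_n u n <= M) -> ex_series u.
Proof.
  intros hu hM.
  assert (h : ex_finite_lim_seq (sum_n u)).
  { apply ex_finite_lim_seq_incr with M; auto.
    intros n. rewrite sum_Sn. pose proof (hu (S n)). unfold plus; cbn; lra. }
  destruct h as [l hl]. exists l. exact hl.
Qed.

Lemma ZSeries_lim_ex (a : Z -> R) :
  ex_ZSeries a -> is_lim_seq (fun N => zsum N a) (ZSeries a).
Proof.
  intros [h1 h2]. apply Series_correct in h1, h2.
  apply is_lim_seq_incr_1.
  apply is_lim_seq_ext with (1 := fun N => eq_sym (zsum_split N a)).
  change (is_lim_seq (sum_n (fun n => a (- Z.of_nat (S n))%Z)) (Series (fun n => a (- Z.of_nat (S n))%Z))) in h2.
  apply is_lim_seq_plus'; [|exact h2].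
  apply -> (is_lim_seq_incr_1 (sum_n (fun n => a (Z.of_nat n)))). exact h1.
Qed.

Lemma ex_ZSeries_bounded (a : Z -> R) M :
  (forall N, zsum N (fun k => Rabs (a k)) <= M) -> ex_ZSeries a.
Proof.
  intros hM.
  assert (s1 : forall n, 0 <= sum_n (fun n => Rabs (a (Z.of_nat n))) n).
  { intros n. rewrite sum_n_Reals. apply cond_pos_sum. intros; apply Rabs_pos. }
  assert (s2 : forall n, 0 <= sum_n (fun n => Rabs (a (- Z.of_nat (S n))%Z)) n).
  { intros n. rewrite sum_n_Reals. apply cond_pos_sum. intros; apply Rabs_pos. }
  assert (s : forall n, sum_n (fun n => Rabs (a (Z.of_nat n))) n
                        + sum_n (fun n => Rabs (a (- Z.of_nat (S n))%Z)) n <= M).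
  { intros n. eapply Rle_trans; [|apply (hM (S n))].
    rewrite zsum_split, sum_Sn. pose proof (Rabs_pos (a (Z.of_nat (S n)))).
    unfold plus; cbn -[Z.of_nat Z.opp]. lra. }
  split; apply ex_series_Rabs; apply ex_series_nonneg_bounded with M;
    try (intros; apply Rabs_pos);
    intros n; specialize (s1 n); specialize (s2 n); specialize (s n); lra.
Qed.

Lemma zsum_le_ZSeries (a : Z -> R) N :
  (forall k, 0 <= a k) -> ex_ZSeries a -> zsum N a <= ZSeries a.
Proof.
  intros ha h. apply ZSeries_lim_ex in h.
  apply is_lim_seq_incr_compare with (1 := h).
  intros n; apply zsum_mono; auto.
Qed.

Lemma ZSeries_le_bound (a : Z -> R) M :
  (forall k, 0 <= a k) -> (forall N, zsum N a <= M) ->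
  ex_ZSeries a /\ ZSeries a <= M.
Proof.
  intros ha hM.
  assert (h : ex_ZSeries a).
  { apply ex_ZSeries_bounded with M. intros N.
    rewrite (zsum_ext N _ a); auto. intros; apply Rabs_pos_eq; auto. }
  split; [exact h|]. apply ZSeries_lim_ex in h.
  apply (is_lim_seq_le _ _ _ _ hM h (is_lim_seq_const M)).
Qed.

Definition summable (a : Z -> C) : Prop :=
  exists M, forall N, zsum N (fun k => Cmod (a k)) <= M.

Definition Clim_seq (u : nat -> C) (l : C) : Prop :=
  is_lim_seq (fun n => Re (u n)) (Re l) /\ is_lim_seq (fun n => Im (u n)) (Im l).

Lemma Clim_unique u l l' : Clim_seq u l -> Clim_seq u l' -> l = l'.
Proof.
  intros [h1 h2] [h1' h2'].
  apply is_lim_seq_unique in h1, h2, h1', h2'.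
  rewrite h1 in h1'; rewrite h2 in h2'. injection h1'; injection h2'.
  intros; now apply injective_projections.
Qed.

Lemma Clim_ext u v l : (forall n, u n = v n) -> Clim_seq u l -> Clim_seq v l.
Proof.
  intros e [h1 h2]; split;
    [apply is_lim_seq_ext with (2 := h1)|apply is_lim_seq_ext with (2 := h2)];
    intros n; now rewrite e.
Qed.

Lemma Clim_const c : Clim_seq (fun _ => c) c.
Proof. split; apply is_lim_seq_const. Qed.

Lemma Clim_plus u v l l' :
  Clim_seq u l -> Clim_seq v l' -> Clim_seq (fun n => (u n + v n)%C) (l + l')%C.
Proof.
  intros [h1 h2] [h1' h2']; split; cbn;
    eapply is_lim_seq_plus; eauto; reflexivity.
Qed.

Lemma Clim_mult u v l l' :
  Clim_seq u l -> Clim_seq v l' -> Clim_seq (fun n => (u n * v n)%C) (l * l')%C.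
Proof.
  intros [h1 h2] [h1' h2']; split; cbn.
  - eapply is_lim_seq_minus'; eapply is_lim_seq_mult'; assumption.
  - eapply is_lim_seq_plus'; eapply is_lim_seq_mult'; assumption.
Qed.

Lemma Clim_minus u v l l' :
  Clim_seq u l -> Clim_seq v l' -> Clim_seq (fun n => (u n - v n)%C) (l - l')%C.
Proof.
  intros [h1 h2] [h1' h2']; split; cbn; eapply is_lim_seq_minus'; eauto.
Qed.

Lemma Clim_Cmod u l : Clim_seq u l -> is_lim_seq (fun n => Cmod (u n)) (Cmod l).
Proof.
  intros [h1 h2].
  apply (is_lim_seq_continuous sqrt (fun n => Re (u n) ^ 2 + Im (u n) ^ 2)).
  - apply continuity_pt_sqrt. apply Rplus_le_le_0_compat; apply pow2_ge_0.
  - cbn. repeat first [eapply is_lim_seq_plus' | eapply is_lim_seq_mult'];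
      try assumption; apply is_lim_seq_const.
Qed.

Lemma Clim_Cmod_le u l M : Clim_seq u l -> (forall n, Cmod (u n) <= M) -> Cmod l <= M.
Proof.
  intros h hM. apply Clim_Cmod in h.
  apply (is_lim_seq_le _ _ _ _ hM h (is_lim_seq_const M)).
Qed.

Lemma Re_minus z w : Re (z - w) = Re z - Re w.
Proof. reflexivity. Qed.

Lemma Im_minus z w : Im (z - w) = Im z - Im w.
Proof. reflexivity. Qed.

Lemma Clim_squeeze u l (e : nat -> R) :
  (forall n, Cmod (u n - l) <= e n) -> is_lim_seq e 0 -> Clim_seq u l.
Proof.
  intros h he.
  assert (sq : forall (x : nat -> R) y, (forall n, Rabs (x n - y) <= e n) ->
             is_lim_seq x y).
  { intros x y hx.
    apply is_lim_seq_le_le with (fun n => y - e n) (fun n => y + e n).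
    - intros n. specialize (hx n). apply Rabs_le_between in hx. lra.
    - pose proof (is_lim_seq_minus' _ _ _ _ (is_lim_seq_const y) he) as L.
      now rewrite Rminus_0_r in L.
    - pose proof (is_lim_seq_plus' _ _ _ _ (is_lim_seq_const y) he) as L.
      now rewrite Rplus_0_r in L. }
  split; apply sq; intros n; rewrite <- ?Re_minus, <- ?Im_minus;
    eapply Rle_trans; [apply Re_le_Cmod|apply h|apply Im_le_Cmod|apply h].
Qed.

Lemma summable_le a b :
  (forall k, Cmod (a k) <= Cmod (b k)) -> summable b -> summable a.
Proof.
  intros h [M hM]; exists M; intros N.
  eapply Rle_trans; [apply zsum_le; intros; apply h|apply hM].
Qed.

Lemma summable_plus a b :
  summable a -> summable b -> summable (fun k => (a k + b k)%C).
Proof.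
  intros [A hA] [B hB]; exists (A + B); intros N.
  eapply Rle_trans; [apply zsum_le; intros; apply Cmod_triangle|].
  rewrite zsum_plus. specialize (hA N); specialize (hB N); lra.
Qed.

Lemma summable_scal c a : summable a -> summable (fun k => (c * a k)%C).
Proof.
  intros [A hA]; exists (Cmod c * A); intros N.
  rewrite (zsum_ext N _ (fun k => Cmod c * Cmod (a k)))
    by (intros; apply Cmod_mult).
  rewrite zsum_scal. apply Rmult_le_compat_l; [apply Cmod_ge_0|apply hA].
Qed.

Lemma summable_shift l a : summable a -> summable (fun k => a (k - l)%Z).
Proof.
  intros [A hA]; exists A; intros N.
  eapply Rle_trans; [apply (zsum_shift_le N l (fun k => Cmod (a k)))|apply hA].
  auto.
Qed.

Lemma summable_neg a : summable a -> summable (fun k => a (- k)%Z).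
Proof.
  intros [A hA]; exists A; intros N.
  rewrite (zsum_neg N (fun k => Cmod (a k))). apply hA.
Qed.

Lemma CZSeries_lim a : summable a -> Clim_seq (fun N => czsum N a) (CZSeries a).
Proof.
  intros [M hM]. split; apply ZSeries_lim_ex; apply ex_ZSeries_bounded with M;
    intros N; (eapply Rle_trans; [|apply (hM N)]); apply zsum_le; intros.
  - apply Re_le_Cmod.
  - apply Im_le_Cmod.
Qed.

Lemma CZSeries_unique a l :
  summable a -> Clim_seq (fun N => czsum N a) l -> CZSeries a = l.
Proof. intros h hl; apply Clim_unique with (2 := hl). now apply CZSeries_lim. Qed.

Lemma Cmod_CZSeries_le a M :
  (forall N, zsum N (fun k => Cmod (a k)) <= M) -> Cmod (CZSeries a) <= M.
Proof.
  intros h. apply Clim_Cmod_le with (fun N => czsum N a).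
  - apply CZSeries_lim; now exists M.
  - intros n; eapply Rle_trans; [apply Cmod_czsum_le|apply h].
Qed.

Lemma ZSeries_ext a b : (forall k, a k = b k) -> ZSeries a = ZSeries b.
Proof.
  intros h; unfold ZSeries; f_equal; apply Series_ext; intros; apply h.
Qed.

Lemma CZSeries_ext a b : (forall k, a k = b k) -> CZSeries a = CZSeries b.
Proof.
  intros h; unfold CZSeries; f_equal; apply ZSeries_ext; intros; now rewrite h.
Qed.

Lemma CZSeries_plus a b :
  summable a -> summable b ->
  CZSeries (fun k => (a k + b k)%C) = (CZSeries a + CZSeries b)%C.
Proof.
  intros ha hb. apply CZSeries_unique; [now apply summable_plus|].
  apply Clim_ext with (fun N => (czsum N a + czsum N b)%C);
    [intros; symmetry; apply czsum_plus|].
  apply Clim_plus; now apply CZSeries_lim.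
Qed.

Lemma CZSeries_scal c a :
  summable a -> CZSeries (fun k => (c * a k)%C) = (c * CZSeries a)%C.
Proof.
  intros ha. apply CZSeries_unique; [now apply summable_scal|].
  apply Clim_ext with (fun N => (c * czsum N a)%C);
    [intros; symmetry; apply czsum_scal|].
  apply Clim_mult; [apply Clim_const|now apply CZSeries_lim].
Qed.

Lemma CZSeries_minus a b :
  summable a -> summable b ->
  CZSeries (fun k => (a k - b k)%C) = (CZSeries a - CZSeries b)%C.
Proof.
  intros ha hb.
  rewrite (CZSeries_ext _ (fun k => (a k + (-(1)) * b k)%C)) by (intros; ring).
  rewrite CZSeries_plus, CZSeries_scal; auto; [ring|now apply summable_scal].
Qed.

Lemma CZSeries_neg a :
  summable a -> CZSeries (fun k => a (- k)%Z) = CZSeries a.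
Proof.
  intros ha. apply CZSeries_unique; [now apply summable_neg|].
  apply Clim_ext with (fun N => czsum N a); [|now apply CZSeries_lim].
  intros N; unfold czsum. f_equal;
    [exact (eq_sym (zsum_neg N (fun k => Re (a k))))
    |exact (eq_sym (zsum_neg N (fun k => Im (a k))))].
Qed.

Lemma ZSeries_succ a :
  ex_ZSeries a -> ZSeries (fun k => a (k + 1)%Z) = ZSeries a.
Proof.
  (* One term moves from the negative half of the sum to the other half. *)
  intros [h1 h2]. unfold ZSeries.
  rewrite (Series_incr_1 _ h1).
  rewrite (Series_incr_1 (fun n => a (- Z.of_nat (S n) + 1)%Z)).
  - rewrite (Series_ext (fun n => a (Z.of_nat n + 1)%Z) (fun n => a (Z.of_nat (S n))))
      by (intros; f_equal; lia).
    rewrite (Series_ext (fun n => a (- Z.of_nat (S (S n)) + 1)%Z)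
               (fun n => a (- Z.of_nat (S n))%Z)) by (intros; f_equal; lia).
    replace (- Z.of_nat 1 + 1)%Z with (Z.of_nat 0) by lia. ring.
  - apply ex_series_incr_1. 
    apply ex_series_ext with (2 := h2). intros; f_equal; lia.
Qed.

Lemma CZSeries_shift l a :
  summable a -> CZSeries (fun k => a (k - l)%Z) = CZSeries a.
Proof.
  intros ha.
  assert (up : forall (n : nat) b, summable b ->
             CZSeries (fun k => b (k + Z.of_nat n)%Z) = CZSeries b).
  { induction n as [|n IH]; intros b hb.
    - apply CZSeries_ext; intros; f_equal; lia.
    - rewrite <- (IH b hb).
      set (c := fun k => b (k + Z.of_nat n)%Z).
      assert (hc : summable c).
      { apply (summable_shift (- Z.of_nat n)) in hb.
        apply summable_le with (2 := hb). intros k; unfold c. right; do 2 f_equal; lia. }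
      rewrite (CZSeries_ext _ (fun k => c (k + 1)%Z)) by (intros; unfold c; f_equal; lia).
      destruct hc as [M hM].
      unfold CZSeries; f_equal.
      + apply (ZSeries_succ (fun k => Re (c k))), ex_ZSeries_bounded with M.
        intros N; eapply Rle_trans; [|apply (hM N)]; apply zsum_le; intros; apply Re_le_Cmod.
      + apply (ZSeries_succ (fun k => Im (c k))), ex_ZSeries_bounded with M.
        intros N; eapply Rle_trans; [|apply (hM N)]; apply zsum_le; intros; apply Im_le_Cmod. }
  destruct (Z_le_gt_dec l 0) as [h|h].
  - rewrite (CZSeries_ext _ (fun k => a (k + Z.of_nat (Z.abs_nat l))%Z))
      by (intros; f_equal; lia).
    now apply up.
  - rewrite <- CZSeries_neg by now apply summable_shift.
    rewrite <- (CZSeries_neg a) by easy.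
    rewrite (CZSeries_ext _ (fun k => (fun j => a (- j)%Z) (k + Z.of_nat (Z.abs_nat l))%Z))
      by (intros; f_equal; lia).
    apply (up _ (fun j => a (- j)%Z)). now apply summable_neg.
Qed.

Lemma CZSeries_conj a :
  CZSeries (fun k => Cconj (a k)) = Cconj (CZSeries a).
Proof.
  unfold CZSeries, Cconj; cbn. f_equal. unfold ZSeries.
  rewrite !Series_opp. unfold ZSeries, Im. ring.
Qed.

(** * Sobolev weights and balls *)

(** All Sobolev weights below are integer powers of this one. *)
Definition wt (k : Z) : R := Rpower (1 + IZR k ^ 2) (1 / 8).

Lemma one_plus_sqr_pos k : 0 < 1 + IZR k ^ 2.
Proof. pose proof (pow2_ge_0 (IZR k)). lra. Qed.

Lemma wt_pow k n : wt k ^ n = Rpower (1 + IZR k ^ 2) (1 / 8 * INR n).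
Proof.
  unfold wt. rewrite <- Rpower_mult, Rpower_pow; [reflexivity|apply exp_pos].
Qed.

Lemma wt_pow8 k : wt k ^ 8 = 1 + IZR k ^ 2.
Proof.
  rewrite wt_pow. replace (1 / 8 * INR 8) with 1 by (cbn; lra).
  apply Rpower_1, one_plus_sqr_pos.
Qed.

Lemma wt_ge1 k : 1 <= wt k.
Proof.
  unfold wt. rewrite <- (Rpower_O (1 + IZR k ^ 2) (one_plus_sqr_pos k)) at 1.
  apply Rle_Rpower; [|lra]. pose proof (pow2_ge_0 (IZR k)). lra.
Qed.

Lemma wt_pos k : 0 < wt k.
Proof. pose proof (wt_ge1 k); lra. Qed.

Lemma wt_opp k : wt (- k) = wt k.
Proof. unfold wt. rewrite opp_IZR. do 2 f_equal. ring. Qed.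

Lemma pow_le_inv_nat x y n : 0 < x -> 0 < y -> x ^ S n <= y ^ S n -> x <= y.
Proof.
  intros hx hy h. destruct (Rle_lt_dec x y) as [?|lt]; [easy|].
  exfalso. assert (H : forall j, y ^ S j < x ^ S j).
  { induction j as [|j IH]; [cbn; lra|].
    change (y * y ^ S j < x * x ^ S j).
    apply Rmult_le_0_lt_compat; auto; [lra|]. apply pow_le; lra. }
  specialize (H n). lra.
Qed.

Lemma wt_mono l j : Rabs (IZR l) <= Rabs (IZR j) -> wt l <= wt j.
Proof.
  intros h. apply pow_le_inv_nat with 7%nat; try apply wt_pos.
  rewrite !wt_pow8, <- (pow2_abs (IZR l)), <- (pow2_abs (IZR j)).
  pose proof (Rabs_pos (IZR l)). nra.
Qed.

Lemma wt_add_le l j : wt (l + j) <= 2 * Rmax (wt l) (wt j).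
Proof.
  pose proof (wt_pos l); pose proof (wt_pos j).
  pose proof (Rmax_l (wt l) (wt j)); pose proof (Rmax_r (wt l) (wt j)).
  apply pow_le_inv_nat with 7%nat; try apply wt_pos; [lra|].
  rewrite Rpow_mult_distr, wt_pow8, plus_IZR.
  set (M := Rmax (wt l) (wt j)) in *.
  assert (wt l ^ 8 <= M ^ 8) by (apply pow_incr; lra).
  assert (wt j ^ 8 <= M ^ 8) by (apply pow_incr; lra).
  rewrite wt_pow8 in *.
  pose proof (pow2_ge_0 (IZR l - IZR j)). simpl (2 ^ 8). nra.
Qed.

Lemma wt_pow3_add_le l j : wt (l + j) ^ 3 <= 8 * (wt l ^ 3 + wt j ^ 3).
Proof.
  pose proof (wt_add_le l j) as h. pose proof (wt_pos (l + j)).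
  pose proof (pow_lt _ 3 (wt_pos l)). pose proof (pow_lt _ 3 (wt_pos j)).
  assert (h3 : wt (l + j) ^ 3 <= (2 * Rmax (wt l) (wt j)) ^ 3)
    by (apply pow_incr; lra).
  rewrite Rpow_mult_distr in h3. simpl (2 ^ 3) in h3.
  unfold Rmax in h3. destruct (Rle_dec (wt l) (wt j)); lra.
Qed.

Lemma wt_pow4_ge_abs k : Rabs (IZR k) <= wt k ^ 4.
Proof.
  apply Rsqr_incr_0_var; [|apply pow_le, Rlt_le, wt_pos].
  rewrite <- Rsqr_abs. unfold Rsqr.
  replace (wt k ^ 4 * wt k ^ 4) with (wt k ^ 8) by ring.
  rewrite wt_pow8. lra.
Qed.

(** [wt k ^ (-6)] is [(1+k^2)^(-3/4)], compared here with the increments of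
    [1 / sqrt k], which telescope.  Its summability is where 3/4 > 1/2 enters. *)
Lemma wt_inv_pow6_telescope n :
  / wt (Z.of_nat (S (S n))) ^ 6
  <= 2 * (/ sqrt (INR (S n)) - / sqrt (INR (S (S n)))).
Proof.
  set (x := sqrt (INR (S n))). set (y := sqrt (INR (S (S n)))).
  assert (hx2 : x ^ 2 = INR (S n)) by (apply pow2_sqrt, pos_INR).
  assert (hy2 : y ^ 2 = INR (S (S n))) by (apply pow2_sqrt, pos_INR).
  assert (hx : 0 < x) by (apply sqrt_lt_R0, lt_0_INR; lia).
  assert (hy : 0 < y) by (apply sqrt_lt_R0, lt_0_INR; lia).
  assert (hxy : y ^ 2 = x ^ 2 + 1) by (rewrite hx2, hy2, (S_INR (S n)); ring).
  assert (lexy : x <= y) by nra.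
  assert (hp : y ^ 3 <= wt (Z.of_nat (S (S n))) ^ 6).
  { apply pow_le_inv_nat with 3%nat; try apply pow_lt; auto; [apply wt_pos|].
    replace ((y ^ 3) ^ 4) with ((y ^ 2) ^ 6) by ring.
    replace ((wt (Z.of_nat (S (S n))) ^ 6) ^ 4) with ((wt (Z.of_nat (S (S n))) ^ 8) ^ 3) by ring.
    rewrite wt_pow8, <- INR_IZR_INZ, hy2.
    set (a := INR (S (S n))). replace (a ^ 6) with ((a ^ 2) ^ 3) by ring.
    apply pow_incr. pose proof (pow2_ge_0 a). lra. }
  apply Rle_trans with (/ y ^ 3).
  { apply Rinv_le_contravar; [apply pow_lt|]; auto. }
  replace (2 * (/ x - / y)) with (2 * (y - x) / (x * y)) by (field; lra).
  assert (e : (y - x) * (y + x) = 1) by lra.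
  assert (pxy : 0 < x * y) by now apply Rmult_lt_0_compat.
  replace (2 * (y - x) / (x * y)) with (/ (x * y * ((y + x) / 2))).
  - apply Rinv_le_contravar; [apply Rmult_lt_0_compat; lra|].
    replace (y ^ 3) with (y * (y * y)) by ring.
    replace (x * y * ((y + x) / 2)) with (y * (x * ((y + x) / 2))) by field.
    apply Rmult_le_compat_l; [lra|]. apply Rmult_le_compat; lra.
  - replace (y - x) with (/ (y + x)); [field; lra|].
    apply Rmult_eq_reg_r with (y + x); [|lra]. rewrite e. field. lra.
Qed.

Lemma zsum_wt_inv_tail M N : (1 <= M)%nat -> (M <= N)%nat ->
  zsum N (fun k => / wt k ^ 6) - zsum M (fun k => / wt k ^ 6)
  <= 4 * (/ sqrt (INR M) - / sqrt (INR N)).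
Proof.
  intros hM. induction 1 as [|N hN IH]; [lra|].
  cbn [zsum]. rewrite wt_opp. destruct N as [|N]; [lia|].
  pose proof (wt_inv_pow6_telescope N). lra.
Qed.

Lemma zsum_wt_inv_pow6 N : zsum N (fun k => / wt k ^ 6) <= 7.
Proof.
  assert (h1 : forall k, 0 < / wt k ^ 6 <= 1).
  { intros k. pose proof (pow_R1_Rle _ 6 (wt_ge1 k)). split.
    - apply Rinv_0_lt_compat; lra.
    - rewrite <- Rinv_1. apply Rinv_le_contravar; lra. }
  assert (h3 : zsum 1 (fun k => / wt k ^ 6) <= 3).
  { cbn [zsum]. pose proof (h1 0%Z). pose proof (h1 (Z.of_nat 1)).
    pose proof (h1 (- Z.of_nat 1)%Z). lra. }
  destruct N as [|N]; [cbn [zsum]; pose proof (h1 0%Z); lra|].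
  pose proof (zsum_wt_inv_tail 1 (S N) ltac:(lia) ltac:(lia)) as t.
  rewrite INR_1, sqrt_1, Rinv_1 in t.
  assert (0 < / sqrt (INR (S N)))
    by (apply Rinv_0_lt_compat, sqrt_lt_R0, lt_0_INR; lia).
  lra.
Qed.

(** Weighted l^2 balls, through partial sums: the bounds are then stable under
    coefficientwise limits and need no separate convergence arguments. *)
Definition wball (w : Z -> R) (a : distr) (M : R) : Prop :=
  0 <= M /\ forall N, zsum N (fun k => (w k * Cmod (a k)) ^ 2) <= M ^ 2.

(** The weights of H^{3/4}, L^2 and H^1.  In the names of lemmas, [X], [L] and [1]
    stand for these three spaces. *)
Definition wX (k : Z) : R := wt k ^ 3.
Definition wL (_ : Z) : R := 1.
Definition w1 (k : Z) : R := wt k ^ 4.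

Lemma wX_pos k : 0 < wX k.
Proof. apply pow_lt, wt_pos. Qed.

Lemma wL_pos k : 0 < wL k.
Proof. unfold wL; lra. Qed.

Lemma w1_pos k : 0 < w1 k.
Proof. apply pow_lt, wt_pos. Qed.

Lemma wball_ge0 w a M : wball w a M -> 0 <= M.
Proof. now intros [h _]. Qed.

Lemma wball_le w a M M' : wball w a M -> M <= M' -> wball w a M'.
Proof.
  intros [h0 h] hM; split; [lra|]. intros N; specialize (h N). nra.
Qed.

Lemma wball_dom w w' a b c M :
  0 <= c -> (forall k, 0 <= w' k * Cmod (b k) <= c * (w k * Cmod (a k))) ->
  wball w a M -> wball w' b (c * M).
Proof.
  intros hc hd [h0 h]. split; [nra|]. intros N.
  apply Rle_trans with (zsum N (fun k => c ^ 2 * (w k * Cmod (a k)) ^ 2)).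
  - apply zsum_le. intros k _. rewrite <- Rpow_mult_distr. apply pow_incr, hd.
  - rewrite zsum_scal, Rpow_mult_distr. apply Rmult_le_compat_l; [apply pow2_ge_0|apply h].
Qed.

Lemma wball_same w a b M :
  (forall k, 0 <= w k) -> (forall k, Cmod (b k) = Cmod (a k)) ->
  wball w a M -> wball w b M.
Proof.
  intros hw e h. rewrite <- (Rmult_1_l M). apply wball_dom with w a; [lra| |exact h].
  intros k; rewrite e. pose proof (hw k). pose proof (Cmod_ge_0 (a k)).
  split; [now apply Rmult_le_pos|lra].
Qed.

Lemma wball_ext w a b M : (forall k, a k = b k) -> wball w a M -> wball w b M.
Proof.
  intros e [h0 h]; split; [easy|]. intros N.
  rewrite (zsum_ext N _ (fun k => (w k * Cmod (a k)) ^ 2)); auto.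
  intros; now rewrite e.
Qed.

Lemma wball_plus w a b A B :
  (forall k, 0 <= w k) -> wball w a A -> wball w b B ->
  wball w (fun k => (a k + b k)%C) (A + B).
Proof.
  intros hw [hA ha] [hB hb]. split; [lra|]. intros N.
  eapply Rle_trans; [|apply (zsum_minkowski N _ _ A B hA hB (ha N) (hb N))].
  apply zsum_le. intros k _. apply pow_incr.
  pose proof (Cmod_triangle (a k) (b k)). pose proof (hw k).
  split; [apply Rmult_le_pos; auto; apply Cmod_ge_0|].
  rewrite <- Rmult_plus_distr_l. now apply Rmult_le_compat_l.
Qed.

Lemma wball_scal w c a A :
  (forall k, 0 <= w k) -> wball w a A -> wball w (fun k => (c * a k)%C) (Cmod c * A).
Proof.
  intros hw. apply wball_dom; [apply Cmod_ge_0|]. intros k.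
  rewrite Cmod_mult. pose proof (Cmod_ge_0 c). pose proof (Cmod_ge_0 (a k)).
  pose proof (hw k). split; [repeat apply Rmult_le_pos; auto|nra].
Qed.

Lemma wball_minus w a b A B :
  (forall k, 0 <= w k) -> wball w a A -> wball w b B ->
  wball w (fun k => (a k - b k)%C) (A + B).
Proof.
  intros hw ha hb.
  apply (wball_same w b (fun k => (- b k)%C)) in hb; auto; [|intros; apply Cmod_opp].
  exact (wball_plus w _ _ A B hw ha hb).
Qed.

Lemma wball_zero w : wball w (fun _ => 0%C) 0.
Proof.
  split; [lra|]. intros N. rewrite (zsum_ext N _ (fun _ => 0)).
  - rewrite zsum_zero; lra.
  - intros; rewrite Cmod_0; ring.
Qed.

Lemma wball_term w a M k : (forall k, 0 <= w k) -> wball w a M -> w k * Cmod (a k) <= M.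
Proof.
  intros hw [h0 h]. apply Rsqr_incr_0_var; [|exact h0].
  rewrite !Rsqr_pow2. eapply Rle_trans; [|apply (h (Z.abs_nat k))].
  apply (zsum_ge_term _ (fun k => (w k * Cmod (a k)) ^ 2)); [|lia].
  auto.
Qed.

Lemma is_lim_seq_zsum N (u : nat -> Z -> R) (l : Z -> R) :
  (forall k, is_lim_seq (fun n => u n k) (l k)) ->
  is_lim_seq (fun n => zsum N (u n)) (zsum N l).
Proof.
  intros h; induction N as [|N IH]; cbn [zsum]; [apply h|].
  repeat apply is_lim_seq_plus'; auto.
Qed.

(** Fatou's lemma: the bound only involves finite sums, which pass to the limit
    one by one. *)
Lemma wball_lim w (u : nat -> distr) a M :
  (forall n, wball w (u n) M) -> (forall k, Clim_seq (fun n => u n k) (a k)) ->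
  wball w a M.
Proof.
  intros h hl. split; [apply (h 0%nat)|]. intros N.
  assert (L : is_lim_seq (fun n => zsum N (fun k => (w k * Cmod (u n k)) ^ 2))
                (zsum N (fun k => (w k * Cmod (a k)) ^ 2))).
  { apply (is_lim_seq_zsum N (fun n k => (w k * Cmod (u n k)) ^ 2)). intros k.
    cbn. repeat apply is_lim_seq_mult'; try apply is_lim_seq_const;
      now apply Clim_Cmod. }
  apply (is_lim_seq_le _ _ _ _ (fun n => proj2 (h n) N) L (is_lim_seq_const _)).
Qed.

Lemma wball_conj w a M :
  (forall k, w (- k)%Z = w k) -> wball w a M -> wball w (conj_distr a) M.
Proof.
  intros e [h0 h]; split; [easy|]. intros N.
  rewrite <- zsum_neg.
  rewrite (zsum_ext N _ (fun k => (w k * Cmod (a k)) ^ 2)); [apply h|].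
  intros k _. unfold conj_distr. rewrite Z.opp_involutive, Cmod_conj, e. easy.
Qed.

Lemma wball_X_L a M : wball wX a M -> wball wL a M.
Proof.
  intros h. rewrite <- (Rmult_1_l M). apply wball_dom with wX a; [lra| |exact h].
  intros k. unfold wX, wL. pose proof (pow_R1_Rle _ 3 (wt_ge1 k)).
  pose proof (Cmod_ge_0 (a k)). nra.
Qed.

Lemma wball_1_X a M : wball w1 a M -> wball wX a M.
Proof.
  intros h. rewrite <- (Rmult_1_l M). apply wball_dom with w1 a; [lra| |exact h].
  intros k. unfold wX, w1. pose proof (pow_R1_Rle _ 3 (wt_ge1 k)).
  pose proof (wt_ge1 k).
  replace (wt k ^ 4) with (wt k * wt k ^ 3) by ring.
  pose proof (Cmod_ge_0 (a k)).
  split; [apply Rmult_le_pos; lra|]. rewrite Rmult_1_l.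
  apply Rmult_le_compat_r; nra.
Qed.

(** Cauchy-Schwarz against the summable weight [wt k ^ (-6)]. *)
Lemma wball_X_l1 a M N : wball wX a M -> zsum N (fun k => Cmod (a k)) <= 3 * M.
Proof.
  intros [h0 h]. apply Rsqr_incr_0_var; [|lra]. rewrite !Rsqr_pow2.
  rewrite (zsum_ext N _ (fun k => / wX k * (wX k * Cmod (a k)))).
  2:{ intros. pose proof (wX_pos k). field. lra. }
  eapply Rle_trans;
    [apply (zsum_cauchy_schwarz N (fun k => / wX k) (fun k => wX k * Cmod (a k)))|].
  rewrite (zsum_ext N (fun k => (/ wX k) ^ 2) (fun k => / wt k ^ 6)).
  2:{ intros. unfold wX. pose proof (wt_pos k). field. lra. }
  specialize (h N). pose proof (zsum_wt_inv_pow6 N).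
  assert (0 <= zsum N (fun k => / wt k ^ 6)).
  { apply zsum_ge0. intros. left. apply Rinv_0_lt_compat, pow_lt, wt_pos. }
  assert (0 <= zsum N (fun k => (wX k * Cmod (a k)) ^ 2))
    by (apply zsum_ge0; auto).
  nra.
Qed.

Lemma wball_X_summable a M : wball wX a M -> summable a.
Proof. intros h; exists (3 * M); intros N; now apply wball_X_l1. Qed.

Lemma wX_opp k : wX (- k) = wX k.
Proof. unfold wX; now rewrite wt_opp. Qed.

Lemma w1_opp k : w1 (- k) = w1 k.
Proof. unfold w1; now rewrite wt_opp. Qed.

Lemma in_H_of_wball s w a M :
  (forall k, Rpower (1 + IZR k ^ 2) s = w k ^ 2) -> wball w a M ->
  in_H s a /\ norm_H s a <= M.
Proof.
  intros e [h0 h].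
  destruct (ZSeries_le_bound (sobolev_term s a) (M ^ 2)) as [ex le].
  - intros k; unfold sobolev_term. rewrite e.
    apply Rmult_le_pos; apply pow2_ge_0.
  - intros N. eapply Rle_trans; [|apply (h N)].
    right; apply zsum_ext; intros; unfold sobolev_term; rewrite e; ring.
  - split; [exact ex|]. unfold norm_H. rewrite <- (sqrt_pow2 M h0).
    now apply sqrt_le_1_alt.
Qed.

Lemma wball_of_in_H s w a :
  (forall k, Rpower (1 + IZR k ^ 2) s = w k ^ 2) -> in_H s a ->
  wball w a (norm_H s a).
Proof.
  intros e h. split; [apply sqrt_pos|]. intros N.
  assert (pos : forall k, 0 <= sobolev_term s a k).
  { intros k; unfold sobolev_term. rewrite e.
    apply Rmult_le_pos; apply pow2_ge_0. }
  assert (le : zsum N (sobolev_term s a) <= ZSeries (sobolev_term s a))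
    by now apply zsum_le_ZSeries.
  unfold norm_H. rewrite pow2_sqrt.
  - eapply Rle_trans; [|exact le].
    right; apply zsum_ext; intros; unfold sobolev_term; rewrite e; ring.
  - eapply Rle_trans; [|exact le]. now apply zsum_ge0.
Qed.

Lemma sobolev_weight_X k : Rpower (1 + IZR k ^ 2) (3 / 4) = wX k ^ 2.
Proof.
  unfold wX. rewrite <- pow_mult, wt_pow. f_equal. cbn; lra.
Qed.

Lemma sobolev_weight_1 k : Rpower (1 + IZR k ^ 2) 1 = w1 k ^ 2.
Proof.
  unfold w1. rewrite <- pow_mult, wt_pow. f_equal. cbn; lra.
Qed.

Lemma sobolev_weight_0 k : Rpower (1 + IZR k ^ 2) 0 = wL k ^ 2.
Proof. rewrite Rpower_O by apply one_plus_sqr_pos. unfold wL; ring. Qed.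

Lemma sobolev_weight_neg k : Rpower (1 + IZR k ^ 2) (- 1 / 4) = (/ wt k) ^ 2.
Proof.
  replace (- 1 / 4) with (- (1 / 8 * INR 2)) by (cbn; lra).
  rewrite Rpower_Ropp, <- wt_pow. pose proof (wt_pos k). field. lra.
Qed.

(** * Weighted convolutions *)

(** Convolution twisted by a kernel.  Phases that the free flow attaches to the
    factors of a product, and differences of such phases, are of this form. *)
Definition tconv (kap : Z -> Z -> C) (a b : distr) : distr :=
  fun k => CZSeries (fun l => (kap l (k - l)%Z * (a l * b (k - l)%Z))%C).

Definition conv (a b : distr) : distr := tconv (fun _ _ => 1%C) a b.

(** The kernel, normalized by the weights, is dominated by a sum of two parts,
    each square summable in one of the frequencies uniformly in the other one.
    This is what the Cauchy-Schwarz argument of [schur_left] and [schur_right]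
    can absorb. *)
Definition schur_kernel (S : R) (w wa wb : Z -> R) (kap : Z -> Z -> C) : Prop :=
  0 <= S /\ exists k1 k2 : Z -> Z -> R,
    (forall l j, 0 <= k1 l j) /\ (forall l j, 0 <= k2 l j) /\
    (forall l j, w (l + j)%Z * Cmod (kap l j) <= (k1 l j + k2 l j) * (wa l * wb j)) /\
    (forall j N, zsum N (fun l => k1 l j ^ 2) <= S ^ 2) /\
    (forall l N, zsum N (fun j => k2 l j ^ 2) <= S ^ 2).

Lemma zsum_reflect_shift_le N k f :
  (forall l, 0 <= f l) -> zsum N (fun l => f (k - l)%Z) <= zsum (N + Z.abs_nat k) f.
Proof.
  intros hf. rewrite <- zsum_neg.
  rewrite (zsum_ext N _ (fun l => f (l - - k)%Z)) by (intros; f_equal; lia).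
  replace (Z.abs_nat k) with (Z.abs_nat (- k)) by lia. now apply zsum_shift_le.
Qed.

Lemma zsum_uniform_shift_le N K f : (forall l, 0 <= f l) ->
  forall l, (Z.abs l <= Z.of_nat N)%Z ->
  zsum K (fun k => f (k - l)%Z) <= zsum (K + N) f.
Proof.
  intros hf l hl. eapply Rle_trans; [now apply zsum_shift_le|].
  apply zsum_mono; [easy|lia].
Qed.

(** Cauchy-Schwarz in [l] isolates [al]; the remaining double sum is taken over
    [l] and [j = k - l], and the sum over [l] of the squared kernel is bounded
    first. *)
Lemma schur_left S A B (k1 : Z -> Z -> R) (al be : Z -> R) N K :
  (forall j N, zsum N (fun l => k1 l j ^ 2) <= S ^ 2) ->
  (forall N, zsum N (fun l => al l ^ 2) <= A ^ 2) ->
  (forall N, zsum N (fun l => be l ^ 2) <= B ^ 2) ->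
  zsum K (fun k => zsum N (fun l => k1 l (k - l)%Z * (al l * be (k - l)%Z)) ^ 2)
  <= (S * A * B) ^ 2.
Proof.
  intros hk ha hb.
  apply Rle_trans with (zsum K (fun k =>
    A ^ 2 * zsum N (fun l => k1 l (k - l)%Z ^ 2 * be (k - l)%Z ^ 2))).
  { apply zsum_le; intros k _.
    rewrite (zsum_ext N _ (fun l => al l * (k1 l (k - l)%Z * be (k - l)%Z)))
      by (intros; ring).
    eapply Rle_trans;
      [apply (zsum_cauchy_schwarz N al (fun l => k1 l (k - l)%Z * be (k - l)%Z))|].
    apply Rmult_le_compat; try apply zsum_ge0; intros; try apply pow2_ge_0; auto.
    apply zsum_le; intros; right; ring. }
  rewrite zsum_scal, zsum_swap.
  replace ((S * A * B) ^ 2) with (A ^ 2 * (S ^ 2 * B ^ 2)) by ring.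
  apply Rmult_le_compat_l; [apply pow2_ge_0|].
  apply Rle_trans with
    (zsum N (fun l => zsum (K + N) (fun j => k1 l j ^ 2 * be j ^ 2))).
  { apply zsum_le; intros l hl.
    apply (zsum_uniform_shift_le N K (fun j => k1 l j ^ 2 * be j ^ 2)); auto.
    intros; apply Rmult_le_pos; apply pow2_ge_0. }
  rewrite zsum_swap.
  apply Rle_trans with (zsum (K + N) (fun j => S ^ 2 * be j ^ 2)).
  - apply zsum_le; intros j _.
    rewrite (zsum_ext N _ (fun l => be j ^ 2 * k1 l j ^ 2)) by (intros; ring).
    rewrite zsum_scal, Rmult_comm.
    apply Rmult_le_compat_r; [apply pow2_ge_0|apply hk].
  - rewrite zsum_scal. apply Rmult_le_compat_l; [apply pow2_ge_0|apply hb].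
Qed.

(** The same with the two factors exchanged. *)
Lemma schur_right S A B (k2 : Z -> Z -> R) (al be : Z -> R) N K :
  (forall l N, zsum N (fun j => k2 l j ^ 2) <= S ^ 2) ->
  (forall N, zsum N (fun l => al l ^ 2) <= A ^ 2) ->
  (forall N, zsum N (fun l => be l ^ 2) <= B ^ 2) ->
  zsum K (fun k => zsum N (fun l => k2 l (k - l)%Z * (al l * be (k - l)%Z)) ^ 2)
  <= (S * A * B) ^ 2.
Proof.
  intros hk ha hb.
  apply Rle_trans with (zsum K (fun k =>
    B ^ 2 * zsum N (fun l => al l ^ 2 * k2 l (k - l)%Z ^ 2))).
  { apply zsum_le; intros k _.
    rewrite (zsum_ext N _ (fun l => be (k - l)%Z * (al l * k2 l (k - l)%Z)))
      by (intros; ring).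
    eapply Rle_trans;
      [apply (zsum_cauchy_schwarz N (fun l => be (k - l)%Z) (fun l => al l * k2 l (k - l)%Z))|].
    apply Rmult_le_compat; try apply zsum_ge0; intros; try apply pow2_ge_0.
    - eapply Rle_trans; [apply (zsum_reflect_shift_le N k (fun j => be j ^ 2))|apply hb].
      auto.
    - apply zsum_le; intros; right; ring. }
  rewrite zsum_scal, zsum_swap.
  replace ((S * A * B) ^ 2) with (B ^ 2 * (S ^ 2 * A ^ 2)) by ring.
  apply Rmult_le_compat_l; [apply pow2_ge_0|].
  apply Rle_trans with (zsum N (fun l => S ^ 2 * al l ^ 2)).
  - apply zsum_le; intros l hl. rewrite zsum_scal, Rmult_comm.
    apply Rmult_le_compat_r; [apply pow2_ge_0|].
    eapply Rle_trans; [|apply (hk l (K + N)%nat)].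
    apply (zsum_uniform_shift_le N K (fun j => k2 l j ^ 2)); auto.
    auto.
  - rewrite zsum_scal. apply Rmult_le_compat_l; [apply pow2_ge_0|apply ha].
Qed.

(** Real partial sums with absolute values: they give at once the convergence
    of the series in [l] and the bounds on its partial sums and its value. *)
Lemma schur_abs S w wa wb kap a b A B N :
  (forall k, 0 <= w k) -> (forall k, 0 <= wa k) -> (forall k, 0 <= wb k) ->
  schur_kernel S w wa wb kap -> wball wa a A -> wball wb b B ->
  wball w (fun k => RtoC (zsum N (fun l => Cmod (kap l (k - l)%Z * (a l * b (k - l)%Z)))))
    (2 * S * A * B).
Proof.
  intros hw hwa hwb [hS (k1 & k2 & p1 & p2 & hk & s1 & s2)] [hA ha] [hB hb].
  split; [repeat apply Rmult_le_pos; lra|]. intros K.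
  set (al := fun l => wa l * Cmod (a l)). set (be := fun l => wb l * Cmod (b l)).
  replace (2 * S * A * B) with (S * A * B + S * A * B) by ring.
  assert (pS : 0 <= S * A * B) by (repeat apply Rmult_le_pos; auto).
  eapply Rle_trans;
    [|apply (zsum_minkowski K _ _ _ _ pS pS (schur_left S A B k1 al be N K s1 ha hb)
              (schur_right S A B k2 al be N K s2 ha hb))].
  apply zsum_le; intros k _. apply pow_incr. rewrite Cmod_R, Rabs_pos_eq.
  2:{ apply zsum_ge0; auto. }
  split; [apply Rmult_le_pos; auto; apply zsum_ge0; auto|].
  rewrite <- zsum_scal, <- zsum_plus. apply zsum_le; intros l _.
  unfold al, be. rewrite !Cmod_mult.
  specialize (hk l (k - l)%Z). replace (l + (k - l))%Z with k in hk by lia.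
  pose proof (Rmult_le_pos _ _ (Cmod_ge_0 (a l)) (Cmod_ge_0 (b (k - l)%Z))). nra.
Qed.

Lemma schur_summable S w wa wb kap a b A B k :
  (forall k, 0 < w k) -> (forall k, 0 <= wa k) -> (forall k, 0 <= wb k) ->
  schur_kernel S w wa wb kap -> wball wa a A -> wball wb b B ->
  summable (fun l => (kap l (k - l)%Z * (a l * b (k - l)%Z))%C).
Proof.
  intros hw hwa hwb hs ha hb. exists (2 * S * A * B / w k). intros N.
  pose proof (wball_term _ _ _ k (fun k => Rlt_le _ _ (hw k))
    (schur_abs S w wa wb kap a b A B N (fun k => Rlt_le _ _ (hw k)) hwa hwb hs ha hb)) as h.
  cbv beta in h. rewrite Cmod_R, Rabs_pos_eq in h by (apply zsum_ge0; auto).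
  apply Rmult_le_reg_l with (w k); [apply hw|].
  replace (w k * (2 * S * A * B / w k)) with (2 * S * A * B); [exact h|].
  field. apply Rgt_not_eq, hw.
Qed.

Lemma wball_tconv_partial S w wa wb kap a b A B N :
  (forall k, 0 <= w k) -> (forall k, 0 <= wa k) -> (forall k, 0 <= wb k) ->
  schur_kernel S w wa wb kap -> wball wa a A -> wball wb b B ->
  wball w (fun k => czsum N (fun l => (kap l (k - l)%Z * (a l * b (k - l)%Z))%C))
    (2 * S * A * B).
Proof.
  intros hw hwa hwb hs ha hb. rewrite <- (Rmult_1_l (2 * S * A * B)).
  eapply wball_dom; [lra| |apply (schur_abs S w wa wb kap a b A B N); eauto].
  intros k. rewrite Rmult_1_l, Cmod_R, Rabs_pos_eq
    by (apply zsum_ge0; auto).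
  pose proof (hw k). split; [apply Rmult_le_pos; auto; apply Cmod_ge_0|].
  apply Rmult_le_compat_l; auto. apply Cmod_czsum_le.
Qed.

Lemma wball_tconv S w wa wb kap a b A B :
  (forall k, 0 < w k) -> (forall k, 0 <= wa k) -> (forall k, 0 <= wb k) ->
  schur_kernel S w wa wb kap -> wball wa a A -> wball wb b B ->
  wball w (tconv kap a b) (2 * S * A * B).
Proof.
  intros hw hwa hwb hs ha hb.
  apply (wball_lim w (fun N k => czsum N (fun l => (kap l (k - l)%Z * (a l * b (k - l)%Z))%C))).
  - intros N; apply (wball_tconv_partial S w wa wb kap a b A B N); auto.
    intros k; apply Rlt_le, hw.
  - intros k. apply CZSeries_lim. now apply (schur_summable S w wa wb kap a b A B).
Qed.

Lemma inv_wX_sqr_sum N : zsum N (fun l => (/ wX l) ^ 2) <= 3 ^ 2.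
Proof.
  rewrite (zsum_ext N _ (fun k => / wt k ^ 6)).
  - pose proof (zsum_wt_inv_pow6 N); lra.
  - intros. unfold wX. pose proof (wt_pos k). field. lra.
Qed.

Lemma schur_XX kap c : 0 <= c -> (forall l j, Cmod (kap l j) <= c) ->
  schur_kernel (24 * c) wX wX wX kap.
Proof.
  intros h0 h. split; [lra|].
  exists (fun l j => 8 * c * / wX l), (fun l j => 8 * c * / wX j).
  assert (p : forall k, 0 < / wX k) by (intros; apply Rinv_0_lt_compat, wX_pos).
  assert (q : forall N, zsum N (fun l => (8 * c * / wX l) ^ 2) <= (24 * c) ^ 2).
  { intros N. rewrite (zsum_ext N _ (fun l => (8 * c) ^ 2 * (/ wX l) ^ 2))
      by (intros; ring).
    rewrite zsum_scal. pose proof (inv_wX_sqr_sum N). pose proof (pow2_ge_0 (8 * c)).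
    nra. }
  split; [|split; [|split; [|split; intros; apply q]]].
  - intros l _; pose proof (p l); nra.
  - intros _ j; pose proof (p j); nra.
  - intros l j. pose proof (wX_pos l). pose proof (wX_pos j).
    replace ((8 * c * / wX l + 8 * c * / wX j) * (wX l * wX j))
      with (8 * (wX l + wX j) * c) by (field; lra).
    apply Rmult_le_compat; auto; [apply Rlt_le, wX_pos|].
    apply wt_pow3_add_le.
Qed.

Lemma schur_XL kap c : 0 <= c -> (forall l j, Cmod (kap l j) <= c) ->
  schur_kernel (3 * c) wL wX wL kap.
Proof.
  intros h0 h. split; [lra|].
  exists (fun l j => c * / wX l), (fun l j => 0).
  assert (p : forall k, 0 < / wX k) by (intros; apply Rinv_0_lt_compat, wX_pos).
  split; [|split; [|split; [|split]]].
  - intros l _; pose proof (p l); nra.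
  - intros; lra.
  - intros l j. pose proof (wX_pos l). unfold wL.
    replace ((c * / wX l + 0) * (wX l * 1)) with c by (field; lra).
    rewrite Rmult_1_l; apply h.
  - intros _ N. rewrite (zsum_ext N _ (fun l => c ^ 2 * (/ wX l) ^ 2))
      by (intros; ring).
    rewrite zsum_scal. pose proof (inv_wX_sqr_sum N). pose proof (pow2_ge_0 c).
    nra.
  - intros _ N. rewrite (zsum_ext N _ (fun _ => 0)) by (intros; ring).
    rewrite zsum_zero; apply pow2_ge_0.
Qed.

Lemma schur_sym S w wa wb kap :
  schur_kernel S w wa wb kap -> schur_kernel S w wb wa (fun l j => kap j l).
Proof.
  intros [h0 (k1 & k2 & p1 & p2 & hk & s1 & s2)]. split; [exact h0|].
  exists (fun l j => k2 j l), (fun l j => k1 j l).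
  split; [|split; [|split; [|split]]]; auto.
  intros l j. rewrite Z.add_comm. eapply Rle_trans; [apply hk|right; ring].
Qed.

Lemma schur_LX kap c : 0 <= c -> (forall l j, Cmod (kap l j) <= c) ->
  schur_kernel (3 * c) wL wL wX kap.
Proof. intros h0 h. now apply (schur_sym _ _ _ _ (fun l j => kap j l)), schur_XL. Qed.

Lemma zsum_low_count N J f c : 0 <= c ->
  (forall l, 0 <= f l <= c) ->
  (forall l, (Z.of_nat J < Z.abs l)%Z -> f l = 0) ->
  zsum N f <= (2 * INR J + 1) * c.
Proof.
  intros hc hf h0. induction N as [|N IH].
  - cbn [zsum]. pose proof (hf 0%Z). pose proof (pos_INR J). nra.
  - destruct (Nat.le_gt_cases (S N) J) as [le|gt].
    + assert (L : zsum (S N) f <= (2 * INR (S N) + 1) * c).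
      { clear - hf. induction (S N) as [|n IH].
        - cbn [zsum]. pose proof (hf 0%Z). cbn [INR]. lra.
        - cbn [zsum]. rewrite S_INR. pose proof (hf (Z.of_nat (S n))).
          pose proof (hf (- Z.of_nat (S n))%Z). lra. }
      apply le_INR in le. nra.
    + cbn [zsum]. rewrite !h0 by lia. lra.
Qed.

(** The lower of the two frequencies is one derivative, split as
    H^{1/4} x H^{1/4} -> L^2.  Where [l] is the lower frequency, the normalized
    kernel is [wt l / wt j ^ 3]; its square is at most [wt j ^ (-4)], and there
    are about [wt j ^ 4] such [l].  The powers balance exactly: this is why the
    regularity 3/4 is enough for first order convergence. *)
Lemma schur_defect kap c : 0 <= c ->
  (forall l j, Cmod (kap l j) <= c * wt l ^ 4 /\ Cmod (kap l j) <= c * wt j ^ 4) ->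
  schur_kernel (2 * c) wL wX wX kap.
Proof.
  intros h0 h. split; [lra|].
  (* The normalized kernel on the region where the first frequency is lower. *)
  set (low := fun l j => if Z_le_gt_dec (Z.abs l) (Z.abs j)
                         then c * (wt l * / wX j) else 0).
  assert (pos : forall l j, 0 <= wt l * / wX j).
  { intros l j. pose proof (wt_pos l).
    pose proof (Rinv_0_lt_compat _ (wX_pos j)). nra. }
  assert (lpos : forall l j, 0 <= low l j).
  { intros l j; unfold low; destruct Z_le_gt_dec; [|lra].
    pose proof (pos l j). nra. }
  assert (main : forall j N, zsum N (fun l => low l j ^ 2) <= (2 * c) ^ 2).
  { intros j N.
    apply Rle_trans with
      ((2 * INR (Z.abs_nat j) + 1) * (c * (wt j * / wX j)) ^ 2).
    - apply zsum_low_count; [apply pow2_ge_0| |].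
      + intros l. split; [apply pow2_ge_0|]. apply pow_incr. split; [apply lpos|].
        unfold low; destruct Z_le_gt_dec as [le|_].
        * apply Rmult_le_compat_l; [easy|]. apply Rmult_le_compat_r.
          -- apply Rlt_le, Rinv_0_lt_compat, wX_pos.
          -- apply wt_mono. rewrite <- !abs_IZR. now apply IZR_le.
        * pose proof (pos j j). nra.
      + intros l hl. unfold low; destruct Z_le_gt_dec; [lia|ring].
    - rewrite INR_IZR_INZ, Zabs2Nat.id_abs, abs_IZR.
      unfold wX. pose proof (wt_ge1 j).
      replace ((c * (wt j * / wt j ^ 3)) ^ 2) with (c ^ 2 * / wt j ^ 4) by (field; lra).
      pose proof (wt_pow4_ge_abs j). pose proof (pow_R1_Rle _ 4 (wt_ge1 j)).
      apply Rle_trans with ((3 * wt j ^ 4) * (c ^ 2 * / wt j ^ 4)).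
      + apply Rmult_le_compat_r; [|lra].
        apply Rmult_le_pos; [apply pow2_ge_0|]. apply Rlt_le, Rinv_0_lt_compat; lra.
      + replace (3 * wt j ^ 4 * (c ^ 2 * / wt j ^ 4)) with (3 * c ^ 2) by (field; lra).
        pose proof (pow2_ge_0 c). lra. }
  exists low, (fun l j => low j l).
  split; [|split; [|split; [|split]]]; auto.
  intros l j. unfold wL; rewrite Rmult_1_l. destruct (h l j) as [hl hj].
  pose proof (lpos l j) as pl. pose proof (lpos j l) as pj.
  pose proof (wX_pos l). pose proof (wX_pos j).
  assert (pp : 0 < wX l * wX j) by now apply Rmult_lt_0_compat.
  destruct (Z_le_gt_dec (Z.abs l) (Z.abs j)) as [le|gt].
  - eapply Rle_trans; [exact hl|].
    apply Rle_trans with (low l j * (wX l * wX j)); [|apply Rmult_le_compat_r; lra].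
    unfold low; destruct Z_le_gt_dec; [|lia]. right. unfold wX. pose proof (wt_pos j).
    field. lra.
  - eapply Rle_trans; [exact hj|].
    apply Rle_trans with (low j l * (wX l * wX j)); [|apply Rmult_le_compat_r; lra].
    unfold low; destruct Z_le_gt_dec; [|lia]. right. unfold wX. pose proof (wt_pos l).
    field. lra.
Qed.

(** * Fourier series with summable coefficients *)

Lemma wX_ge0 k : 0 <= wX k.
Proof. apply Rlt_le, wX_pos. Qed.

Lemma wL_ge0 k : 0 <= wL k.
Proof. apply Rlt_le, wL_pos. Qed.

Lemma w1_ge0 k : 0 <= w1 k.
Proof. apply Rlt_le, w1_pos. Qed.

#[local] Hint Resolve wX_pos wL_pos w1_pos wX_ge0 wL_ge0 w1_ge0 : core.

Lemma tconv_summable_XL kap c a b A B k :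
  0 <= c -> (forall l j, Cmod (kap l j) <= c) -> wball wX a A -> wball wL b B ->
  summable (fun l => (kap l (k - l)%Z * (a l * b (k - l)%Z))%C).
Proof.
  intros h0 h ha hb.
  apply schur_summable with (3 * c) wL wX wL A B; auto. now apply schur_XL.
Qed.

Lemma tconv_summable_LX kap c a b A B k :
  0 <= c -> (forall l j, Cmod (kap l j) <= c) -> wball wL a A -> wball wX b B ->
  summable (fun l => (kap l (k - l)%Z * (a l * b (k - l)%Z))%C).
Proof.
  intros h0 h ha hb.
  apply schur_summable with (3 * c) wL wL wX A B; auto. now apply schur_LX.
Qed.

Lemma Cmod_one_le (l j : Z) : Cmod 1%C <= 1.
Proof. rewrite Cmod_1; lra. Qed.

Lemma wball_conv_XX a b A B : wball wX a A -> wball wX b B -> wball wX (conv a b) (48 * A * B).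
Proof.
  intros ha hb. replace (48 * A * B) with (2 * (24 * 1) * A * B) by ring.
  apply wball_tconv with wX wX; auto. apply schur_XX; [lra|apply Cmod_one_le].
Qed.

Lemma wball_conv_XL a b A B : wball wX a A -> wball wL b B -> wball wL (conv a b) (6 * A * B).
Proof.
  intros ha hb. replace (6 * A * B) with (2 * (3 * 1) * A * B) by ring.
  apply wball_tconv with wX wL; auto. apply schur_XL; [lra|apply Cmod_one_le].
Qed.

Lemma wball_conv_LX a b A B : wball wL a A -> wball wX b B -> wball wL (conv a b) (6 * A * B).
Proof.
  intros ha hb. replace (6 * A * B) with (2 * (3 * 1) * A * B) by ring.
  apply wball_tconv with wL wX; auto. apply schur_LX; [lra|apply Cmod_one_le].
Qed.

Lemma conv_summable a b A B k : wball wX a A -> wball wX b B ->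
  summable (fun l => (1 * (a l * b (k - l)%Z))%C).
Proof.
  intros ha hb.
  apply (tconv_summable_XL (fun _ _ => 1%C) 1 a b A B);
    auto using wball_X_L; [lra|apply Cmod_one_le].
Qed.

Lemma conv_minus_l a a' b A A' B k :
  wball wL a A -> wball wL a' A' -> wball wX b B ->
  conv (fun j => (a j - a' j)%C) b k = (conv a b k - conv a' b k)%C.
Proof.
  intros ha ha' hb. unfold conv, tconv. rewrite <- CZSeries_minus.
  - apply CZSeries_ext; intros; ring.
  - apply (tconv_summable_LX (fun _ _ => 1%C) 1 a b A B); auto; [lra|apply Cmod_one_le].
  - apply (tconv_summable_LX (fun _ _ => 1%C) 1 a' b A' B); auto; [lra|apply Cmod_one_le].
Qed.

Lemma conv_minus_r a b b' A B B' k :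
  wball wX a A -> wball wL b B -> wball wL b' B' ->
  conv a (fun j => (b j - b' j)%C) k = (conv a b k - conv a b' k)%C.
Proof.
  intros ha hb hb'. unfold conv, tconv. rewrite <- CZSeries_minus.
  - apply CZSeries_ext; intros; ring.
  - apply (tconv_summable_XL (fun _ _ => 1%C) 1 a b A B); auto; [lra|apply Cmod_one_le].
  - apply (tconv_summable_XL (fun _ _ => 1%C) 1 a b' A B'); auto; [lra|apply Cmod_one_le].
Qed.

Lemma Cexp_add z w : Cexp (z + w) = (Cexp z * Cexp w)%C.
Proof.
  unfold Cexp. change (Re (z + w)) with (Re z + Re w).
  change (Im (z + w)) with (Im z + Im w).
  rewrite exp_plus, cos_plus, sin_plus.
  apply injective_projections; cbn; ring.
Qed.

Lemma Cexp_0 : Cexp 0%C = 1%C.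
Proof. unfold Cexp; cbn. rewrite exp_0, cos_0, sin_0. apply injective_projections; cbn; ring. Qed.

Lemma Cexp_conj z : Cexp (Cconj z) = Cconj (Cexp z).
Proof.
  unfold Cexp, Cconj; cbn. unfold Re, Im; cbn. rewrite cos_neg, sin_neg. apply injective_projections; cbn; ring.
Qed.

Lemma Cexp_i (y : R) : Cexp (Ci * y)%C = (cos y, sin y).
Proof.
  unfold Cexp. replace (Re (Ci * y)%C) with 0 by (cbn; ring).
  replace (Im (Ci * y)%C) with y by (cbn; ring). rewrite exp_0. apply injective_projections; cbn; ring.
Qed.

Lemma Cmod_Cexp_i (y : R) : Cmod (Cexp (Ci * y)) = 1.
Proof.
  rewrite Cexp_i. unfold Cmod; cbn [fst snd].
  replace (cos y ^ 2 + sin y ^ 2) with 1; [apply sqrt_1|].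
  pose proof (sin2_cos2 y). unfold Rsqr in *; nra.
Qed.

(** The character [e^{ikx}]. *)
Definition mode (k : Z) (x : R) : C := Cexp (Ci * (IZR k * x)%R).

Lemma Cmod_mode k x : Cmod (mode k x) = 1.
Proof. apply Cmod_Cexp_i. Qed.

Lemma mode_add k l x : mode (k + l) x = (mode k x * mode l x)%C.
Proof.
  unfold mode. rewrite <- Cexp_add, plus_IZR. f_equal.
  rewrite Rmult_plus_distr_r, RtoC_plus; ring.
Qed.

Lemma mode_neg k x : Cexp (- (Ci * (IZR k * x)%R)) = mode (- k) x.
Proof.
  unfold mode. f_equal. rewrite opp_IZR.
  replace (- IZR k * x) with (- (IZR k * x)) by ring. rewrite RtoC_opp; ring.
Qed.

Lemma to_fun_summable a x : summable a -> summable (fun k => (a k * mode k x)%C).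
Proof.
  apply summable_le. intros k. rewrite Cmod_mult, Cmod_mode; lra.
Qed.

Lemma to_fun_plus a b x : summable a -> summable b ->
  to_fun (fun k => (a k + b k)%C) x = (to_fun a x + to_fun b x)%C.
Proof.
  intros ha hb. unfold to_fun.
  rewrite <- CZSeries_plus by (apply (to_fun_summable _ x); auto).
  apply CZSeries_ext; intros; ring.
Qed.

Lemma to_fun_scal c a x : summable a ->
  to_fun (fun k => (c * a k)%C) x = (c * to_fun a x)%C.
Proof.
  intros ha. unfold to_fun.
  rewrite <- CZSeries_scal by (apply (to_fun_summable _ x); auto).
  apply CZSeries_ext; intros; ring.
Qed.

Lemma to_fun_minus a b x : summable a -> summable b ->
  to_fun (fun k => (a k - b k)%C) x = (to_fun a x - to_fun b x)%C.
Proof.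
  intros ha hb. unfold to_fun.
  rewrite <- CZSeries_minus by (apply (to_fun_summable _ x); auto).
  apply CZSeries_ext; intros; ring.
Qed.

Lemma to_fun_ext a b x : (forall k, a k = b k) -> to_fun a x = to_fun b x.
Proof. intros h; apply CZSeries_ext; intros; now rewrite h. Qed.

Lemma to_fun_shift l b x : summable b ->
  to_fun (fun k => b (k - l)%Z) x = (mode l x * to_fun b x)%C.
Proof.
  intros hb.
  change (to_fun b x) with (CZSeries (fun k => (b k * mode k x)%C)).
  rewrite <- (CZSeries_shift l (fun k => (b k * mode k x)%C))
    by now apply to_fun_summable.
  rewrite <- CZSeries_scal.
  - apply CZSeries_ext; intros k.
    change (b (k - l)%Z * mode k x = mode l x * (b (k - l)%Z * mode (k - l) x))%C.
    replace (mode k x) with (mode (l + (k - l)) x) by (f_equal; lia).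
    rewrite mode_add; ring.
  - apply (summable_shift l (fun k => (b k * mode k x)%C)).
    now apply to_fun_summable.
Qed.

Lemma to_fun_conj a x : summable a ->
  to_fun (conj_distr a) x = Cconj (to_fun a x).
Proof.
  intros ha. unfold to_fun. rewrite <- CZSeries_conj.
  rewrite <- CZSeries_neg.
  - apply CZSeries_ext; intros k. unfold conj_distr. rewrite Z.opp_involutive.
    rewrite Cmult_conj. f_equal.
    change (mode (- k) x = Cconj (Cexp (Ci * (IZR k * x)%R))).
    rewrite <- Cexp_conj, <- mode_neg. f_equal.
    rewrite Cmult_conj. apply injective_projections; cbn; ring.
  - apply (to_fun_summable _ x). apply summable_neg in ha.
    apply summable_le with (2 := ha). intros k; unfold conj_distr.
    rewrite Cmod_conj; lra.
Qed.

Lemma wball_X_tail a M J N : wball wX a M -> (1 <= J)%nat -> (J <= N)%nat ->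
  (zsum N (fun k => Cmod (a k)) - zsum J (fun k => Cmod (a k))) ^ 2
  <= M ^ 2 * (4 / sqrt (INR J)).
Proof.
  intros [hM h] hJ hN.
  set (cut := fun (f : Z -> R) k => if Z_le_gt_dec (Z.abs k) (Z.of_nat J) then 0 else f k).
  assert (hcut : forall f n, (J <= n)%nat -> zsum n (cut f) = zsum n f - zsum J f).
  { intros f. induction 1 as [|n hn IH].
    - rewrite (zsum_ext J _ (fun _ => 0)), zsum_zero; [ring|].
      intros; unfold cut; now destruct Z_le_gt_dec.
    - cbn [zsum]. rewrite IH. unfold cut.
      destruct (Z_le_gt_dec (Z.abs (Z.of_nat (S n))) (Z.of_nat J)); [lia|].
      destruct (Z_le_gt_dec (Z.abs (- Z.of_nat (S n))) (Z.of_nat J)); [lia|]. ring. }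
  rewrite <- hcut by easy.
  rewrite (zsum_ext N _ (fun k => (wX k * Cmod (a k)) * cut (fun k => / wX k) k)).
  2:{ intros k _. unfold cut. destruct Z_le_gt_dec; [ring|].
      pose proof (wX_pos k). field; lra. }
  eapply Rle_trans; [apply (zsum_cauchy_schwarz N (fun k => wX k * Cmod (a k)))|].
  apply Rmult_le_compat; try (apply zsum_ge0; auto); [apply h|].
  rewrite (zsum_ext N _ (cut (fun k => / wt k ^ 6))).
  2:{ intros k _. unfold cut. destruct Z_le_gt_dec; [ring|].
      unfold wX. pose proof (wt_pos k). field; lra. }
  rewrite hcut by easy.
  eapply Rle_trans; [now apply zsum_wt_inv_tail|].
  assert (0 < / sqrt (INR N)) by (apply Rinv_0_lt_compat, sqrt_lt_R0, lt_0_INR; lia).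
  unfold Rdiv; lra.
Qed.

(** The l^1 tails are small uniformly on an H^{3/4} ball, so that only finitely
    many coefficients matter at a given precision.  This replaces Fubini and
    completeness arguments for products and power series. *)
Lemma to_fun_lim (u : nat -> distr) a M x :
  (forall n, wball wX (u n) M) -> (forall k, Clim_seq (fun n => u n k) (a k)) ->
  Clim_seq (fun n => to_fun (u n) x) (to_fun a x).
Proof.
  intros hu hl.
  assert (ha : wball wX a M) by now apply wball_lim with u.
  set (d := fun n k => (u n k - a k)%C).
  assert (hd : forall n, wball wX (d n) (M + M)) by (intros; apply wball_minus; auto).
  apply Clim_squeeze with (fun n => Cmod (to_fun (d n) x)).
  { intros n. unfold d. rewrite to_fun_minus; [lra|eapply wball_X_summable..]; eauto. }
  apply is_lim_seq_spec. intros eps. pose proof (cond_pos eps) as he.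
  (* [J] makes the tail estimate of [wball_X_tail] at most [eps / 2]. *)
  set (X := ((M + M) ^ 2 * 4 / (eps / 2) ^ 2)).
  destruct (INR_unbounded (X ^ 2)) as [J0 hJ0]. set (J := S J0).
  assert (hJ : X ^ 2 < INR J) by (unfold J; rewrite S_INR; lra).
  assert (tail : (M + M) ^ 2 * (4 / sqrt (INR J)) <= (eps / 2) ^ 2).
  { assert (hs : 0 < sqrt (INR J)) by (apply sqrt_lt_R0, lt_0_INR; unfold J; lia).
    assert (X <= sqrt (INR J)).
    { apply Rsqr_incr_0_var; [|lra]. rewrite Rsqr_sqrt by apply pos_INR.
      rewrite Rsqr_pow2; lra. }
    apply Rmult_le_reg_r with (sqrt (INR J)); [easy|].
    replace ((M + M) ^ 2 * (4 / sqrt (INR J)) * sqrt (INR J))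
      with ((eps / 2) ^ 2 * X) by (unfold X; field; lra).
    apply Rmult_le_compat_l; [apply pow2_ge_0|easy]. }
  assert (L : is_lim_seq (fun n => zsum J (fun k => Cmod (d n k))) 0).
  { rewrite <- (zsum_zero J). apply (is_lim_seq_zsum J (fun n k => Cmod (d n k))).
    intros k. rewrite <- Cmod_0. apply (Clim_Cmod (fun n => d n k)).
    assert (e : (a k - a k)%C = 0%C) by ring. rewrite <- e.
    apply Clim_minus; [apply hl|apply Clim_const]. }
  apply is_lim_seq_spec in L. destruct (L (mkposreal (eps / 2) ltac:(lra))) as [n0 hn0].
  exists n0. intros n hn. specialize (hn0 n hn).
  change (Rabs (zsum J (fun k => Cmod (d n k)) - 0) < eps / 2) in hn0.
  rewrite Rminus_0_r in hn0. rewrite Rminus_0_r, Rabs_pos_eq by apply Cmod_ge_0.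
  apply Rabs_lt_between in hn0.
  apply Rle_lt_trans with (zsum J (fun k => Cmod (d n k)) + eps / 2); [|lra].
  apply Cmod_CZSeries_le. intros N.
  rewrite (zsum_ext N _ (fun k => Cmod (d n k)))
    by (intros; change (Cmod (d n k * mode k x) = Cmod (d n k));
        rewrite Cmod_mult, Cmod_mode; ring).
  destruct (Nat.le_gt_cases J N) as [le|gt].
  - pose proof (wball_X_tail (d n) (M + M) J N (hd n) ltac:(unfold J; lia) le) as t.
    assert (zsum N (fun k => Cmod (d n k)) - zsum J (fun k => Cmod (d n k)) <= eps / 2);
      [|lra].
    apply Rsqr_incr_0_var; [|lra]. rewrite !Rsqr_pow2. lra.
  - pose proof (zsum_mono N J (fun k => Cmod (d n k)) (fun _ => Cmod_ge_0 _)
      ltac:(lia)). lra.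
Qed.

(** For the partial sums in [l] the identity is a finite combination of
    shifts. *)
Lemma to_fun_conv a b A B x : wball wX a A -> wball wX b B ->
  to_fun (conv a b) x = (to_fun a x * to_fun b x)%C.
Proof.
  intros ha hb.
  set (c := fun N k => czsum N (fun l => (1 * (a l * b (k - l)%Z))%C)).
  assert (s : schur_kernel (24 * 1) wX wX wX (fun _ _ => 1%C))
    by (apply schur_XX; [lra|apply Cmod_one_le]).
  assert (hc : forall N, wball wX (c N) (2 * (24 * 1) * A * B)).
  { intros N. apply (wball_tconv_partial (24 * 1) wX wX wX (fun _ _ => 1%C)); auto. }
  assert (sb : summable b) by (eapply wball_X_summable; eauto).
  assert (fin : forall N, to_fun (c N) x
            = (czsum N (fun l => (a l * mode l x)%C) * to_fun b x)%C).
  { assert (one : forall l, to_fun (fun k => (a l * b (k - l)%Z)%C) x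
                    = (a l * mode l x * to_fun b x)%C).
    { intros l. rewrite (to_fun_scal (a l) (fun k => b (k - l)%Z))
        by now apply summable_shift.
      rewrite to_fun_shift by easy. ring. }
    induction N as [|N IH].
    - rewrite czsum_0, <- one. apply to_fun_ext; intros k.
      unfold c. rewrite czsum_0. ring.
    - rewrite czsum_S, Cmult_plus_distr_r, <- IH, Cmult_plus_distr_r, <- !one.
      rewrite <- to_fun_plus, <- to_fun_plus.
      + apply to_fun_ext; intros k. unfold c. rewrite czsum_S. ring.
      + eapply wball_X_summable; apply hc.
      + apply summable_plus; apply (summable_scal _ (fun k => b (k - _)%Z)), summable_shift; easy.
      + apply (summable_scal _ (fun k => b (k - _)%Z)), summable_shift; easy.
      + apply (summable_scal _ (fun k => b (k - _)%Z)), summable_shift; easy. }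
  apply Clim_unique with (fun N => to_fun (c N) x).
  - apply to_fun_lim with (2 * (24 * 1) * A * B); [exact hc|].
    intros k. apply CZSeries_lim.
    apply (schur_summable (24 * 1) wX wX wX (fun _ _ => 1%C) a b A B); auto.
  - eapply Clim_ext; [intros; symmetry; apply fin|].
    apply Clim_mult; [|apply Clim_const]. apply CZSeries_lim.
    apply to_fun_summable. eapply wball_X_summable; eauto.
Qed.

(** * Recovering the coefficients *)

Lemma sin_2PI_IZR n : sin (IZR n * (2 * PI)) = 0.
Proof. rewrite (Rmult_comm 2), <- Rmult_assoc. apply sin_eq_0_1.
  exists (2 * n)%Z. rewrite mult_IZR. ring. Qed.

Lemma cos_2PI_IZR n : cos (IZR n * (2 * PI)) = 1.
Proof.
  replace (IZR n * (2 * PI)) with (2 * (IZR n * PI)) by ring.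
  rewrite cos_2a_sin. rewrite (sin_eq_0_1 (IZR n * PI)) by now exists n. ring.
Qed.

Lemma is_RInt_mode n (c : C) :
  is_RInt (V := C_R_CompleteNormedModule) (fun x => (c * mode n x)%C) 0 (2 * PI)
    (if Z.eq_dec n 0 then (RtoC (2 * PI) * c)%C else RtoC 0).
Proof.
  set (p := Re c). set (q := Im c).
  assert (em : forall x, (c * mode n x)%C
     = (p * cos (IZR n * x) - q * sin (IZR n * x),
        p * sin (IZR n * x) + q * cos (IZR n * x))).
  { intros x. unfold mode. rewrite Cexp_i. reflexivity. }
  eapply (is_RInt_ext (V := C_R_CompleteNormedModule));
    [intros x _; symmetry; apply em|].
  destruct (Z.eq_dec n 0) as [->|hn].
  - assert (e : (RtoC (2 * PI) * c)%C = ((2 * PI - 0) * p, (2 * PI - 0) * q))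
      by (apply injective_projections; unfold p, q, Re, Im; cbn; ring).
    rewrite e.
    apply (is_RInt_fct_extend_pair (U := R_NormedModule) (V := R_NormedModule)); cbn [fst snd].
    + eapply is_RInt_ext; [|apply (is_RInt_const (V := R_NormedModule) 0 (2 * PI) p)].
      intros x _; cbv beta. rewrite Rmult_0_l, cos_0, sin_0.
      match goal with |- ?u = ?v => change (@eq R u v) end. ring.
    + eapply is_RInt_ext; [|apply (is_RInt_const (V := R_NormedModule) 0 (2 * PI) q)].
      intros x _; cbv beta. rewrite Rmult_0_l, cos_0, sin_0.
      match goal with |- ?u = ?v => change (@eq R u v) end. ring.
  - assert (hn' : IZR n <> 0) by now apply not_0_IZR.
    set (f := fun x => (p * sin (IZR n * x) + q * cos (IZR n * x)) / IZR n).
    set (g := fun x => (q * sin (IZR n * x) - p * cos (IZR n * x)) / IZR n).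
    assert (e : RtoC 0 = (f (2 * PI) - f 0, g (2 * PI) - g 0)).
    { unfold f, g. rewrite (Rmult_0_r (IZR n)), sin_2PI_IZR, cos_2PI_IZR, sin_0, cos_0.
      apply injective_projections; cbn; field; easy. }
    rewrite e.
    apply (is_RInt_fct_extend_pair (U := R_NormedModule) (V := R_NormedModule)); cbn [fst snd].
    + apply (is_RInt_derive (V := R_CompleteNormedModule) f).
      * intros x _. unfold f. auto_derive; [easy|]. field; easy.
      * intros x _. apply (ex_derive_continuous (V := R_NormedModule)). auto_derive. easy.
    + apply (is_RInt_derive (V := R_CompleteNormedModule) g).
      * intros x _. unfold g. auto_derive; [easy|]. field; easy.
      * intros x _. apply (ex_derive_continuous (V := R_NormedModule)). auto_derive. easy.
Qed.

Lemma is_RInt_czsum N (f : Z -> R -> C) (l : Z -> C) a b :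
  (forall k, is_RInt (V := C_R_CompleteNormedModule) (f k) a b (l k)) ->
  is_RInt (V := C_R_CompleteNormedModule) (fun x => czsum N (fun k => f k x)) a b (czsum N l).
Proof.
  intros h. induction N as [|N IH].
  - rewrite czsum_0. eapply (is_RInt_ext (V := C_R_CompleteNormedModule)); [|apply h].
    intros x _; cbv beta. now rewrite czsum_0.
  - rewrite czsum_S.
    eapply (is_RInt_ext (V := C_R_CompleteNormedModule)); [intros x _; symmetry; apply czsum_S|].
    apply (is_RInt_plus (V := C_R_CompleteNormedModule)); [exact IH|].
    apply (is_RInt_plus (V := C_R_CompleteNormedModule)); apply h.
Qed.

(** With [T] the sum of the absolute values, this is a bound on the remainder
    that survives multiplication of the terms by characters, hence is uniform
    in [x]. *)
Lemma Cmod_CZSeries_tail a T N :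
  summable a -> (forall n, zsum n (fun k => Cmod (a k)) <= T) ->
  Cmod (CZSeries a - czsum N a) <= T - zsum N (fun k => Cmod (a k)).
Proof.
  intros sa hT.
  apply Clim_Cmod_le with (fun n => czsum (n + N) a - czsum N a)%C.
  - apply Clim_minus; [|apply Clim_const].
    destruct (CZSeries_lim a sa) as [h1 h2].
    split; [apply (is_lim_seq_incr_n (fun n => Re (czsum n a)) N)
           |apply (is_lim_seq_incr_n (fun n => Im (czsum n a)) N)]; assumption.
  - intros n. apply Rle_trans with
      (zsum (n + N) (fun k => Cmod (a k)) - zsum N (fun k => Cmod (a k)));
      [|specialize (hT (n + N)%nat); lra].
    induction n as [|n IH]; cbn [Nat.add].
    + unfold Cminus. rewrite Cplus_opp_r, Cmod_0; lra.
    + rewrite czsum_S; cbn [zsum].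
      set (t := (a (Z.of_nat (S (n + N))) + a (- Z.of_nat (S (n + N)))%Z)%C).
      replace (czsum (n + N) a + t - czsum N a)%C with ((czsum (n + N) a - czsum N a) + t)%C by ring.
      eapply Rle_trans; [apply Cmod_triangle|].
      assert (Cmod t <= Cmod (a (Z.of_nat (S (n + N)))) + Cmod (a (- Z.of_nat (S (n + N)))%Z))
        by apply Cmod_triangle.
      lra.
Qed.

(** Uniform convergence allows to integrate term by term. *)
Lemma fourier_to_fun c k : summable c -> fourier (to_fun c) k = c k.
Proof.
  intros sc.
  set (term := fun l x => (c l * mode (l - k) x)%C).
  set (lt := fun l => if Z.eq_dec (l - k) 0 then (RtoC (2 * PI) * c l)%C else RtoC 0).
  assert (hR : is_RInt (V := C_R_CompleteNormedModule)
     (fun x => (to_fun c x * Cexp (- (Ci * (IZR k * x)%R)))%C) 0 (2 * PI)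
     (RtoC (2 * PI) * c k)%C).
  { destruct sc as [M hM].
    assert (sc : summable c) by now exists M.
    assert (ex : ex_finite_lim_seq (fun N => zsum N (fun k => Cmod (c k)))).
    { apply ex_finite_lim_seq_incr with M; auto. intros n.
      apply zsum_mono; [auto|lia]. }
    destruct ex as [T hT].
    assert (leT : forall N, zsum N (fun k => Cmod (c k)) <= T).
    { intros N. apply is_lim_seq_incr_compare with (1 := hT).
      intros n; apply zsum_mono; [auto|lia]. }
    destruct (filterlim_RInt (V := C_R_CompleteNormedModule)
      (fun N x => czsum N (fun l => term l x)) 0 (2 * PI) eventually _
      (fun x => (to_fun c x * Cexp (- (Ci * (IZR k * x)%R)))%C)
      (fun N => czsum N lt)) as [If [hIf hint]].
    - intros N. apply (is_RInt_czsum N term lt). intros l. apply is_RInt_mode.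
    - apply filterlim_locally. intros eps.
      apply is_lim_seq_spec in hT. destruct (hT eps) as [n0 hn0].
      exists n0. intros n hn x. specialize (hn0 n hn).
      assert (D : Cmod (czsum n (fun l => term l x)
                  - to_fun c x * Cexp (- (Ci * (IZR k * x)%R))) < eps).
      { rewrite mode_neg.
        replace (czsum n (fun l => term l x)) with (mode (- k) x * czsum n (fun l => (c l * mode l x)%C))%C.
        2:{ rewrite <- czsum_scal. apply czsum_ext; intros l _. unfold term.
            replace (l - k)%Z with (- k + l)%Z by lia. rewrite mode_add; ring. }
        replace (_ - _)%C with (- (mode (- k) x * (to_fun c x - czsum n (fun l => (c l * mode l x)%C))))%C by ring.
        rewrite Cmod_opp, Cmod_mult, Cmod_mode, Rmult_1_l.
        eapply Rle_lt_trans; [apply (Cmod_CZSeries_tail (fun l => (c l * mode l x)%C) T)|].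
        - now apply to_fun_summable.
        - intros N. rewrite (zsum_ext N _ (fun k => Cmod (c k))); [apply leT|].
          intros; rewrite Cmod_mult, Cmod_mode; ring.
        - rewrite (zsum_ext n _ (fun k => Cmod (c k)))
            by (intros; rewrite Cmod_mult, Cmod_mode; ring).
          apply Rabs_lt_between in hn0. lra. }
      set (w := (czsum n (fun l => term l x)
                  - to_fun c x * Cexp (- (Ci * (IZR k * x)%R)))%C) in D.
      split.
      + apply Rle_lt_trans with (2 := D). exact (Re_le_Cmod w).
      + apply Rle_lt_trans with (2 := D). exact (Im_le_Cmod w).
    - replace (RtoC (2 * PI) * c k)%C with If; [exact hint|].
      apply (filterlim_locally_unique (V := C_R_NormedModule) (fun N => czsum N lt) (F := eventually)).
      + exact hIf.
      + apply filterlim_ext_loc with (fun _ => (RtoC (2 * PI) * c k)%C); [|apply filterlim_const].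
        exists (Z.abs_nat k). intros N hN. symmetry.
        assert (off : forall n, (n < Z.abs_nat k)%nat -> czsum n lt = 0%C).
        { induction n as [|n IH]; intros hn.
          - rewrite czsum_0. unfold lt. destruct Z.eq_dec; [lia|easy].
          - rewrite czsum_S, IH by lia. unfold lt.
            destruct Z.eq_dec; [lia|]. destruct Z.eq_dec; [lia|]. ring. }
        induction hN as [|N hN IH].
        * destruct (Z.eq_dec k 0) as [->|nz].
          -- cbn. rewrite czsum_0. unfold lt. now destruct Z.eq_dec.
          -- destruct (Z.abs_nat k) as [|n] eqn:e; [lia|].
             rewrite czsum_S, off by lia. unfold lt.
             destruct Z.eq_dec; destruct Z.eq_dec; try lia.
             ++ replace (Z.of_nat (S n)) with k by lia. ring.
             ++ replace (- Z.of_nat (S n))%Z with k by lia. ring.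
        * rewrite czsum_S, IH. unfold lt.
          destruct Z.eq_dec; [lia|]. destruct Z.eq_dec; [lia|]. ring. }
  unfold fourier. rewrite (is_RInt_unique _ _ _ _ hR).
  rewrite Cmult_assoc, <- RtoC_mult, Rinv_l; [ring|].
  pose proof PI_RGT_0; lra.
Qed.

Lemma fourier_ext f g k : (forall x, f x = g x) -> fourier f k = fourier g k.
Proof.
  intros h. unfold fourier. f_equal.
  apply (RInt_ext (V := C_R_CompleteNormedModule)). intros x _. now rewrite h.
Qed.

(** * Differentiation of coefficients and the mean value inequality *)

(** Derivative of a complex function of a real variable, componentwise so that
    the product rule is that of real functions. *)
Definition cder (f : R -> C) (t : R) (l : C) : Prop :=
  is_derive (fun s => Re (f s)) t (Re l) /\ is_derive (fun s => Im (f s)) t (Im l).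

Lemma cder_ext f g t l : (forall s, f s = g s) -> cder f t l -> cder g t l.
Proof.
  intros e [h1 h2]; split; [apply is_derive_ext with (2 := h1)|apply is_derive_ext with (2 := h2)];
    intros; now rewrite e.
Qed.

Lemma cder_eq f t l l' : l = l' -> cder f t l -> cder f t l'.
Proof. now intros ->. Qed.

Lemma cder_const c t : cder (fun _ => c) t 0%C.
Proof. split; apply (is_derive_const (V := R_NormedModule)). Qed.

Lemma cder_plus f g t l l' :
  cder f t l -> cder g t l' -> cder (fun s => (f s + g s)%C) t (l + l')%C.
Proof.
  intros [h1 h2] [h1' h2'].
  split; apply (is_derive_plus (V := R_NormedModule)); assumption.
Qed.

Lemma cder_mult f g t l l' :
  cder f t l -> cder g t l' ->
  cder (fun s => (f s * g s)%C) t (l * g t + f t * l')%C.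
Proof.
  intros [h1 h2] [h1' h2']. split.
  - pose proof (is_derive_mult (K := R_AbsRing) _ _ t _ _ h1 h1' Rmult_comm) as A.
    pose proof (is_derive_mult (K := R_AbsRing) _ _ t _ _ h2 h2' Rmult_comm) as B.
    pose proof (is_derive_minus (V := R_NormedModule) _ _ t _ _ A B) as D.
    evar_last; [exact D|].
    unfold minus, plus, opp, mult, Re, Im; cbn; unfold Re, Im; ring.
  - pose proof (is_derive_mult (K := R_AbsRing) _ _ t _ _ h1 h2' Rmult_comm) as A.
    pose proof (is_derive_mult (K := R_AbsRing) _ _ t _ _ h2 h1' Rmult_comm) as B.
    pose proof (is_derive_plus (V := R_NormedModule) _ _ t _ _ A B) as D.
    evar_last; [exact D|].
    unfold minus, plus, opp, mult, Re, Im; cbn; unfold Re, Im; ring.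
Qed.

Lemma cder_scal c f t l : cder f t l -> cder (fun s => (c * f s)%C) t (c * l)%C.
Proof.
  intros h. replace (c * l)%C with (0 * f t + c * l)%C by ring.
  apply (cder_mult (fun _ => c)); [apply cder_const|exact h].
Qed.

Lemma cder_minus f g t l l' :
  cder f t l -> cder g t l' -> cder (fun s => (f s - g s)%C) t (l - l')%C.
Proof.
  intros [h1 h2] [h1' h2'].
  split; apply (is_derive_minus (V := R_NormedModule)); assumption.
Qed.

Lemma cder_id t : cder RtoC t 1%C.
Proof.
  split; cbn; [apply (is_derive_id (K := R_AbsRing))|apply (is_derive_const (V := R_NormedModule))].
Qed.

Lemma cder_Cexp z t : cder (fun s => Cexp (s * z)) t (z * Cexp (t * z))%C.
Proof.
  destruct z as [p q].
  split; unfold Cexp, Re, Im; cbn; auto_derive; auto; unfold Re, Im, Rminus; cbn; ring.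
Qed.

Definition clamp (a b t : R) : R := Rmax a (Rmin b t).

Lemma clamp_in a b t : a <= b -> a <= clamp a b t <= b.
Proof.
  intros h. unfold clamp, Rmax, Rmin. destruct Rle_dec; destruct Rle_dec; lra.
Qed.

Lemma clamp_id a b t : a <= t <= b -> clamp a b t = t.
Proof.
  intros h. unfold clamp, Rmax, Rmin.
  repeat destruct Rle_dec; lra.
Qed.

Lemma clamp_lip a b s t : Rabs (clamp a b s - clamp a b t) <= Rabs (s - t).
Proof.
  unfold clamp, Rmax, Rmin, Rabs.
  repeat destruct Rle_dec; repeat destruct Rcase_abs; lra.
Qed.

(** Continuity on [a,b], one sided at the ends, as continuity of the extension
    by constants: the rules for sums and products then apply unchanged. *)
Definition contw (a b : R) (f : R -> R) : Prop :=
  forall t, continuity_pt (fun s => f (clamp a b s)) t.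

Definition ccont (a b : R) (f : R -> C) : Prop :=
  contw a b (fun s => Re (f s)) /\ contw a b (fun s => Im (f s)).

Lemma contw_eps a b f : a <= b ->
  (forall t eps, a <= t <= b -> 0 < eps -> exists delta, 0 < delta /\
     forall s, a <= s <= b -> Rabs (s - t) < delta -> Rabs (f s - f t) < eps) ->
  contw a b f.
Proof.
  intros hab h t eps heps.
  destruct (h (clamp a b t) eps (clamp_in a b t hab) heps) as (d & hd & H).
  exists d. split; [exact hd|]. intros s [_ hs]. cbn in hs |- *. unfold R_dist in *.
  apply H; [now apply clamp_in|].
  eapply Rle_lt_trans; [apply clamp_lip|exact hs].
Qed.

Lemma contw_of_continuity a b f : (forall t, continuity_pt f t) -> contw a b f.
Proof.
  intros h t. apply (continuity_pt_comp (clamp a b) f); [|apply h].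
  intros eps heps. exists eps. split; [exact heps|]. intros s [_ hs].
  cbn in hs |- *. unfold R_dist in *. eapply Rle_lt_trans; [apply clamp_lip|exact hs].
Qed.

Lemma ccont_minus a b f g :
  ccont a b f -> ccont a b g -> ccont a b (fun s => (f s - g s)%C).
Proof.
  intros [h1 h2] [h1' h2'].
  split; intros t.
  - exact (continuity_pt_minus _ _ _ (h1 t) (h1' t)).
  - exact (continuity_pt_minus _ _ _ (h2 t) (h2' t)).
Qed.

Lemma ccont_mult a b f g :
  ccont a b f -> ccont a b g -> ccont a b (fun s => (f s * g s)%C).
Proof.
  intros [h1 h2] [h1' h2']; split; intros t.
  - exact (continuity_pt_minus _ _ _ (continuity_pt_mult _ _ _ (h1 t) (h1' t))
             (continuity_pt_mult _ _ _ (h2 t) (h2' t))).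
  - exact (continuity_pt_plus _ _ _ (continuity_pt_mult _ _ _ (h1 t) (h2' t))
             (continuity_pt_mult _ _ _ (h2 t) (h1' t))).
Qed.

Lemma ccont_of_cder a b f df : (forall t, cder f t (df t)) -> ccont a b f.
Proof.
  intros h. split; apply contw_of_continuity; intros t; destruct (h t) as [h1 h2].
  - apply continuity_pt_filterlim, (ex_derive_continuous (V := R_NormedModule)).
    eexists; exact h1.
  - apply continuity_pt_filterlim, (ex_derive_continuous (V := R_NormedModule)).
    eexists; exact h2.
Qed.

Lemma ccont_const a b c : ccont a b (fun _ => c).
Proof. apply (ccont_of_cder a b _ (fun _ => 0%C)). intros; apply cder_const. Qed.

Lemma mvt_within f df a b : a < b -> contw a b f ->
  (forall x, a < x < b -> is_derive f x (df x)) ->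
  exists c, a < c < b /\ f b - f a = df c * (b - a).
Proof.
  intros hab hc hd.
  (* [MVT_gen] may return an endpoint, where [df] is replaced by one of its
     values inside. *)
  set (inside := fun x => if Rlt_dec a x then if Rlt_dec x b then x else (a + b) / 2
                          else (a + b) / 2).
  assert (hin : forall x, a < inside x < b).
  { intros x; unfold inside. destruct Rlt_dec; [destruct Rlt_dec|]; lra. }
  destruct (MVT_gen (fun s => f (clamp a b s)) a b (fun x => df (inside x)))
    as (c & _ & e).
  - rewrite Rmin_left, Rmax_right by lra. intros x hx.
    replace (inside x) with x
      by (unfold inside; destruct Rlt_dec; [destruct Rlt_dec|]; lra).
    apply is_derive_ext_loc with f; [|now apply hd].
    assert (hp : 0 < Rmin (x - a) (b - x)) by (apply Rmin_glb_lt; lra).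
    exists (mkposreal _ hp). intros y hy. rewrite clamp_id; [easy|].
    change (Rabs (y - x) < Rmin (x - a) (b - x)) in hy.
    pose proof (Rmin_l (x - a) (b - x)). pose proof (Rmin_r (x - a) (b - x)).
    apply Rabs_lt_between in hy. lra.
  - intros x _. apply hc.
  - exists (inside c). split; [apply hin|]. rewrite !clamp_id in e by lra. exact e.
Qed.

Lemma contw_zsum a b K (f : R -> Z -> R) :
  (forall k, contw a b (fun s => f s k)) -> contw a b (fun s => zsum K (f s)).
Proof.
  intros h; induction K as [|K IH]; [apply h|].
  intros t. exact (continuity_pt_plus _ _ _ (IH t)
    (continuity_pt_plus _ _ _ (h (Z.of_nat (S K)) t) (h (- Z.of_nat (S K))%Z t))).
Qed.

Lemma is_derive_zsum K (f : R -> Z -> R) (df : Z -> R) t :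
  (forall k, is_derive (fun s => f s k) t (df k)) ->
  is_derive (fun s => zsum K (f s)) t (zsum K df).
Proof.
  intros h; induction K as [|K IH]; [apply h|].
  apply (is_derive_plus (V := R_NormedModule)); [exact IH|].
  apply (is_derive_plus (V := R_NormedModule)); apply h.
Qed.

(** A Minkowski inequality for the integral of [H], without integrals.  It holds
    for every truncation of the frequencies, hence in the weighted l^2 space. *)
Lemma wball_mvt w (W H : R -> distr) a b M : a < b -> 0 <= M ->
  (forall k, ccont a b (fun s => W s k)) ->
  (forall t k, a < t < b -> cder (fun s => W s k) t (H t k)) ->
  (forall t, a < t < b -> wball w (H t) M) ->
  wball w (fun k => (W b k - W a k)%C) (M * (b - a)).
Proof.
  intros hab hM hc hd hH. split; [nra|]. intros K.
  (* Duality: apply the scalar theorem to the pairing of [W] with its own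
     increment. *)
  set (d := fun k => (W b k - W a k)%C).
  set (D := zsum K (fun k => (w k * Cmod (d k)) ^ 2)).
  destruct (mvt_within
    (fun s => zsum K (fun k => w k ^ 2 * (Re (d k) * Re (W s k) + Im (d k) * Im (W s k))))
    (fun s => zsum K (fun k => w k ^ 2 * (Re (d k) * Re (H s k) + Im (d k) * Im (H s k))))
    a b hab) as (c & hcab & e).
  - apply (contw_zsum a b K (fun s k => w k ^ 2 * (Re (d k) * Re (W s k) + Im (d k) * Im (W s k)))).
    intros k t. destruct (hc k) as [h1 h2].
    apply (continuity_pt_scal _ (w k ^ 2)).
    apply continuity_pt_plus; [apply (continuity_pt_scal _ (Re (d k)))
                              |apply (continuity_pt_scal _ (Im (d k)))]; [apply h1|apply h2].
  - intros x hx.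
    apply (is_derive_zsum K (fun s k => w k ^ 2 * (Re (d k) * Re (W s k) + Im (d k) * Im (W s k)))).
    intros k. destruct (hd x k hx) as [h1 h2].
    apply (is_derive_scal (fun s => Re (d k) * Re (W s k) + Im (d k) * Im (W s k))).
    apply (is_derive_plus (V := R_NormedModule));
      [apply (is_derive_scal (fun s => Re (W s k)))
      |apply (is_derive_scal (fun s => Im (W s k)))]; assumption.
  - assert (eD : D = zsum K (fun k => w k ^ 2 * (Re (d k) * Re (W b k) + Im (d k) * Im (W b k)))
                   - zsum K (fun k => w k ^ 2 * (Re (d k) * Re (W a k) + Im (d k) * Im (W a k)))).
    { unfold Rminus. rewrite <- (Rmult_1_l (zsum K (fun k => w k ^ 2 * (Re (d k) * Re (W a k) + _)))),
        Ropp_mult_distr_l, <- zsum_scal, <- zsum_plus.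
      apply zsum_ext; intros k _. rewrite Rpow_mult_distr, Cmod_sqr. unfold d.
      rewrite Re_minus, Im_minus. ring. }
    rewrite <- eD in e. destruct (hH c hcab) as [_ hHc]. specialize (hHc K).
    assert (cs : D ^ 2 <= D * (M * (b - a)) ^ 2).
    { rewrite e at 1. rewrite Rpow_mult_distr, Rpow_mult_distr, <- Rmult_assoc.
      apply Rmult_le_compat_r; [apply pow2_ge_0|].
      apply Rle_trans with (zsum K (fun k => (w k * Cmod (d k)) * (w k * Cmod (H c k))) ^ 2).
      - rewrite <- (pow2_abs (zsum K _)). apply pow_incr. split; [apply Rabs_pos|].
        assert (p : forall k, Rabs (Re (d k) * Re (H c k) + Im (d k) * Im (H c k))
                    <= Cmod (d k) * Cmod (H c k)).
        { intros k. replace (Re (d k) * Re (H c k) + Im (d k) * Im (H c k))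
            with (Re (d k * Cconj (H c k))) by (cbn; unfold Re, Im; ring).
          rewrite <- (Cmod_conj (H c k)), <- Cmod_mult. apply Re_le_Cmod. }
        assert (q : forall k, 0 <= w k ^ 2) by (auto).
        apply Rabs_le. split.
        + rewrite <- (Rmult_1_l (zsum K (fun k => w k * _ * _))), Ropp_mult_distr_l, <- zsum_scal.
          apply zsum_le; intros k _. specialize (p k). apply Rabs_le_between in p.
          specialize (q k). nra.
        + apply zsum_le; intros k _. specialize (p k). apply Rabs_le_between in p.
          specialize (q k). nra.
      - eapply Rle_trans; [apply (zsum_cauchy_schwarz K (fun k => w k * Cmod (d k)))|].
        apply Rmult_le_compat_l; [|exact hHc]. apply zsum_ge0; auto. }
    assert (0 <= D) by (apply zsum_ge0; auto).
    change (D <= (M * (b - a)) ^ 2).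
    pose proof (pow2_ge_0 (M * (b - a))). nra.
Qed.

Lemma cder_mvt f df a b M : a < b -> 0 <= M ->
  (forall t, cder f t (df t)) -> (forall t, a < t < b -> Cmod (df t) <= M) ->
  Cmod (f b - f a) <= M * (b - a).
Proof.
  intros hab hM hd hb.
  (* A scalar function is a sequence concentrated at frequency 0. *)
  set (at0 := fun (z : C) (k : Z) => if Z.eq_dec k 0 then z else 0%C).
  assert (B : wball wL (fun k => (at0 (f b) k - at0 (f a) k)%C) (M * (b - a))).
  { apply (wball_mvt wL (fun s => at0 (f s)) (fun s => at0 (df s))); auto.
    - intros k. unfold at0. destruct Z.eq_dec; [now apply ccont_of_cder with df|apply ccont_const].
    - intros t k _. unfold at0. destruct Z.eq_dec; [apply hd|apply cder_const].
    - intros t ht. split; [easy|]. intros N. specialize (hb t ht).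
      apply Rle_trans with (Cmod (df t) ^ 2); [|pose proof (Cmod_ge_0 (df t)); nra].
      right. induction N as [|N IH]; cbn [zsum]; [|rewrite IH]; unfold at0, wL.
      + destruct Z.eq_dec; [ring|easy].
      + destruct Z.eq_dec; [lia|]. destruct Z.eq_dec; [lia|]. rewrite Cmod_0; ring. }
  apply (wball_term _ _ _ 0%Z) in B; auto. unfold at0, wL in B. cbn in B.
  rewrite Rmult_1_l in B. exact B.
Qed.

(** * The exponential series *)

(** With [u n = z ^ n] these are the partial sums of the exponential of [z]. *)
Fixpoint exp_sum (N : nat) (u : nat -> C) : C :=
  match N with
  | O => u O
  | S n => (exp_sum n u + RtoC (/ INR (fact (S n))) * u (S n))%C
  end.

Lemma inv_fact_pos n : 0 < / INR (fact n).
Proof. apply Rinv_0_lt_compat, INR_fact_lt_0. Qed.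

Lemma exp_sum_Re N u : Re (exp_sum N u) = sum_n (fun n => / INR (fact n) * Re (u n)) N.
Proof.
  induction N as [|N IH]; [rewrite sum_O; cbn; field|].
  rewrite sum_Sn, <- IH. cbn -[fact INR]. unfold plus, Re; cbn -[fact INR]. ring.
Qed.

Lemma exp_sum_Im N u : Im (exp_sum N u) = sum_n (fun n => / INR (fact n) * Im (u n)) N.
Proof.
  induction N as [|N IH]; [rewrite sum_O; cbn; field|].
  rewrite sum_Sn, <- IH. cbn -[fact INR]. unfold plus, Im; cbn -[fact INR]. ring.
Qed.

Lemma is_series_exp x : is_series (fun n => / INR (fact n) * x ^ n) (exp x).
Proof.
  eapply is_series_ext; [|apply (is_exp_Reals x)].
  intros n. unfold scal; cbn; unfold mult; cbn. rewrite pow_n_pow. ring.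
Qed.

Lemma sum_exp_le x N : 0 <= x -> sum_n (fun n => / INR (fact n) * x ^ n) N <= exp x.
Proof.
  intros hx. pose proof (is_series_exp x) as h.
  apply (is_lim_seq_incr_compare _ _ h). intros n. rewrite sum_Sn.
  pose proof (inv_fact_pos (S n)). pose proof (pow_le x (S n) hx).
  unfold plus; cbn -[fact INR pow]. nra.
Qed.

Lemma exp_sum_lim (u : nat -> C) x c :
  0 <= x -> (forall n, Cmod (u n) <= c * x ^ n) ->
  Clim_seq (fun N => exp_sum N u)
    (Series (fun n => / INR (fact n) * Re (u n)),
     Series (fun n => / INR (fact n) * Im (u n))).
Proof.
  intros hx hu.
  assert (ex : ex_series (fun n => c * (/ INR (fact n) * x ^ n))).
  { apply (ex_series_scal c (fun n => / INR (fact n) * x ^ n)).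
    exists (exp x). apply is_series_exp. }
  assert (dom : forall v : nat -> R, (forall n, Rabs (v n) <= Cmod (u n)) ->
            ex_series (fun n => / INR (fact n) * v n)).
  { intros v hv. apply (ex_series_le (V := R_CompleteNormedModule)) with (2 := ex). intros n.
    change (Rabs (/ INR (fact n) * v n) <= c * (/ INR (fact n) * x ^ n)).
    rewrite Rabs_mult, Rabs_pos_eq by apply Rlt_le, inv_fact_pos.
    pose proof (inv_fact_pos n). specialize (hv n); specialize (hu n).
    apply Rle_trans with (/ INR (fact n) * (c * x ^ n)); [|right; ring].
    apply Rmult_le_compat_l; lra. }
  split; cbn [fst snd Re Im].
  - apply is_lim_seq_ext with (sum_n (fun n => / INR (fact n) * Re (u n)));
      [intros; symmetry; apply exp_sum_Re|].
    apply (Series_correct (fun n => / INR (fact n) * Re (u n))).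
    apply (dom (fun n => Re (u n))). intros; apply Re_le_Cmod.
  - apply is_lim_seq_ext with (sum_n (fun n => / INR (fact n) * Im (u n)));
      [intros; symmetry; apply exp_sum_Im|].
    apply (Series_correct (fun n => / INR (fact n) * Im (u n))).
    apply (dom (fun n => Im (u n))). intros; apply Im_le_Cmod.
Qed.

Lemma Cmod_Cpow z n : Cmod (z ^ n) = Cmod z ^ n.
Proof. induction n as [|n IH]; cbn; [apply Cmod_1|]. now rewrite Cmod_mult, IH. Qed.

Lemma cder_Cpow z n t :
  cder (fun s => ((s * z) ^ S n)%C) t (RtoC (INR (S n)) * z * (t * z) ^ n)%C.
Proof.
  assert (lin : cder (fun s => (s * z)%C) t z).
  { apply cder_eq with (1 * z + t * 0)%C; [ring|].
    apply cder_mult; [apply cder_id|apply cder_const]. }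
  induction n as [|n IH].
  - apply cder_eq with z; [cbn; ring|].
    apply cder_ext with (2 := lin). intros; cbn; ring.
  - change (cder (fun s => (s * z * (s * z) ^ S n)%C) t (RtoC (INR (S (S n))) * z * (t * z) ^ S n)%C).
    replace (RtoC (INR (S (S n))) * z * (t * z) ^ S n)%C
      with (z * (t * z) ^ S n + (t * z) * (RtoC (INR (S n)) * z * (t * z) ^ n))%C.
    + now apply cder_mult.
    + rewrite (S_INR (S n)), RtoC_plus. cbn [Cpow]. ring.
Qed.

Lemma cder_exp_sum z N t :
  cder (fun s => exp_sum (S N) (Cpow (s * z))) t (z * exp_sum N (Cpow (t * z)))%C.
Proof.
  assert (term : forall n, cder (fun s => (RtoC (/ INR (fact (S n))) * (s * z) ^ S n)%C) t
                   (z * (RtoC (/ INR (fact n)) * (t * z) ^ n))%C).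
  { intros n.
    replace (z * (RtoC (/ INR (fact n)) * (t * z) ^ n))%C
      with (RtoC (/ INR (fact (S n))) * (RtoC (INR (S n)) * z * (t * z) ^ n))%C.
    - apply cder_scal, cder_Cpow.
    - replace (/ INR (fact n)) with (/ INR (fact (S n)) * INR (S n)).
      + rewrite RtoC_mult; ring.
      + rewrite fact_simpl, mult_INR. pose proof (INR_fact_neq_0 n).
        field. split; [easy|]. apply not_0_INR; lia. }
  induction N as [|N IH].
  - replace (z * exp_sum 0 (Cpow (t * z)))%C
      with (0 + z * (RtoC (/ INR (fact 0)) * (t * z) ^ 0))%C
      by (cbn; rewrite Rinv_1; ring).
    apply (cder_plus (fun s => exp_sum 0 (Cpow (s * z)))); [apply (cder_const 1%C)|apply term].
  - replace (z * exp_sum (S N) (Cpow (t * z)))%C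
      with (z * exp_sum N (Cpow (t * z)) + z * (RtoC (/ INR (fact (S N))) * (t * z) ^ S N))%C
      by (cbn [exp_sum]; ring).
    apply (cder_plus (fun s => exp_sum (S N) (Cpow (s * z)))); [exact IH|apply term].
Qed.

Lemma Cmod_Cexp z : Cmod (Cexp z) = exp (Re z).
Proof.
  assert (e : Cexp z = (RtoC (exp (Re z)) * Cexp (Ci * RtoC (Im z)))%C).
  { rewrite Cexp_i. unfold Cexp. apply injective_projections; cbn; ring. }
  rewrite e, Cmod_mult, Cmod_Cexp_i, Cmod_R, Rabs_pos_eq; [ring|].
  apply Rlt_le, exp_pos.
Qed.

Lemma Cmod_Cexp_le z : Cmod (Cexp z) <= exp (Cmod z).
Proof.
  rewrite Cmod_Cexp. destruct (Req_dec (Re z) (Cmod z)) as [->|n]; [lra|].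
  left; apply exp_increasing. pose proof (Re_le_Cmod z).
  pose proof (Rle_abs (Re z)). lra.
Qed.

(** The derivative of [exp (- t z)] times the partial sum at [t z] is a single
    term of the series, which is small; compare [t = 0] and [t = 1]. *)
Lemma Cexp_series z : Clim_seq (fun N => exp_sum N (Cpow z)) (Cexp z).
Proof.
  set (r := Cmod z). assert (hr : 0 <= r) by apply Cmod_ge_0.
  assert (bd : forall N, Cmod (exp_sum (S N) (Cpow z) - Cexp z)
           <= (exp r * (r * exp r)) * (/ INR (fact (S N)) * r ^ S N)).
  { intros N.
    set (f := fun t : R => (Cexp (t * - z) * exp_sum (S N) (Cpow (t * z)))%C).
    set (df := fun t : R => (- z * (Cexp (t * - z) *
                (RtoC (/ INR (fact (S N))) * (t * z) ^ S N)))%C).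
    assert (hd : forall t, cder f t (df t)).
    { intros t. replace (df t) with
        (- z * Cexp (t * - z) * exp_sum (S N) (Cpow (t * z))
         + Cexp (t * - z) * (z * exp_sum N (Cpow (t * z))))%C
        by (unfold df; cbn [exp_sum]; ring).
      apply cder_mult; [apply cder_Cexp|apply cder_exp_sum]. }
    assert (hb : forall t, 0 < t < 1 ->
              Cmod (df t) <= r * exp r * (/ INR (fact (S N)) * r ^ S N)).
    { intros t ht. unfold df. rewrite !Cmod_mult, Cmod_opp, Cmod_Cpow, Cmod_mult, !Cmod_R.
      fold r. rewrite !Rabs_pos_eq by (try lra; apply Rlt_le, inv_fact_pos).
      rewrite Rmult_assoc. apply Rmult_le_compat_l; [easy|].
      pose proof (inv_fact_pos (S N)).
      apply Rmult_le_compat; [apply Cmod_ge_0| | |].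
      - apply Rmult_le_pos; [lra|]. apply pow_le; nra.
      - eapply Rle_trans; [apply Cmod_Cexp_le|].
        rewrite Cmod_mult, Cmod_opp, Cmod_R, Rabs_pos_eq by lra. fold r.
        destruct (Req_dec (t * r) r) as [->|n]; [lra|].
        left; apply exp_increasing. nra.
      - apply Rmult_le_compat_l; [lra|]. apply pow_incr. nra. }
    assert (hM : 0 <= r * exp r * (/ INR (fact (S N)) * r ^ S N)).
    { pose proof (inv_fact_pos (S N)). pose proof (exp_pos r). pose proof (pow_le r (S N) hr).
      apply Rmult_le_pos; apply Rmult_le_pos; lra. }
    pose proof (cder_mvt f df 0 1 _ Rlt_0_1 hM hd hb) as E.
    assert (f0 : f 0 = 1%C).
    { unfold f. replace (RtoC 0 * - z)%C with (RtoC 0) by ring.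
      replace (RtoC 0 * z)%C with (RtoC 0) by ring. rewrite Cexp_0.
      assert (e : forall n, exp_sum n (Cpow 0) = 1%C).
      { induction n as [|n IH]; cbn [exp_sum]; [reflexivity|]. rewrite IH. cbn [Cpow]. ring. }
      rewrite e; ring. }
    assert (f1 : f 1 = (Cexp (- z) * exp_sum (S N) (Cpow z))%C).
    { unfold f. do 2 f_equal; try ring. f_equal; ring. }
    rewrite f0, f1 in E.
    replace (exp_sum (S N) (Cpow z) - Cexp z)%C
      with (Cexp z * (Cexp (- z) * exp_sum (S N) (Cpow z) - 1))%C.
    2:{ replace (Cexp z * (Cexp (- z) * exp_sum (S N) (Cpow z) - 1))%C
          with ((Cexp z * Cexp (- z)) * exp_sum (S N) (Cpow z) - Cexp z)%C by ring.
        rewrite <- Cexp_add. replace (z + - z)%C with (RtoC 0) by ring. rewrite Cexp_0. ring. }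
    rewrite Cmod_mult, Rmult_assoc.
    apply Rmult_le_compat; try apply Cmod_ge_0; [apply Cmod_Cexp_le|].
    rewrite Rminus_0_r, Rmult_1_r in E. exact E. }
  assert (L : is_lim_seq (fun N => (exp r * (r * exp r)) * (/ INR (fact (S N)) * r ^ S N)) 0).
  { replace (Finite 0) with (Rbar_mult (exp r * (r * exp r)) 0) by (cbn; f_equal; ring).
    apply is_lim_seq_scal_l.
    apply (is_lim_seq_incr_1 (fun N => / INR (fact N) * r ^ N)).
    apply ex_series_lim_0. exists (exp r). apply is_series_exp. }
  destruct (Clim_squeeze (fun N => exp_sum (S N) (Cpow z)) (Cexp z) _ bd L) as [h1 h2].
  split; [apply (is_lim_seq_incr_1 (fun N => Re (exp_sum N (Cpow z))))
         |apply (is_lim_seq_incr_1 (fun N => Im (exp_sum N (Cpow z))))]; assumption.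
Qed.

Lemma wball_exp_sum w (u : nat -> distr) c x N :
  (forall k, 0 <= w k) -> 0 <= c -> 0 <= x ->
  (forall n, wball w (u n) (c * x ^ n)) ->
  wball w (fun k => exp_sum N (fun n => u n k)) (c * exp x).
Proof.
  intros hw hc hx hu.
  apply wball_le with (c * sum_n (fun n => / INR (fact n) * x ^ n) N);
    [|apply Rmult_le_compat_l; auto; now apply sum_exp_le].
  induction N as [|N IH].
  - rewrite sum_O. replace (c * _) with (c * x ^ 0) by (cbn; field). apply hu.
  - rewrite sum_Sn. unfold plus; cbn -[fact INR pow]. rewrite Rmult_plus_distr_l.
    apply wball_plus; [exact hw|exact IH|].
    replace (c * (/ INR (fact (S N)) * x ^ S N))
      with (Cmod (RtoC (/ INR (fact (S N)))) * (c * x ^ S N)).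
    + now apply wball_scal.
    + rewrite Cmod_R, Rabs_pos_eq by apply Rlt_le, inv_fact_pos. ring.
Qed.

(** * The free flow and products *)

Lemma Cexp_i_lip (x y : R) : Cmod (Cexp (Ci * x) - Cexp (Ci * y)) <= Rabs (x - y).
Proof.
  assert (le : forall a b, a < b -> Cmod (Cexp (Ci * b) - Cexp (Ci * a)) <= b - a).
  { intros a b hab.
    replace (b - a) with (1 * (b - a)) by ring.
    rewrite (Cmult_comm Ci b), (Cmult_comm Ci a).
    apply (cder_mvt (fun t => Cexp (t * Ci)) (fun t => (Ci * Cexp (t * Ci))%C)); auto; [lra| |].
    - intros t; apply cder_Cexp.
    - intros t _. rewrite Cmod_mult, Cmult_comm, Cmod_Cexp_i.
      replace (Cmod Ci) with 1; [lra|]. unfold Cmod, Ci; cbn.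
      replace (0 * (0 * 1) + 1 * (1 * 1)) with 1 by ring. now rewrite sqrt_1. }
  destruct (Rtotal_order x y) as [lt|[->|gt]].
  - rewrite <- Cmod_opp, Rabs_left by lra.
    replace (- (Cexp (Ci * x) - Cexp (Ci * y)))%C
      with (Cexp (Ci * y) - Cexp (Ci * x))%C by ring.
    specialize (le x y lt). lra.
  - replace (Cexp (Ci * y) - Cexp (Ci * y))%C with (RtoC 0) by ring.
    rewrite Cmod_0. apply Rabs_pos.
  - rewrite Rabs_right by lra. now apply le.
Qed.

Lemma Cexp_i_minus1 (y : R) : Cmod (Cexp (Ci * y) - 1) <= Rabs y.
Proof.
  rewrite <- Cexp_0. replace (RtoC 0) with (Ci * RtoC 0)%C by ring.
  eapply Rle_trans; [apply Cexp_i_lip|]. rewrite Rminus_0_r; lra.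
Qed.

Lemma bracket_pos m k : m <> 0 -> 0 < bracket m k.
Proof.
  intros hm. apply sqrt_lt_R0. pose proof (pow2_ge_0 (IZR k)).
  pose proof (pow2_gt_0 m hm). lra.
Qed.

Lemma bracket_sqr m k : bracket m k ^ 2 = IZR k ^ 2 + m ^ 2.
Proof.
  apply pow2_sqrt. pose proof (pow2_ge_0 (IZR k)); pose proof (pow2_ge_0 m); lra.
Qed.

Lemma bracket_opp m k : bracket m (- k) = bracket m k.
Proof. unfold bracket. rewrite opp_IZR. f_equal; ring. Qed.

Lemma bracket_le m k : bracket m k <= Rabs (IZR k) + Rabs m.
Proof.
  pose proof (Rabs_pos (IZR k)). pose proof (Rabs_pos m).
  apply Rsqr_incr_0_var; [|lra]. rewrite !Rsqr_pow2, bracket_sqr.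
  rewrite <- (pow2_abs (IZR k)), <- (pow2_abs m). nra.
Qed.

Lemma bracket_lip m k l : Rabs (bracket m k - bracket m l) <= Rabs (IZR k - IZR l).
Proof.
  assert (pk : 0 <= bracket m k) by apply sqrt_pos.
  assert (pl : 0 <= bracket m l) by apply sqrt_pos.
  pose proof (bracket_sqr m k) as sk. pose proof (bracket_sqr m l) as sl.
  apply Rsqr_incr_0_var; [|apply Rabs_pos]. rewrite <- !Rsqr_abs. unfold Rsqr.
  (* Cauchy-Schwarz for the vectors (k,m) and (l,m). *)
  assert (IZR k * IZR l + m ^ 2 <= bracket m k * bracket m l).
  { apply Rsqr_incr_0_var; [|now apply Rmult_le_pos]. rewrite !Rsqr_pow2.
    rewrite Rpow_mult_distr, sk, sl. pose proof (pow2_ge_0 (m * (IZR k - IZR l))). nra. }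
  nra.
Qed.

(** The bracket is 1-Lipschitz, so replacing [l + j] by [j] costs at most
    [|l|]. *)
Lemma bracket_defect m l j :
  Rabs (bracket m l + bracket m j - bracket m (l + j)) <= (2 + Rabs m) * wt l ^ 4.
Proof.
  pose proof (bracket_lip m j (l + j)) as lip. pose proof (bracket_le m l) as le.
  assert (0 <= bracket m l) by apply sqrt_pos.
  rewrite plus_IZR in lip.
  replace (IZR j - (IZR l + IZR j)) with (- IZR l) in lip by ring. rewrite Rabs_Ropp in lip.
  replace (bracket m l + bracket m j - bracket m (l + j))
    with (bracket m l + (bracket m j - bracket m (l + j))) by ring.
  eapply Rle_trans; [apply Rabs_triang|]. rewrite (Rabs_pos_eq (bracket m l)) by easy.
  pose proof (wt_pow4_ge_abs l). pose proof (pow_R1_Rle _ 4 (wt_ge1 l)).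
  pose proof (Rabs_pos m). nra.
Qed.

(** The symbol of the free flow [e^{s L}]. *)
Definition phase (m s : R) (k : Z) : C := Cexp (Ci * (s * bracket m k)%R).

Definition flow (m s : R) (a : distr) : distr := multiplier (phase m s) a.

Lemma Cmod_phase m s k : Cmod (phase m s k) = 1.
Proof. apply Cmod_Cexp_i. Qed.

Lemma phase_add m s t k : phase m (s + t) k = (phase m s k * phase m t k)%C.
Proof.
  unfold phase. rewrite <- Cexp_add. f_equal.
  rewrite Rmult_plus_distr_r, RtoC_plus; ring.
Qed.

Lemma phase_0 m k : phase m 0 k = 1%C.
Proof.
  unfold phase. rewrite Rmult_0_l. replace (Ci * 0)%C with (RtoC 0) by ring.
  apply Cexp_0.
Qed.

Lemma phase_inv m s k : (phase m (- s) k * phase m s k = 1)%C.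
Proof. rewrite <- phase_add, Rplus_opp_l. apply phase_0. Qed.

Lemma flow_flow m s t a : flow m s (flow m t a) = flow m (s + t) a.
Proof.
  apply functional_extensionality; intros k. unfold flow, multiplier.
  rewrite phase_add; ring.
Qed.

Lemma flow_0 m a : flow m 0 a = a.
Proof.
  apply functional_extensionality; intros k. unfold flow, multiplier.
  rewrite phase_0; ring.
Qed.

Lemma wball_flow w m s a A : (forall k, 0 <= w k) -> wball w a A -> wball w (flow m s a) A.
Proof.
  intros hw. apply wball_same; [exact hw|]. intros k. unfold flow, multiplier.
  rewrite Cmod_mult, Cmod_phase; ring.
Qed.

Lemma flow_conj m s a : conj_distr (flow m s a) = flow m (- s) (conj_distr a).
Proof.
  apply functional_extensionality; intros k. unfold conj_distr, flow, multiplier.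
  rewrite Cmult_conj. f_equal. unfold phase. rewrite <- Cexp_conj, bracket_opp. f_equal.
  rewrite Cmult_conj. apply injective_projections; cbn; ring.
Qed.

Lemma flow_minus m s a b k :
  flow m s (fun j => (a j - b j)%C) k = (flow m s a k - flow m s b k)%C.
Proof. unfold flow, multiplier; ring. Qed.

Definition defect_const (m : R) : R := 4 * (2 + Rabs m).

Lemma defect_const_ge0 m : 0 <= defect_const m.
Proof. unfold defect_const. pose proof (Rabs_pos m). lra. Qed.

(** The phases of the two sides differ by
    [s (w_l + w_j - w_(l+j))], with [w] the bracket, and this is at most [|s|]
    times the lower frequency.  The case [s' = s] compares the product of
    evolved factors with the evolved product, and [s' = - s] is the replacement
    on which the scheme is built. *)
Lemma wball_flow_conv_defect m s s' a b A B : wball wX a A -> wball wX b B ->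
  wball wL (fun k => (flow m (- s) (conv (flow m s a) (flow m s' b)) k
                   - conv a (flow m (s' - s) b) k)%C)
    (defect_const m * Rabs s * A * B).
Proof.
  intros ha hb.
  assert (sa : forall t, wball wX (flow m t a) A) by (intros; apply wball_flow; auto).
  assert (sb : forall t, wball wX (flow m t b) B) by (intros; apply wball_flow; auto).
  set (kap := fun l j => (phase m (- s) (l + j) * phase m s l * phase m s' j
                          - phase m (s' - s) j)%C).
  apply wball_ext with (tconv kap a b).
  { intros k. unfold flow at 1, multiplier at 1, conv, tconv.
    rewrite <- CZSeries_scal, <- CZSeries_minus.
    - apply CZSeries_ext; intros l. unfold kap, flow, multiplier.
      replace (l + (k - l))%Z with k by lia. ring.
    - apply summable_scal. now apply conv_summable with A B.
    - now apply conv_summable with A B.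
    - now apply conv_summable with A B. }
  assert (pos : 0 <= Rabs s * (2 + Rabs m))
    by (pose proof (Rabs_pos s); pose proof (Rabs_pos m); nra).
  replace (defect_const m * Rabs s * A * B)
    with (2 * (2 * (Rabs s * (2 + Rabs m))) * A * B) by (unfold defect_const; ring).
  apply wball_tconv with wX wX; auto. apply schur_defect; [exact pos|].
  assert (bd : forall l j, Cmod (kap l j)
             <= Rabs s * Rabs (bracket m l + bracket m j - bracket m (l + j))).
  { intros l j. rewrite <- Rabs_mult.
    unfold kap, phase. rewrite <- !Cexp_add.
    replace (Ci * (- s * bracket m (l + j))%R + Ci * (s * bracket m l)%R
             + Ci * (s' * bracket m j)%R)%C
      with (Ci * (- s * bracket m (l + j) + s * bracket m l + s' * bracket m j)%R)%C
      by (rewrite !RtoC_plus; ring).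
    eapply Rle_trans; [apply Cexp_i_lip|]. right; f_equal; ring. }
  pose proof (Rabs_pos s).
  intros l j; split; (eapply Rle_trans; [apply bd|]); rewrite Rmult_assoc;
    apply Rmult_le_compat_l; auto; [apply bracket_defect|].
  rewrite Z.add_comm. replace (bracket m l + bracket m j) with (bracket m j + bracket m l) by ring.
  apply bracket_defect.
Qed.

(** * Superposition operators *)

(** [E] acts on Fourier coefficients as the superposition operator
    [v |-> phi o v].  These are the properties of the nonlinearity that the
    error analysis uses, uniformly on H^{3/4} balls; the last one says that
    superposition commutes with the free flow up to [O(s)] in L^2.  A single
    constant keeps the closure properties below short. *)
Definition tame (m : R) (phi : C -> C) (E : distr -> distr) : Prop :=
  forall R, 0 <= R -> exists C, 0 <= C /\ forall a, wball wX a R ->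
    wball wX (E a) C /\
    (forall x, to_fun (E a) x = phi (to_fun a x)) /\
    (forall b d, wball wX b R -> wball wX (fun k => (a k - b k)%C) d ->
       wball wX (fun k => (E a k - E b k)%C) (C * d)) /\
    (forall s, wball wL (fun k => (flow m (- s) (E (flow m s a)) k - E a k)%C)
                 (C * Rabs s)).

(** The coefficients of the constant function 1. *)
Definition unit0 (k : Z) : C := if Z.eq_dec k 0 then 1%C else 0%C.

Lemma wt_0 : wt 0 = 1.
Proof.
  unfold wt. replace (1 + IZR 0 ^ 2) with 1 by (cbn; ring).
  unfold Rpower. rewrite ln_1, Rmult_0_r. apply exp_0.
Qed.

Lemma zsum_at0 N f : (forall k, k <> 0%Z -> f k = 0) -> zsum N f = f 0%Z.
Proof.
  intros h; induction N as [|N IH]; cbn [zsum]; [easy|].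
  rewrite IH, (h (Z.of_nat (S N))), (h (- Z.of_nat (S N))%Z) by lia. ring.
Qed.

Lemma wball_at0 w c : 0 <= w 0%Z ->
  wball w (fun k => (c * unit0 k)%C) (w 0%Z * Cmod c).
Proof.
  intros hw. split; [apply Rmult_le_pos; auto; apply Cmod_ge_0|]. intros N.
  rewrite zsum_at0.
  - unfold unit0; cbn. rewrite Cmult_1_r. lra.
  - intros k hk. unfold unit0. destruct Z.eq_dec; [easy|].
    rewrite Cmult_0_r, Cmod_0. ring.
Qed.

Lemma wball_X_unit0 : wball wX unit0 1.
Proof.
  pose proof (wball_at0 wX 1%C (wX_ge0 0)) as h.
  assert (e : wX 0 * Cmod 1%C = 1) by (unfold wX; rewrite wt_0, Cmod_1; ring).
  rewrite e in h. apply wball_ext with (2 := h). intros; ring.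
Qed.

Lemma to_fun_unit0 x : to_fun unit0 x = 1%C.
Proof.
  assert (h0 : forall N, czsum N (fun k => (unit0 k * mode k x)%C) = 1%C).
  { induction N as [|N IH].
    - rewrite czsum_0. unfold unit0; cbn. unfold mode. rewrite Rmult_0_l.
      replace (Ci * 0)%C with (RtoC 0) by ring. rewrite Cexp_0; ring.
    - rewrite czsum_S, IH. unfold unit0.
      destruct Z.eq_dec; [lia|]. destruct Z.eq_dec; [lia|]. ring. }
  apply CZSeries_unique.
  - apply (to_fun_summable unit0). apply (wball_X_summable _ 1), wball_X_unit0.
  - apply Clim_ext with (fun _ => 1%C); [intros; symmetry; apply h0|apply Clim_const].
Qed.

(** The flow turns the constant function with speed [bracket m 0 = |m|]. *)
Lemma wball_flow_unit0 m s : wball wL (fun k => (flow m s unit0 k - unit0 k)%C) (Rabs m * Rabs s).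
Proof.
  apply wball_ext with (fun k => ((phase m s 0 - 1) * unit0 k)%C).
  - intros k. unfold flow, multiplier, unit0. destruct Z.eq_dec as [->|_]; ring.
  - apply wball_le with (wL 0 * Cmod (phase m s 0 - 1)); [apply wball_at0; auto|].
    unfold wL; rewrite Rmult_1_l. eapply Rle_trans; [apply Cexp_i_minus1|].
    rewrite Rabs_mult, Rmult_comm.
    apply Rmult_le_compat_r; [apply Rabs_pos|].
    rewrite Rabs_pos_eq by apply sqrt_pos. pose proof (bracket_le m 0) as h.
    rewrite Rabs_R0 in h; lra.
Qed.

Lemma tame_id m : tame m (fun v => v) (fun a => a).
Proof.
  intros R hR. exists (R + 1). split; [lra|]. intros a ha.
  split; [apply wball_le with R; auto; lra|]. split; [easy|]. split.
  - intros b d hb hd. apply wball_le with d; [easy|]. pose proof (wball_ge0 _ _ _ hd). nra.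
  - intros s. apply wball_ext with (fun _ => 0%C).
    + intros k. rewrite flow_flow, Rplus_opp_l, flow_0. ring.
    + apply wball_le with 0; [apply wball_zero|]. pose proof (Rabs_pos s). nra.
Qed.

Lemma tame_one m : tame m (fun _ => 1%C) (fun _ => unit0).
Proof.
  intros R hR. exists (1 + Rabs m). pose proof (Rabs_pos m). split; [lra|]. intros a ha.
  split; [apply wball_le with 1; [apply wball_X_unit0|lra]|].
  split; [apply to_fun_unit0|]. split.
  - intros b d hb hd. apply wball_ext with (fun _ => 0%C); [intros; ring|].
    apply wball_le with 0; [apply wball_zero|]. pose proof (wball_ge0 _ _ _ hd). nra.
  - intros s. apply wball_le with (Rabs m * Rabs (- s)); [apply wball_flow_unit0|].
    rewrite Rabs_Ropp. pose proof (Rabs_pos s). nra.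
Qed.

Lemma tame_plus m p P q Q : tame m p P -> tame m q Q ->
  tame m (fun v => (p v + q v)%C) (fun a k => (P a k + Q a k)%C).
Proof.
  intros hp hq R hR. destruct (hp R hR) as (A & hA & ha).
  destruct (hq R hR) as (B & hB & hb). exists (A + B). split; [lra|]. intros a hX.
  destruct (ha a hX) as (a1 & a2 & a3 & a4). destruct (hb a hX) as (b1 & b2 & b3 & b4).
  split; [now apply wball_plus|]. split; [|split].
  - intros x. rewrite to_fun_plus, a2, b2; [easy|eapply wball_X_summable; eauto..].
  - intros b d hXb hd. rewrite Rmult_plus_distr_r.
    eapply wball_ext; [|apply (wball_plus wX _ _ _ _ wX_ge0 (a3 b d hXb hd) (b3 b d hXb hd))].
    intros k; cbv beta; ring.
  - intros s. rewrite Rmult_plus_distr_r.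
    eapply wball_ext; [|apply (wball_plus wL _ _ _ _ wL_ge0 (a4 s) (b4 s))].
    intros k; cbv beta; unfold flow, multiplier; ring.
Qed.

Lemma tame_scal m c p P : tame m p P ->
  tame m (fun v => (c * p v)%C) (fun a k => (c * P a k)%C).
Proof.
  intros hp R hR. destruct (hp R hR) as (A & hA & ha).
  pose proof (Cmod_ge_0 c).
  exists (Cmod c * A). split; [nra|]. intros a hX.
  destruct (ha a hX) as (a1 & a2 & a3 & a4).
  split; [now apply wball_scal|]. split; [|split].
  - intros x. rewrite to_fun_scal, a2; [easy|eapply wball_X_summable; eauto].
  - intros b d hXb hd. rewrite Rmult_assoc.
    eapply wball_ext; [|apply (wball_scal wX c _ _ wX_ge0 (a3 b d hXb hd))].
    intros k; cbv beta; ring.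
  - intros s. rewrite Rmult_assoc.
    eapply wball_ext; [|apply (wball_scal wL c _ _ wL_ge0 (a4 s))].
    intros k; cbv beta; unfold flow, multiplier; ring.
Qed.

Lemma tame_dilation m c p P : tame m p P ->
  tame m (fun v => p (c * v)%C) (fun a => P (fun k => (c * a k)%C)).
Proof.
  intros hp R hR. pose proof (Cmod_ge_0 c).
  destruct (hp (Cmod c * R)) as (A & hA & ha); [nra|].
  exists (A * (1 + Cmod c)). split; [nra|]. intros a hX.
  destruct (ha (fun k => (c * a k)%C)) as (a1 & a2 & a3 & a4); [now apply wball_scal|].
  split; [apply wball_le with A; auto; nra|]. split; [|split].
  - intros x. rewrite a2, to_fun_scal; [easy|eapply wball_X_summable; eauto].
  - intros b d hXb hd. pose proof (wball_ge0 _ _ _ hd).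
    apply wball_le with (A * (Cmod c * d)); [|nra].
    apply a3; [now apply wball_scal|].
    eapply wball_ext; [|apply (wball_scal wX c _ _ wX_ge0 hd)].
    intros k; cbv beta; ring.
  - intros s. pose proof (Rabs_pos s).
    apply wball_le with (A * Rabs s); [|apply Rmult_le_compat_r; [easy|nra]].
    replace (fun k => (c * flow m s a k)%C) with (flow m s (fun k => (c * a k)%C)); [apply a4|].
    apply functional_extensionality; intros k; unfold flow, multiplier; ring.
Qed.

Lemma wball_conv_diff_X a a' b b' A B d e :
  wball wX a A -> wball wX a' A -> wball wX b B -> wball wX b' B ->
  wball wX (fun k => (a k - a' k)%C) d -> wball wX (fun k => (b k - b' k)%C) e ->
  wball wX (fun k => (conv a b k - conv a' b' k)%C) (48 * d * B + 48 * A * e).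
Proof.
  intros ha ha' hb hb' hd he.
  apply wball_ext with (fun k => (conv (fun j => (a j - a' j)%C) b k
                               + conv a' (fun j => (b j - b' j)%C) k)%C).
  - intros k. rewrite (conv_minus_l a a' b A A B), (conv_minus_r a' b b' A B B);
      auto using wball_X_L. ring.
  - apply wball_plus; auto; now apply wball_conv_XX.
Qed.

Lemma wball_conv_diff_L a a' b b' A B d e :
  wball wX a A -> wball wX a' A -> wball wX b B -> wball wX b' B ->
  wball wL (fun k => (a k - a' k)%C) d -> wball wL (fun k => (b k - b' k)%C) e ->
  wball wL (fun k => (conv a b k - conv a' b' k)%C) (6 * d * B + 6 * A * e).
Proof.
  intros ha ha' hb hb' hd he.
  apply wball_ext with (fun k => (conv (fun j => (a j - a' j)%C) b k
                               + conv a' (fun j => (b j - b' j)%C) k)%C).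
  - intros k. rewrite (conv_minus_l a a' b A A B), (conv_minus_r a' b b' A B B);
      auto using wball_X_L. ring.
  - apply wball_plus; auto; [now apply wball_conv_LX|now apply wball_conv_XL].
Qed.

(** The flow property is [wball_flow_conv_defect] with [s' = s]. *)
Lemma tame_square m : tame m (fun v => (v ^ 2)%C) (fun a => conv a a).
Proof.
  intros R hR. set (D := defect_const m). pose proof (defect_const_ge0 m).
  exists ((48 * R + 96) * R + D * R * R). assert (0 <= D) by easy.
  assert (0 <= D * R * R) by (apply Rmult_le_pos; [apply Rmult_le_pos|]; auto).
  split; [nra|]. intros a ha. split; [|split; [|split]].
  - apply wball_le with (48 * R * R); [now apply wball_conv_XX|nra].
  - intros x. rewrite (to_fun_conv a a R R) by easy. cbn [Cpow]. ring.
  - intros b d hb hd. pose proof (wball_ge0 _ _ _ hd).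
    apply wball_le with (48 * d * R + 48 * R * d); [|nra].
    now apply wball_conv_diff_X.
  - intros s. apply wball_le with (D * Rabs s * R * R).
    + eapply wball_ext; [|apply (wball_flow_conv_defect m s s a a R R ha ha)].
      intros k; cbv beta. rewrite Rminus_diag, flow_0. ring.
    + pose proof (Rabs_pos s). nra.
Qed.

(** * Superposition with the exponential, the sine and the cosine *)

Fixpoint conv_pow (n : nat) (a : distr) : distr :=
  match n with
  | O => unit0
  | S n => conv (conv_pow n a) a
  end.

(** Fourier coefficients of the exponential of a function, see [tame_exp]. *)
Definition exp_seq (a : distr) : distr := fun k =>
  (Series (fun n => / INR (fact n) * Re (conv_pow n a k)),
   Series (fun n => / INR (fact n) * Im (conv_pow n a k))).

Lemma wball_conv_pow a R n : 0 <= R -> wball wX a R -> wball wX (conv_pow n a) ((48 * R + 48) ^ n).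
Proof.
  intros hR ha. induction n as [|n IH]; [apply wball_X_unit0|].
  apply wball_le with (48 * (48 * R + 48) ^ n * R); [now apply wball_conv_XX|].
  pose proof (pow_le (48 * R + 48) n ltac:(lra)). cbn [pow]. nra.
Qed.

Lemma succ_le_pow2 n : INR (S n) <= 2 ^ n.
Proof.
  induction n as [|n IH]; [cbn; lra|].
  rewrite S_INR. cbn [pow]. assert (1 <= 2 ^ n) by (apply pow_R1_Rle; lra). lra.
Qed.

(** Turns the factor [n + 1] produced by the Leibniz rule into geometric growth,
    which the exponential series absorbs. *)
Lemma wball_pow_growth w (u : nat -> distr) rho d : 0 <= rho -> 0 <= d ->
  (forall n, wball w (u n) (INR (S n) * rho ^ n * d)) ->
  forall n, wball w (u n) (d * (2 * rho) ^ n).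
Proof.
  intros hr hd h n. apply wball_le with (1 := h n).
  rewrite Rpow_mult_distr. pose proof (succ_le_pow2 n). pose proof (pow_le rho n hr).
  replace (d * (2 ^ n * rho ^ n)) with (2 ^ n * rho ^ n * d) by ring.
  apply Rmult_le_compat_r; [easy|]. now apply Rmult_le_compat_r.
Qed.

Lemma wball_conv_pow_lip a b R d n : 0 <= R -> wball wX a R -> wball wX b R ->
  wball wX (fun k => (a k - b k)%C) d ->
  wball wX (fun k => (conv_pow n a k - conv_pow n b k)%C) (INR (S n) * (48 * R + 48) ^ n * d).
Proof.
  intros hR ha hb hd. pose proof (wball_ge0 _ _ _ hd) as d0.
  induction n as [|n IH].
  - apply wball_ext with (fun _ => 0%C); [intros; cbn; ring|].
    apply wball_le with 0; [apply wball_zero|]. cbn; lra.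
  - set (rho := 48 * R + 48) in *.
    pose proof (pow_le rho n ltac:(unfold rho; lra)) as hp. pose proof (pos_INR (S n)).
    apply wball_le with (48 * (INR (S n) * rho ^ n * d) * R + 48 * rho ^ n * d).
    + apply wball_conv_diff_X; auto; now apply wball_conv_pow.
    + rewrite (S_INR (S n)). cbn [pow].
      assert (0 <= INR (S n) * rho ^ n * d) by (apply Rmult_le_pos; [now apply Rmult_le_pos|easy]).
      assert (0 <= rho ^ n * d) by now apply Rmult_le_pos.
      replace ((INR (S n) + 1) * (rho * rho ^ n) * d)
        with (rho * (INR (S n) * rho ^ n * d) + rho * (rho ^ n * d)) by ring.
      assert (48 * R * (INR (S n) * rho ^ n * d) <= rho * (INR (S n) * rho ^ n * d))
        by (apply Rmult_le_compat_r; [easy|unfold rho; lra]).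
      assert (48 * (rho ^ n * d) <= rho * (rho ^ n * d))
        by (apply Rmult_le_compat_r; [easy|unfold rho; lra]).
      lra.
Qed.

(** By induction: with [P] the [n]-th power pulled back along the flow, one more
    factor adds the defect of the product [P a] to the previous error. *)
Lemma wball_conv_pow_flow m a R s n : 0 <= R -> wball wX a R ->
  wball wL (fun k => (flow m (- s) (conv_pow n (flow m s a)) k - conv_pow n a k)%C)
    (INR (S n) * (48 * R + 48) ^ n * ((defect_const m + Rabs m) * Rabs s)).
Proof.
  intros hR ha. pose proof (defect_const_ge0 m) as h0.
  pose proof (Rabs_pos m). pose proof (Rabs_pos s).
  set (D := defect_const m) in *. set (d := (D + Rabs m) * Rabs s).
  assert (d0 : 0 <= d) by (unfold d; apply Rmult_le_pos; lra).
  induction n as [|n IH].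
  - apply wball_le with (Rabs m * Rabs (- s)); [apply wball_flow_unit0|].
    rewrite Rabs_Ropp. cbn [pow INR]. unfold d. nra.
  - set (rho := 48 * R + 48) in *.
    pose proof (pow_le rho n ltac:(unfold rho; lra)) as hp. pose proof (pos_INR (S n)).
    set (P := flow m (- s) (conv_pow n (flow m s a))) in *.
    assert (hP : wball wX P (rho ^ n)).
    { apply wball_flow; auto. apply wball_conv_pow; auto. apply wball_flow; auto. }
    assert (eP : conv_pow n (flow m s a) = flow m s P)
      by (unfold P; now rewrite flow_flow, Rplus_opp_r, flow_0).
    apply wball_le with ((6 * (INR (S n) * rho ^ n * d) * R + 6 * rho ^ n * 0)
                      + D * Rabs s * rho ^ n * R).
    + eapply wball_ext; [|apply (wball_plus wL
        (fun k => (conv P a k - conv (conv_pow n a) a k)%C)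
        (fun k => (flow m (- s) (conv (flow m s P) (flow m s a)) k
                   - conv P (flow m (s - s) a) k)%C)); auto].
      * intros k; cbv beta. cbn [conv_pow]. rewrite eP, Rminus_diag, flow_0. ring.
      * apply wball_conv_diff_L; auto; [now apply wball_conv_pow|].
        apply wball_ext with (fun _ => 0%C); [intros; ring|apply wball_zero].
      * now apply wball_flow_conv_defect.
    + rewrite (S_INR (S n)). cbn [pow].
      assert (0 <= INR (S n) * rho ^ n * d) by (apply Rmult_le_pos; [now apply Rmult_le_pos|easy]).
      assert (0 <= rho ^ n * d) by now apply Rmult_le_pos.
      assert (D * Rabs s <= d) by (unfold d; nra).
      assert (D * Rabs s * rho ^ n <= rho ^ n * d) by nra.
      assert (D * Rabs s * rho ^ n * R <= rho ^ n * d * R) by (apply Rmult_le_compat_r; auto).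
      replace ((INR (S n) + 1) * (rho * rho ^ n) * d)
        with (rho * (INR (S n) * rho ^ n * d) + rho * (rho ^ n * d)) by ring.
      assert (6 * R * (INR (S n) * rho ^ n * d) <= rho * (INR (S n) * rho ^ n * d))
        by (apply Rmult_le_compat_r; [easy|unfold rho; lra]).
      assert (R * (rho ^ n * d) <= rho * (rho ^ n * d))
        by (apply Rmult_le_compat_r; [easy|unfold rho; lra]).
      lra.
Qed.

Lemma exp_sum_minus N (u v : nat -> C) :
  exp_sum N (fun n => (u n - v n)%C) = (exp_sum N u - exp_sum N v)%C.
Proof. induction N as [|N IH]; cbn [exp_sum]; [ring|]. rewrite IH; ring. Qed.

Lemma exp_sum_scal N c (u : nat -> C) : exp_sum N (fun n => (c * u n)%C) = (c * exp_sum N u)%C.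
Proof. induction N as [|N IH]; cbn [exp_sum]; [ring|]. rewrite IH; ring. Qed.

Lemma exp_seq_lim a R k : 0 <= R -> wball wX a R ->
  Clim_seq (fun N => exp_sum N (fun n => conv_pow n a k)) (exp_seq a k).
Proof.
  intros hR ha. apply (exp_sum_lim (fun n => conv_pow n a k) (48 * R + 48) 1); [lra|].
  intros n. rewrite Rmult_1_l.
  pose proof (wball_term wX _ _ k wX_ge0 (wball_conv_pow a R n hR ha)) as t.
  pose proof (pow_R1_Rle _ 3 (wt_ge1 k)) as h. change (1 <= wX k) in h.
  pose proof (Cmod_ge_0 (conv_pow n a k)). nra.
Qed.

Lemma to_fun_conv_pow a R n x : 0 <= R -> wball wX a R ->
  to_fun (conv_pow n a) x = (to_fun a x ^ n)%C.
Proof.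
  intros hR ha; induction n as [|n IH]; [apply to_fun_unit0|].
  cbn [conv_pow Cpow]. rewrite (to_fun_conv _ _ ((48 * R + 48) ^ n) R), IH; auto; [ring|].
  now apply wball_conv_pow.
Qed.

Lemma wball_exp_partial a R N : 0 <= R -> wball wX a R ->
  wball wX (fun k => exp_sum N (fun n => conv_pow n a k)) (1 * exp (48 * R + 48)).
Proof.
  intros hR ha. apply wball_exp_sum; auto; [lra|lra|].
  intros n. rewrite Rmult_1_l. now apply wball_conv_pow.
Qed.

Lemma to_fun_exp_partial a R N x : 0 <= R -> wball wX a R ->
  to_fun (fun k => exp_sum N (fun n => conv_pow n a k)) x = exp_sum N (Cpow (to_fun a x)).
Proof.
  intros hR ha. induction N as [|N IH]; cbn [exp_sum]; [now apply to_fun_conv_pow with R|].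
  rewrite <- IH, <- (to_fun_conv_pow a R (S N) x hR ha).
  assert (sc : summable (conv_pow (S N) a)) by (eapply wball_X_summable, wball_conv_pow; eauto).
  rewrite <- to_fun_scal by exact sc. apply to_fun_plus.
  - eapply wball_X_summable, wball_exp_partial; eauto.
  - now apply summable_scal.
Qed.

Lemma tame_exp m : tame m Cexp exp_seq.
Proof.
  intros R hR. set (rho := 48 * R + 48).
  pose proof (defect_const_ge0 m). pose proof (Rabs_pos m).
  set (D := defect_const m + Rabs m).
  assert (E1 : 1 <= exp (2 * rho)).
  { rewrite <- exp_0. left; apply exp_increasing. unfold rho; lra. }
  assert (E2 : exp rho <= exp (2 * rho)).
  { left; apply exp_increasing. unfold rho; lra. }
  assert (hD : 0 <= D) by (unfold D; lra).
  exists ((1 + D) * exp (2 * rho)). split; [nra|]. intros a ha.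
  assert (lima : forall k, Clim_seq (fun N => exp_sum N (fun n => conv_pow n a k)) (exp_seq a k)).
  { intros k; now apply exp_seq_lim with R. }
  split; [|split; [|split]].
  - apply wball_le with (1 * exp rho); [|nra].
    apply (wball_lim wX (fun N k => exp_sum N (fun n => conv_pow n a k))); auto.
    intros N; now apply wball_exp_partial.
  - intros x.
    apply Clim_unique with (fun N => to_fun (fun k => exp_sum N (fun n => conv_pow n a k)) x).
    + apply (to_fun_lim (fun N k => exp_sum N (fun n => conv_pow n a k)) _ (1 * exp rho)); auto.
      intros N; now apply wball_exp_partial.
    + eapply Clim_ext; [|apply Cexp_series].
      intros N; symmetry; now apply to_fun_exp_partial with R.
  - intros b d hb hd. pose proof (wball_ge0 _ _ _ hd) as d0.
    apply wball_le with (d * exp (2 * rho)).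
    2:{ assert (0 <= D * (exp (2 * rho) * d)) by (repeat apply Rmult_le_pos; lra). lra. }
    apply (wball_lim wX (fun N k => (exp_sum N (fun n => conv_pow n a k)
                                  - exp_sum N (fun n => conv_pow n b k))%C)).
    + intros N. apply wball_ext with (fun k => exp_sum N (fun n => (conv_pow n a k - conv_pow n b k)%C)).
      { intros k; now rewrite exp_sum_minus. }
      apply (wball_exp_sum wX (fun n k => (conv_pow n a k - conv_pow n b k)%C)); auto; [unfold rho; lra|].
      apply (wball_pow_growth wX (fun n k => (conv_pow n a k - conv_pow n b k)%C));
        [unfold rho; lra|easy|].
      intros n; now apply wball_conv_pow_lip.
    + intros k. apply Clim_minus; [apply lima|now apply exp_seq_lim with R].
  - intros s. pose proof (Rabs_pos s).
    assert (hfa : wball wX (flow m s a) R) by (apply wball_flow; auto).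
    assert (ds : 0 <= D * Rabs s) by (apply Rmult_le_pos; auto).
    apply wball_le with (D * Rabs s * exp (2 * rho)).
    2:{ assert (0 <= exp (2 * rho) * Rabs s) by (apply Rmult_le_pos; lra). lra. }
    apply (wball_lim wL (fun N k => (phase m (- s) k * exp_sum N (fun n => conv_pow n (flow m s a) k)
                                  - exp_sum N (fun n => conv_pow n a k))%C)).
    + intros N. apply wball_ext with
        (fun k => exp_sum N (fun n => (flow m (- s) (conv_pow n (flow m s a)) k - conv_pow n a k)%C)).
      { intros k. rewrite exp_sum_minus. unfold flow at 1, multiplier at 1.
        now rewrite exp_sum_scal. }
      apply (wball_exp_sum wL (fun n k => (flow m (- s) (conv_pow n (flow m s a)) k - conv_pow n a k)%C));
        auto; [unfold rho; lra|].
      apply (wball_pow_growth wL (fun n k => (flow m (- s) (conv_pow n (flow m s a)) k - conv_pow n a k)%C));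
        [unfold rho; lra|easy|].
      intros n; now apply wball_conv_pow_flow.
    + intros k. apply Clim_minus; [|apply lima].
      apply Clim_mult; [apply Clim_const|now apply exp_seq_lim with R].
Qed.

Lemma tame_ext m p q P : (forall v, p v = q v) -> tame m p P -> tame m q P.
Proof.
  intros e h R hR. destruct (h R hR) as (C & hC & H). exists C; split; [easy|].
  intros a ha. destruct (H a ha) as (h1 & h2 & h3 & h4).
  split; [easy|]. split; [intros x; now rewrite h2|]. now split.
Qed.

Lemma tame_sin_half m : exists E, tame m (fun v => Csin (v / 2)) E.
Proof.
  eexists. apply tame_ext with
    (fun v => (/ (2 * Ci) * Cexp ((Ci / 2) * v) + (- / (2 * Ci)) * Cexp ((- (Ci / 2)) * v))%C).
  - intros v. unfold Csin.
    replace (Ci * (v / 2))%C with (Ci / 2 * v)%C by (unfold Cdiv; ring).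
    replace (- (Ci / 2 * v))%C with (- (Ci / 2) * v)%C by ring. unfold Cdiv; ring.
  - apply tame_plus; apply tame_scal, (tame_dilation m _ Cexp), tame_exp.
Qed.

Lemma tame_cos_half m : exists E, tame m (fun v => Ccos (v / 2)) E.
Proof.
  eexists. apply tame_ext with
    (fun v => (/ 2 * Cexp ((Ci / 2) * v) + / 2 * Cexp ((- (Ci / 2)) * v))%C).
  - intros v. unfold Ccos.
    replace (Ci * (v / 2))%C with (Ci / 2 * v)%C by (unfold Cdiv; ring).
    replace (- (Ci / 2 * v))%C with (- (Ci / 2) * v)%C by ring. unfold Cdiv; ring.
  - apply tame_plus; apply tame_scal, (tame_dilation m _ Cexp), tame_exp.
Qed.

Lemma tame_F m nl : exists Ps, Forall2 (tame m) (F nl) Ps.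
Proof.
  destruct nl; cbn [F].
  - exists [fun a => conv a a; fun _ => unit0; fun a k => (2 * a k)%C].
    repeat constructor; [apply tame_square|apply tame_one|].
    apply (tame_scal m 2 (fun v => v) (fun a => a)), tame_id.
  - destruct (tame_sin_half m) as [S hS]. destruct (tame_cos_half m) as [K hK].
    exists [S; K]. now repeat constructor.
Qed.

Lemma tame_G m nl : exists Qs, Forall2 (tame m) (G nl) Qs.
Proof.
  destruct nl; cbn [G].
  - exists [fun _ => unit0; fun a => conv a a; fun a => a].
    repeat constructor; [apply tame_one|apply tame_square|apply tame_id].
  - destruct (tame_sin_half m) as [S hS]. destruct (tame_cos_half m) as [K hK].
    exists [K; S]. now repeat constructor.
Qed.

(** * The filter *)

Lemma symbA_eq m k : symbA m k = (Ci * RtoC (- 2 * bracket m k))%C.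
Proof.
  unfold symbA, symbL. apply injective_projections; cbn; ring.
Qed.

Lemma symbA_neq0 m k : m <> 0 -> symbA m k <> 0%C.
Proof.
  intros hm e. rewrite symbA_eq in e. apply (f_equal Im) in e. cbn in e.
  pose proof (bracket_pos m k hm). lra.
Qed.

Lemma Cmod_Ci : Cmod Ci = 1.
Proof.
  unfold Cmod, Ci; cbn. replace (0 * (0 * 1) + 1 * (1 * 1)) with 1 by ring.
  apply sqrt_1.
Qed.

Lemma Cexp_i_taylor1 (y : R) : Cmod (Cexp (Ci * y) - 1 - Ci * y) <= y ^ 2.
Proof.
  set (f := fun t : R => (Cexp (t * (Ci * y)) - t * (Ci * y))%C).
  set (df := fun t : R => (Ci * y * (Cexp (t * (Ci * y)) - 1))%C).
  assert (hd : forall t, cder f t (df t)).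
  { intros t. apply cder_eq with (Ci * y * Cexp (t * (Ci * y)) - (1 * (Ci * y) + t * 0))%C.
    - unfold df; ring.
    - apply cder_minus; [apply cder_Cexp|].
      apply cder_mult; [apply cder_id|apply cder_const]. }
  assert (hb : forall t, 0 < t < 1 -> Cmod (df t) <= y ^ 2).
  { intros t ht. unfold df. rewrite !Cmod_mult, Cmod_Ci, Cmod_R, Rmult_1_l, <- (pow2_abs y).
    replace (t * (Ci * y))%C with (Ci * RtoC (t * y))%C by (rewrite RtoC_mult; ring).
    pose proof (Cexp_i_minus1 (t * y)) as L. rewrite Rabs_mult in L.
    rewrite (Rabs_pos_eq t) in L by lra. pose proof (Rabs_pos y).
    cbn [pow]. rewrite Rmult_1_r. apply Rmult_le_compat_l; [easy|]. nra. }
  pose proof (cder_mvt f df 0 1 _ Rlt_0_1 (pow2_ge_0 y) hd hb) as E.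
  rewrite Rminus_0_r, Rmult_1_r in E.
  replace (Cexp (Ci * y) - 1 - Ci * y)%C with (f 1 - f 0)%C; [exact E|].
  unfold f. replace (RtoC 1 * (Ci * y))%C with (Ci * y)%C by ring.
  replace (RtoC 0 * (Ci * y))%C with (RtoC 0) by ring. rewrite Cexp_0. ring.
Qed.

Definition phi1_mult (m tau : R) (a : distr) : distr :=
  multiplier (fun k => phi1 (tau * symbA m k)) a.

Lemma Cmod_phi1_le m tau k : m <> 0 -> tau <> 0 -> Cmod (phi1 (tau * symbA m k)) <= 1.
Proof.
  intros hm ht. unfold phi1, Cdiv. rewrite symbA_eq.
  pose proof (bracket_pos m k hm).
  set (y := tau * (- 2 * bracket m k)).
  assert (hy : y <> 0).
  { unfold y. apply Rmult_integral_contrapositive_currified; [easy|lra]. }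
  replace (tau * (Ci * RtoC (- 2 * bracket m k)))%C with (Ci * RtoC y)%C
    by (unfold y; rewrite RtoC_mult; ring).
  rewrite Cmod_mult, Cmod_inv, Cmod_mult, Cmod_Ci, Cmod_R, Rmult_1_l.
  2:{ intros e. apply (f_equal Im) in e. cbn in e. lra. }
  pose proof (Cexp_i_minus1 y). pose proof (Rabs_pos_lt y hy).
  apply Rmult_le_reg_r with (Rabs y); [easy|].
  rewrite Rmult_assoc, Rinv_l, Rmult_1_l, Rmult_1_r; lra.
Qed.

Lemma wball_phi1_mult w m tau a A : (forall k, 0 <= w k) -> m <> 0 -> tau <> 0 ->
  wball w a A -> wball w (phi1_mult m tau a) A.
Proof.
  intros hw hm ht ha. rewrite <- (Rmult_1_l A). apply wball_dom with w a; [lra| |exact ha].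
  intros k. unfold phi1_mult, multiplier. rewrite Cmod_mult, Rmult_1_l.
  pose proof (Cmod_phi1_le m tau k hm ht). pose proof (Cmod_ge_0 (phi1 (tau * symbA m k))).
  pose proof (Cmod_ge_0 (a k)). pose proof (hw k).
  split; [repeat apply Rmult_le_pos; auto|].
  apply Rmult_le_compat_l; [easy|]. nra.
Qed.

(** In this form the left side is a smooth function of [tau], also at 0. *)
Lemma scaled_phi1 m (tau : R) k : m <> 0 ->
  (tau * phi1 (tau * symbA m k) = (phase m (-2 * tau) k - 1) / symbA m k)%C.
Proof.
  intros hm. pose proof (symbA_neq0 m k hm) as h0.
  assert (e : phase m (-2 * tau) k = Cexp (tau * symbA m k)).
  { unfold phase. rewrite symbA_eq. f_equal.
    replace (-2 * tau * bracket m k) with (tau * (- 2 * bracket m k)) by ring.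
    rewrite RtoC_mult; ring. }
  rewrite e. unfold phi1. destruct (Req_dec tau 0) as [->|nz].
  - replace (RtoC 0 * symbA m k)%C with (RtoC 0) by ring. rewrite Cexp_0.
    unfold Cdiv; ring.
  - field. split; [exact h0|]. intros E. apply (f_equal Re) in E. cbn in E. lra.
Qed.

(** [tau phi_1(tau A)] is a primitive of [e^{tau A}] in [tau]; the remainder costs
    one application of [A]. *)
Lemma scaled_phi1_taylor m (t h : R) k : m <> 0 ->
  Cmod ((RtoC (t + h) * phi1 (RtoC (t + h) * symbA m k) - t * phi1 (t * symbA m k))
        - h * phase m (-2 * t) k)%C <= 2 * bracket m k * h ^ 2.
Proof.
  intros hm. pose proof (symbA_neq0 m k hm) as h0. pose proof (bracket_pos m k hm) as hb.
  rewrite !scaled_phi1 by easy.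
  set (y := h * (- 2 * bracket m k)).
  assert (e : phase m (-2 * (t + h)) k = (phase m (-2 * t) k * Cexp (Ci * RtoC y))%C).
  { unfold phase. rewrite <- Cexp_add. f_equal. unfold y.
    replace (-2 * (t + h) * bracket m k) with (-2 * t * bracket m k + h * (-2 * bracket m k)) by ring.
    rewrite RtoC_plus; ring. }
  assert (ey : (Ci * RtoC y = h * symbA m k)%C).
  { unfold y. rewrite symbA_eq, RtoC_mult; ring. }
  rewrite e.
  replace ((phase m (-2 * t) k * Cexp (Ci * RtoC y) - 1) / symbA m k
           - (phase m (-2 * t) k - 1) / symbA m k - h * phase m (-2 * t) k)%C
    with (phase m (-2 * t) k * (Cexp (Ci * RtoC y) - 1 - Ci * RtoC y) * / symbA m k)%C.
  2:{ rewrite ey. field. exact h0. }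
  rewrite !Cmod_mult, Cmod_phase, Rmult_1_l, Cmod_inv by exact h0.
  rewrite symbA_eq at 1. rewrite Cmod_mult, Cmod_Ci, Cmod_R, Rmult_1_l.
  replace (Rabs (- 2 * bracket m k)) with (2 * bracket m k)
    by (rewrite Rabs_left by lra; ring).
  apply Rmult_le_reg_r with (2 * bracket m k); [lra|].
  rewrite Rmult_assoc, Rinv_l, Rmult_1_r by lra.
  eapply Rle_trans; [apply Cexp_i_taylor1|]. unfold y. right; ring.
Qed.

Lemma is_derive_quadratic (f : R -> R) t l c :
  (forall h, Rabs (f (t + h) - f t - h * l) <= c * h ^ 2) -> is_derive f t l.
Proof.
  intros H. apply is_derive_Reals. intros eps heps.
  assert (c0 : 0 <= c).
  { specialize (H 1). pose proof (Rabs_pos (f (t + 1) - f t - 1 * l)). lra. }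
  assert (hd : 0 < eps / (c + 1)) by (apply Rdiv_lt_0_compat; lra).
  exists (mkposreal _ hd). intros h hn hh. cbn in hh.
  replace ((f (t + h) - f t) / h - l) with ((f (t + h) - f t - h * l) / h) by (field; easy).
  pose proof (Rabs_pos_lt h hn) as ph.
  unfold Rdiv. rewrite Rabs_mult, Rabs_inv.
  apply Rmult_lt_reg_r with (Rabs h); [easy|].
  rewrite Rmult_assoc, Rinv_l, Rmult_1_r by lra.
  eapply Rle_lt_trans; [apply H|]. rewrite <- (pow2_abs h).
  assert (h1 : Rabs h * (c + 1) < eps).
  { apply Rmult_lt_reg_r with (/ (c + 1)); [apply Rinv_0_lt_compat; lra|].
    rewrite Rmult_assoc, Rinv_r, Rmult_1_r by lra. exact hh. }
  nra.
Qed.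

Lemma cder_quadratic (f : R -> C) t l c :
  (forall h : R, Cmod (f (t + h)%R - f t - h * l)%C <= c * h ^ 2) -> cder f t l.
Proof.
  intros H. split; apply is_derive_quadratic with c; intros h; specialize (H h).
  - eapply Rle_trans; [|exact H]. eapply Rle_trans; [|apply Re_le_Cmod].
    right. f_equal. cbn; unfold Re; ring.
  - eapply Rle_trans; [|exact H]. eapply Rle_trans; [|apply Im_le_Cmod].
    right. f_equal. cbn; unfold Im; ring.
Qed.

Lemma zsum_dual_le N k f g A B : wball wX f A -> wball wX g B ->
  zsum N (fun l => (wX l * Cmod (f l)) * (wX (k - l)%Z * Cmod (g (k - l)%Z))) <= A * B.
Proof.
  intros [hA hf] [hB hg]. apply Rsqr_incr_0_var; [|nra]. rewrite !Rsqr_pow2.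
  eapply Rle_trans;
    [apply (zsum_cauchy_schwarz N (fun l => wX l * Cmod (f l))
              (fun l => wX (k - l)%Z * Cmod (g (k - l)%Z)))|].
  rewrite Rpow_mult_distr.
  apply Rmult_le_compat; try (apply zsum_ge0; auto); [apply hf|].
  eapply Rle_trans;
    [apply (zsum_reflect_shift_le N k (fun j => (wX j * Cmod (g j)) ^ 2))|apply hg].
  auto.
Qed.

(** The series is differentiated term by term.  Its remainder carries one
    derivative [wt j ^ 4] of the second factor; as the output frequency [k] is
    fixed, [wt j <= 2 wt k wt l] moves a quarter of it to the first factor, and
    both factors are then paired in H^{3/4}. *)
Lemma cder_conv_phi1 m f g A B k (t : R) : m <> 0 -> wball wX f A -> wball wX g B ->
  cder (fun t => (RtoC t * conv f (phi1_mult m t g) k)%C) t (conv f (flow m (-2 * t) g) k).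
Proof.
  intros hm hf hg.
  (* Unlike the quotient [phi1], its product with [t] is harmless at [t = 0]. *)
  set (psi := fun (t : R) j => (RtoC t * phi1 (RtoC t * symbA m j))%C).
  assert (bpsi : forall t j, Cmod (psi t j) <= Rabs t).
  { intros s j. unfold psi. destruct (Req_dec s 0) as [->|nz].
    - rewrite Cmult_0_l, Cmod_0, Rabs_R0; lra.
    - rewrite Cmod_mult, Cmod_R. rewrite <- (Rmult_1_r (Rabs s)) at 2.
      apply Rmult_le_compat_l; [apply Rabs_pos|].
      now apply Cmod_phi1_le. }
  assert (sum : forall s, summable (fun l => (psi s (k - l)%Z * (f l * g (k - l)%Z))%C)).
  { intros s.
    apply (tconv_summable_XL (fun _ j => psi s j) (Rabs s) f g A B); auto using wball_X_L, Rabs_pos. }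
  assert (sum' : summable (fun l => (phase m (-2 * t) (k - l)%Z * (f l * g (k - l)%Z))%C)).
  { apply (tconv_summable_XL (fun _ j => phase m (-2 * t) j) 1 f g A B); auto using wball_X_L.
    - lra.
    - intros; rewrite Cmod_phase; lra. }
  apply cder_ext with (fun s => CZSeries (fun l => (psi s (k - l)%Z * (f l * g (k - l)%Z))%C)).
  { intros s. destruct (Req_dec s 0) as [->|nz].
    - rewrite Cmult_0_l. apply CZSeries_unique; [apply sum|].
      apply Clim_ext with (fun _ => RtoC 0); [|apply Clim_const].
      intros N. symmetry. apply injective_projections;
        rewrite (czsum_ext N _ (fun _ => RtoC 0));
        try (intros; unfold psi; ring); unfold czsum; cbn; apply zsum_zero.
    - unfold conv, tconv. rewrite <- CZSeries_scal
        by (apply conv_summable with A B; auto; now apply wball_phi1_mult).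
      apply CZSeries_ext; intros l. unfold psi, phi1_mult, multiplier. ring. }
  apply cder_eq with (CZSeries (fun l => (phase m (-2 * t) (k - l)%Z * (f l * g (k - l)%Z))%C)).
  { apply CZSeries_ext; intros l. unfold flow, multiplier. ring. }
  apply cder_quadratic with (4 * (1 + Rabs m) * wt k * (A * B)). intros h.
  rewrite <- CZSeries_minus, <- CZSeries_scal, <- CZSeries_minus; auto using summable_scal.
  2:{ apply summable_le with (fun l => (psi (t + h)%R (k - l)%Z * (f l * g (k - l)%Z)
        + (- (1)) * (psi t (k - l)%Z * (f l * g (k - l)%Z)))%C).
      - intros l. right. f_equal. ring.
      - apply summable_plus; auto using summable_scal. }
  apply Cmod_CZSeries_le. intros N.
  pose proof (Rabs_pos m).
  apply Rle_trans with (zsum N (fun l => (4 * (1 + Rabs m) * wt k * h ^ 2) *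
     ((wX l * Cmod (f l)) * (wX (k - l)%Z * Cmod (g (k - l)%Z))))).
  - apply zsum_le; intros l _.
    replace (psi (t + h)%R (k - l)%Z * (f l * g (k - l)%Z)
             - psi t (k - l)%Z * (f l * g (k - l)%Z)
             - h * (phase m (-2 * t) (k - l) * (f l * g (k - l)%Z)))%C
      with ((psi (t + h)%R (k - l)%Z - psi t (k - l)%Z - h * phase m (-2 * t) (k - l))
            * (f l * g (k - l)%Z))%C by ring.
    rewrite !Cmod_mult.
    pose proof (scaled_phi1_taylor m t h (k - l)%Z hm) as T.
    fold (psi (t + h) (k - l)%Z) (psi t (k - l)%Z) in T.
    set (j := (k - l)%Z) in *.
    assert (hb : bracket m j <= (1 + Rabs m) * wt j ^ 4).
    { pose proof (bracket_le m j). pose proof (wt_pow4_ge_abs j).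
      pose proof (pow_R1_Rle _ 4 (wt_ge1 j)). nra. }
    assert (hw : wt j <= 2 * (wt k * wt l)).
    { pose proof (wt_add_le k (- l)) as w. rewrite wt_opp in w.
      replace (k + - l)%Z with j in w by (unfold j; lia).
      pose proof (wt_ge1 k). pose proof (wt_ge1 l).
      unfold Rmax in w; destruct Rle_dec; nra. }
    assert (h4 : wt j ^ 4 <= 2 * wt k * (wX l * wX j)).
    { replace (wt j ^ 4) with (wt j * wX j) by (unfold wX; ring).
      replace (2 * wt k * (wX l * wX j)) with (2 * (wt k * wX l) * wX j) by ring.
      apply Rmult_le_compat_r; auto. eapply Rle_trans; [exact hw|].
      apply Rmult_le_compat_l; [lra|].
      apply Rmult_le_compat_l; [apply Rlt_le, wt_pos|].
      unfold wX. pose proof (wt_ge1 l). rewrite <- (pow_1 (wt l)) at 1.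
      apply Rle_pow; [easy|lia]. }
    pose proof (pow2_ge_0 h).
    replace (4 * (1 + Rabs m) * wt k * h ^ 2 * (wX l * Cmod (f l) * (wX j * Cmod (g j))))
      with ((2 * ((1 + Rabs m) * (2 * wt k * (wX l * wX j))) * h ^ 2) * (Cmod (f l) * Cmod (g j)))
      by ring.
    apply Rmult_le_compat_r; [apply Rmult_le_pos; apply Cmod_ge_0|].
    eapply Rle_trans; [exact T|]. apply Rmult_le_compat_r; [easy|].
    apply Rmult_le_compat_l; [lra|]. eapply Rle_trans; [exact hb|].
    apply Rmult_le_compat_l; lra.
  - rewrite zsum_scal. pose proof (zsum_dual_le N k f g A B hf hg).
    replace (4 * (1 + Rabs m) * wt k * (A * B) * h ^ 2)
      with (4 * (1 + Rabs m) * wt k * h ^ 2 * (A * B)) by ring.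
    apply Rmult_le_compat_l; [|easy]. pose proof (wt_pos k). pose proof (pow2_ge_0 h).
    apply Rmult_le_pos; [apply Rmult_le_pos|]; lra.
Qed.

(** * The operators of the scheme *)

(** The three operators of the error analysis, without the smoothing factor
    [symbB]: the nonlinearity [N], its filtered version [Qt tau] in the scheme,
    and the integrand [q s], whose integral over [0, tau] is [tau * Qt tau].
    All bounds are uniform on H^{3/4} balls. *)
Definition admissible (m : R) (N : distr -> distr) (Qt q : R -> distr -> distr) : Prop :=
  forall R, 0 <= R -> exists C, 0 <= C /\ forall a, wball wX a R ->
    (wball wX (N a) C) /\
    (forall tau, 0 < tau -> wball wX (Qt tau a) C) /\
    (forall b d, wball wX b R -> wball wX (fun k => (a k - b k)%C) d ->
       wball wX (fun k => (N a k - N b k)%C) (C * d)) /\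
    (forall tau b d, 0 < tau -> wball wX b R -> wball wX (fun k => (a k - b k)%C) d ->
       wball wX (fun k => (Qt tau a k - Qt tau b k)%C) (C * d)) /\
    (forall s, wball wL (fun k => (flow m (- s) (N (flow m s a)) k - q s a k)%C)
                 (C * Rabs s)) /\
    (forall k t, cder (fun t => (RtoC t * Qt t a k)%C) t (q t a k)).

Lemma wball_conj_diff a b d : wball wX (fun k => (a k - b k)%C) d ->
  wball wX (fun k => (conj_distr a k - conj_distr b k)%C) d.
Proof.
  intros h. eapply wball_ext; [|apply (wball_conj wX _ _ wX_opp h)].
  intros k. unfold conj_distr. now rewrite Cminus_conj.
Qed.

Lemma admissible_pair m p P r Q : m <> 0 -> tame m p P -> tame m r Q ->
  admissible m (fun a => conv (P a) (Q (conj_distr a)))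
    (fun tau a => conv (P a) (phi1_mult m tau (Q (conj_distr a))))
    (fun s a => conv (P a) (flow m (-2 * s) (Q (conj_distr a)))).
Proof.
  intros hm hp hq R hR. destruct (hp R hR) as (A & hA & ha).
  destruct (hq R hR) as (B & hB & hb).
  pose proof (defect_const_ge0 m) as D0. set (D := defect_const m) in *.
  exists (96 * A * B + D * A * B).
  assert (AB : 0 <= A * B) by now apply Rmult_le_pos.
  assert (DAB : 0 <= D * A * B) by (rewrite Rmult_assoc; now apply Rmult_le_pos).
  split; [lra|]. intros a hX.
  assert (hXc : wball wX (conj_distr a) R) by (apply wball_conj; auto using wX_opp).
  destruct (ha a hX) as (a1 & _ & a3 & a4).
  destruct (hb _ hXc) as (b1 & _ & b3 & b4).
  split; [|split; [|split; [|split; [|split]]]].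
  - apply wball_le with (48 * A * B); [now apply wball_conv_XX|lra].
  - intros tau ht. apply wball_le with (48 * A * B); [|lra].
    apply wball_conv_XX; auto. apply wball_phi1_mult; auto; lra.
  - intros b d hXb hd. pose proof (wball_ge0 _ _ _ hd) as d0.
    assert (hXbc : wball wX (conj_distr b) R) by (apply wball_conj; auto using wX_opp).
    apply wball_le with (48 * (A * d) * B + 48 * A * (B * d)).
    + apply wball_conv_diff_X; auto.
      * apply (ha b hXb).
      * apply (hb _ hXbc).
      * apply b3; auto using wball_conj_diff.
    + assert (0 <= D * A * B * d) by now apply Rmult_le_pos. lra.
  - intros tau b d ht hXb hd. pose proof (wball_ge0 _ _ _ hd) as d0.
    assert (hXbc : wball wX (conj_distr b) R) by (apply wball_conj; auto using wX_opp).
    apply wball_le with (48 * (A * d) * B + 48 * A * (B * d)).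
    + apply wball_conv_diff_X; auto.
      * apply (ha b hXb).
      * apply wball_phi1_mult; auto; lra.
      * apply wball_phi1_mult; auto; [lra|apply (hb _ hXbc)].
      * eapply wball_ext; [|apply (wball_phi1_mult wX m tau _ _ wX_ge0 hm (Rgt_not_eq _ _ ht)
                                 (b3 _ d hXbc (wball_conj_diff _ _ _ hd)))].
        intros k. unfold phi1_mult, multiplier. ring.
    + assert (0 <= D * A * B * d) by now apply Rmult_le_pos. lra.
  - intros s. pose proof (Rabs_pos s) as s0.
    rewrite flow_conj.
    (* Pull both factors back along the flow, so that they stay close to
       their values at time zero. *)
    set (f := flow m (- s) (P (flow m s a))) in *.
    set (g := flow m (- - s) (Q (flow m (- s) (conj_distr a)))).
    assert (ef : P (flow m s a) = flow m s f)
      by (unfold f; now rewrite flow_flow, Rplus_opp_r, flow_0).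
    assert (eg : Q (flow m (- s) (conj_distr a)) = flow m (- s) g)
      by (unfold g; now rewrite flow_flow, Rplus_opp_r, flow_0).
    assert (hf : wball wX f A).
    { apply wball_flow; auto. apply ha, wball_flow; auto. }
    assert (hg : wball wX g B).
    { apply wball_flow; auto. apply hb, wball_flow; auto. }
    specialize (a4 s). fold f in a4. specialize (b4 (- s)). fold g in b4.
    rewrite Rabs_Ropp in b4. rewrite ef, eg.
    apply wball_le with (D * Rabs s * A * B
      + (6 * (A * Rabs s) * B + 6 * A * (B * Rabs s))).
    2:{ assert (0 <= A * B * Rabs s) by now apply Rmult_le_pos. lra. }
    eapply wball_ext; [|apply (wball_plus wL _ _ _ _ wL_ge0
      (wball_flow_conv_defect m s (- s) f g A B hf hg)
      (wball_conv_diff_L f (P a) (flow m (- s - s) g) (flow m (- s - s) (Q (conj_distr a)))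
         A B (A * Rabs s) (B * Rabs s) hf a1 (wball_flow _ _ _ _ _ wX_ge0 hg)
         (wball_flow _ _ _ _ _ wX_ge0 b1) a4
         (wball_ext _ _ _ _ (flow_minus m (- s - s) _ _)
            (wball_flow _ _ _ _ _ wL_ge0 b4))))].
    intros k; cbv beta. replace (-2 * s) with (- s - s) by ring. ring.
  - intros k t. now apply cder_conv_phi1 with A B.
Qed.

Lemma admissible_zero m :
  admissible m (fun _ _ => 0%C) (fun _ _ _ => 0%C) (fun _ _ _ => 0%C).
Proof.
  intros R hR. exists 0. split; [lra|]. intros a _.
  assert (z : forall w x, wball w (fun _ => (0 - 0)%C) (0 * x)).
  { intros w x. rewrite Rmult_0_l. apply wball_ext with (2 := wball_zero w). intros; ring. }
  split; [apply wball_zero|]. split; [intros; apply wball_zero|].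
  split; [intros; apply z|]. split; [intros; apply z|]. split.
  - intros s. rewrite Rmult_0_l. apply wball_ext with (2 := wball_zero wL).
    intros; unfold flow, multiplier; ring.
  - intros k t. apply cder_ext with (fun _ => RtoC 0); [intros; ring|apply cder_const].
Qed.

Lemma admissible_plus m N Qt q N' Qt' q' :
  admissible m N Qt q -> admissible m N' Qt' q' ->
  admissible m (fun a k => (N a k + N' a k)%C) (fun t a k => (Qt t a k + Qt' t a k)%C)
    (fun t a k => (q t a k + q' t a k)%C).
Proof.
  intros h h' R hR. destruct (h R hR) as (A & hA & ha).
  destruct (h' R hR) as (B & hB & hb). exists (A + B). split; [lra|]. intros a hX.
  destruct (ha a hX) as (a1 & a2 & a3 & a4 & a5 & a6).
  destruct (hb a hX) as (b1 & b2 & b3 & b4 & b5 & b6).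
  split; [now apply wball_plus|]. split; [intros; apply wball_plus; auto|].
  split; [|split; [|split]].
  - intros b d hXb hd. rewrite Rmult_plus_distr_r.
    eapply wball_ext; [|apply (wball_plus wX _ _ _ _ wX_ge0 (a3 b d hXb hd) (b3 b d hXb hd))].
    intros k; cbv beta; ring.
  - intros tau b d ht hXb hd. rewrite Rmult_plus_distr_r.
    eapply wball_ext; [|apply (wball_plus wX _ _ _ _ wX_ge0 (a4 tau b d ht hXb hd) (b4 tau b d ht hXb hd))].
    intros k; cbv beta; ring.
  - intros s. rewrite Rmult_plus_distr_r.
    eapply wball_ext; [|apply (wball_plus wL _ _ _ _ wL_ge0 (a5 s) (b5 s))].
    intros k; cbv beta; unfold flow, multiplier; ring.
  - intros k t. eapply cder_ext; [|apply (cder_plus _ _ t _ _ (a6 k t) (b6 k t))].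
    intros s; cbv beta; ring.
Qed.

Lemma to_fun_zero x : to_fun (fun _ => RtoC 0) x = RtoC 0.
Proof.
  transitivity (0 * to_fun unit0 x)%C; [|ring].
  rewrite <- to_fun_scal by (eapply wball_X_summable, wball_X_unit0).
  apply to_fun_ext; intros; ring.
Qed.

(** Induction on the lists, one product [F_j . G_j] at a time. *)
Lemma dot_operators m fs gs Ps Qs : m <> 0 ->
  Forall2 (tame m) fs Ps -> Forall2 (tame m) gs Qs ->
  exists N Qt q, admissible m N Qt q /\
    forall a R, 0 <= R -> wball wX a R ->
    (forall x, to_fun (N a) x
       = dot (map (fun f => f (to_fun a x)) fs)
             (map (fun g => g (to_fun (conj_distr a) x)) gs)) /\
    (forall tau x, 0 < tau -> to_fun (Qt tau a) x
       = dot (map (fun f => f (to_fun a x)) fs)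
             (map (fun g => to_fun (phi1_mult m tau
                     (fourier (fun y => g (to_fun (conj_distr a) y)))) x) gs)).
Proof.
  intros hm hP. revert gs Qs.
  induction hP as [|p P fs Ps hp hP IH]; intros gs Qs hQ;
    [|destruct hQ as [|r Q gs Qs hr hQ]].
  1,2: exists (fun _ _ => 0%C), (fun _ _ _ => 0%C), (fun _ _ _ => 0%C);
    split; [apply admissible_zero|];
    assert (z : forall x, to_fun (fun _ => 0%C) x = 0%C)
      by (intros x; apply to_fun_zero);
    intros a R hR ha; split; intros; apply z.
  destruct (IH gs Qs hQ) as (N & Qt & q & hadm & hdot).
  pose proof (admissible_pair m p P r Q hm hp hr) as hpair.
  exists (fun a k => (conv (P a) (Q (conj_distr a)) k + N a k)%C),
    (fun tau a k => (conv (P a) (phi1_mult m tau (Q (conj_distr a))) k + Qt tau a k)%C),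
    (fun s a k => (conv (P a) (flow m (-2 * s) (Q (conj_distr a))) k + q s a k)%C).
  split; [exact (admissible_plus _ _ _ _ _ _ _ hpair hadm)|].
  intros a R hR ha. destruct (hdot a R hR ha) as [d1 d2].
  assert (hac : wball wX (conj_distr a) R) by (apply wball_conj; auto using wX_opp).
  destruct (hp R hR) as (A & hA & p1). destruct (p1 a ha) as (p2 & p3 & _).
  destruct (hr R hR) as (B & hB & r1). destruct (r1 _ hac) as (r2 & r3 & _).
  destruct (hpair R hR) as (D & _ & hpa). destruct (hpa a ha) as (q1 & q2 & _).
  destruct (hadm R hR) as (E & _ & hEa). destruct (hEa a ha) as (e1 & e2 & _).
  assert (eQ : fourier (fun y => r (to_fun (conj_distr a) y)) = Q (conj_distr a)).
  { apply functional_extensionality; intros k.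
    rewrite <- (fourier_to_fun (Q (conj_distr a)) k) by (eapply wball_X_summable; eauto).
    apply fourier_ext. intros x; now rewrite r3. }
  split.
  - intros x. rewrite to_fun_plus by (eapply wball_X_summable; eauto).
    rewrite d1, (to_fun_conv _ _ A B), p3, r3 by assumption. reflexivity.
  - intros tau x ht. rewrite to_fun_plus by (eapply wball_X_summable; eauto).
    rewrite d2, (to_fun_conv _ _ A B), p3 by (auto; apply wball_phi1_mult; auto; lra).
    cbn [map]. rewrite eQ. reflexivity.
Qed.

Lemma Csin_R (x : R) : Csin x = RtoC (sin x).
Proof.
  unfold Csin. replace (- (Ci * x))%C with (Ci * RtoC (- x))%C by (rewrite RtoC_opp; ring).
  rewrite !Cexp_i, cos_neg, sin_neg.
  replace ((cos x, sin x) - (cos x, (- sin x)%R))%C with (2 * Ci * RtoC (sin x))%C.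
  - field. intros e. apply (f_equal Im) in e. cbn in e. lra.
  - apply injective_projections; cbn; ring.
Qed.

Lemma Csin_add (z w : C) : (Csin z * Ccos w + Ccos z * Csin w = Csin (z + w))%C.
Proof.
  unfold Csin, Ccos.
  replace (Ci * (z + w))%C with (Ci * z + Ci * w)%C by ring.
  replace (- (Ci * z + Ci * w))%C with (- (Ci * z) + - (Ci * w))%C by ring.
  rewrite !Cexp_add. field.
  intros e. apply (f_equal Im) in e. cbn in e. lra.
Qed.

Lemma half_plus_conj (v : C) : (v / 2 + Cconj v / 2)%C = RtoC (Re v).
Proof.
  replace (v / 2 + Cconj v / 2)%C with ((v + Cconj v) * / 2)%C by (unfold Cdiv; ring).
  replace (v + Cconj v)%C with (2 * RtoC (Re v))%C.
  - field.
  - apply injective_projections; cbn; unfold Re; ring.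
Qed.

(** On a pair [v], [conj v] the product [F . G] is a multiple of [g (Re v)]: it
    expands the square, respectively the sine, of [(v + conj v) / 2]. *)
Lemma symbB_dot nl m k (v : C) : m <> 0 ->
  (symbB nl m k * dot (map (fun f => f v) (F nl)) (map (fun g => g (Cconj v)) (G nl))
   = - (Ci * / bracket m k) * RtoC (g nl (Re v)))%C.
Proof.
  intros hm.
  destruct nl; cbn [F G map symbB g]; unfold dot; cbn [combine map fold_right fst snd].
  - assert (e : RtoC (Re v ^ 2) = ((v / 2 + Cconj v / 2) ^ 2)%C).
    { rewrite half_plus_conj. cbn. now rewrite RtoC_mult, RtoC_mult. }
    rewrite e. cbn [Cpow]. field.
    intros E. apply (f_equal Re) in E. cbn in E. pose proof (bracket_pos m k hm). lra.
  - rewrite Cplus_0_r, Csin_add, half_plus_conj, Csin_R, RtoC_opp. ring.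
Qed.

(** * Local error and stability *)

(** Compares [sqrt (1 + k^2)] with [sqrt (k^2 + m^2)], uniformly in [k]. *)
Definition smoothing_const (m : R) : R := 1 + / Rabs m.

Lemma smoothing_const_ge1 m : m <> 0 -> 1 <= smoothing_const m.
Proof.
  intros hm. unfold smoothing_const.
  pose proof (Rinv_0_lt_compat _ (Rabs_pos_lt m hm)). lra.
Qed.

Lemma wt_pow4_le_bracket m k : m <> 0 -> wt k ^ 4 <= smoothing_const m * bracket m k.
Proof.
  intros hm. pose proof (bracket_pos m k hm). pose proof (smoothing_const_ge1 m hm) as c1.
  apply Rsqr_incr_0_var; [|nra]. rewrite !Rsqr_pow2, Rpow_mult_distr, bracket_sqr.
  rewrite <- pow_mult. change (4 * 2)%nat with 8%nat. rewrite wt_pow8.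
  set (c := smoothing_const m) in *.
  assert (cm : 1 <= c * Rabs m).
  { unfold c, smoothing_const. pose proof (Rabs_pos_lt m hm).
    rewrite Rmult_plus_distr_r, Rinv_l; lra. }
  rewrite <- (pow2_abs m). pose proof (pow2_ge_0 (IZR k)).
  assert (1 <= (c * Rabs m) ^ 2) by nra. rewrite Rpow_mult_distr in *.
  assert (1 * IZR k ^ 2 <= c ^ 2 * IZR k ^ 2) by (apply Rmult_le_compat_r; nra).
  lra.
Qed.

Lemma Cmod_symbB_le nl m k : m <> 0 -> Cmod (symbB nl m k) <= / bracket m k.
Proof.
  intros hm. pose proof (bracket_pos m k hm) as hb.
  pose proof (Rinv_0_lt_compat _ hb).
  assert (e : Cmod (/ bracket m k)%C = / bracket m k).
  { rewrite <- RtoC_inv by lra. rewrite Cmod_R. now apply Rabs_pos_eq, Rlt_le. }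
  destruct nl; unfold symbB; rewrite Cmod_mult, e.
  - replace (Cmod (- (Ci / 4))) with (/ 4); [lra|].
    unfold Cdiv. rewrite Cmod_opp, Cmod_mult, Cmod_Ci, <- RtoC_inv, Cmod_R, Rabs_pos_eq; lra.
  - rewrite Cmod_Ci. lra.
Qed.

(** [B] contains one inverse of the bracket, so it gains one derivative. *)
Lemma wball_symbB nl m a A : m <> 0 -> wball wL a A ->
  wball w1 (multiplier (symbB nl m) a) (smoothing_const m * A).
Proof.
  intros hm. pose proof (smoothing_const_ge1 m hm).
  apply wball_dom; [lra|]. intros k. unfold multiplier, wL. rewrite Cmod_mult, Rmult_1_l.
  pose proof (w1_pos k). pose proof (Cmod_ge_0 (a k)). pose proof (Cmod_ge_0 (symbB nl m k)).
  split; [apply Rmult_le_pos; [lra|now apply Rmult_le_pos]|].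
  rewrite <- Rmult_assoc. apply Rmult_le_compat_r; [easy|].
  apply Rle_trans with (smoothing_const m * bracket m k * / bracket m k).
  - apply Rmult_le_compat; try lra; [now apply wt_pow4_le_bracket|now apply Cmod_symbB_le].
  - pose proof (bracket_pos m k hm). rewrite Rmult_assoc, Rinv_r; lra.
Qed.

Lemma contw_shift T t0 tau f : 0 <= t0 -> 0 <= tau -> t0 + tau <= T ->
  contw 0 T f -> contw 0 tau (fun s => f (t0 + s)).
Proof.
  intros h0 ht hT h t.
  apply continuity_pt_ext with (fun s => f (clamp 0 T (t0 + clamp 0 tau s))).
  { intros s. rewrite (clamp_id 0 T); [easy|].
    pose proof (clamp_in 0 tau s ht). lra. }
  apply (continuity_pt_comp (fun s => t0 + clamp 0 tau s) (fun y => f (clamp 0 T y))); [|apply h].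
  apply (continuity_pt_plus (fun _ => t0) (clamp 0 tau)).
  - apply continuity_pt_const. intros x y; reflexivity.
  - apply (contw_of_continuity 0 tau (fun x => x)).
    intros; apply derivable_continuous_pt, derivable_pt_id.
Qed.

Lemma ccont_shift T t0 tau f : 0 <= t0 -> 0 <= tau -> t0 + tau <= T ->
  ccont 0 T f -> ccont 0 tau (fun s => f (t0 + s)).
Proof.
  intros h0 ht hT [h1 h2].
  split; [apply (contw_shift T t0 tau (fun s => Re (f s)))
         |apply (contw_shift T t0 tau (fun s => Im (f s)))]; assumption.
Qed.

Lemma cder_shift t0 f s l : cder f (t0 + s) l -> cder (fun s => f (t0 + s)) s l.
Proof.
  assert (shift : forall (g : R -> R) d, is_derive g (t0 + s) d ->
            is_derive (fun s => g (t0 + s)) s d).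
  { intros g d hg.
    pose proof (is_derive_plus (V := R_NormedModule) (fun _ => t0) (fun s => s) s _ _
      (is_derive_const (V := R_NormedModule) t0 s) (is_derive_id (K := R_AbsRing) s)) as h.
    evar_last; [exact (is_derive_comp g _ s _ _ hg h)|].
    unfold scal, plus, zero, one; cbn. unfold mult; cbn. ring. }
  intros [h1 h2]. split; [exact (shift _ _ h1)|exact (shift _ _ h2)].
Qed.

Lemma cder_phase m k s :
  cder (fun s => phase m (- s) k) s (- (Ci * bracket m k) * phase m (- s) k)%C.
Proof.
  assert (e : forall s, phase m (- s) k = Cexp (RtoC s * (- (Ci * bracket m k)))).
  { intros t. unfold phase. f_equal. rewrite RtoC_mult, RtoC_opp; ring. }
  rewrite e. eapply cder_ext; [intros; symmetry; apply e|]. apply cder_Cexp.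
Qed.

(** [U] solves [u_t = L u + B N(u)] on [0, T], coefficient by coefficient. *)
Definition evolves (nl : nonlinearity) (m : R) (N : distr -> distr) (T : R)
    (U : R -> distr) : Prop :=
  (forall k, ccont 0 T (fun t => U t k)) /\
  (forall t k, 0 < t < T -> cder (fun s => U s k) t
     (Ci * bracket m k * U t k + symbB nl m k * N (U t) k)%C).

(** The derivative of the phase cancels the linear part of the equation. *)
Lemma cder_filtered nl m N T U t0 s k : evolves nl m N T U ->
  0 < t0 + s < T ->
  cder (fun s => (phase m (- s) k * U (t0 + s)%R k)%C) s
    (phase m (- s) k * (symbB nl m k * N (U (t0 + s)%R) k))%C.
Proof.
  intros [_ h] ht.
  eapply cder_eq; [|apply cder_mult; [apply cder_phase|apply (cder_shift t0 (fun s => U s k)), h, ht]].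
  cbv beta. ring.
Qed.

Lemma ccont_filtered nl m N T U t0 tau k : evolves nl m N T U ->
  0 <= t0 -> 0 <= tau -> t0 + tau <= T ->
  ccont 0 tau (fun s => (phase m (- s) k * U (t0 + s)%R k)%C).
Proof.
  intros [h _] h0 ht hT. apply ccont_mult.
  - eapply ccont_of_cder. intros; apply cder_phase.
  - apply (ccont_shift T t0 tau (fun t => U t k)); auto.
Qed.

(** In filtered variables the derivative of the solution is [B] applied to a
    bounded function, hence bounded in H^1 although the solution itself is only
    in H^{3/4}. *)
Lemma free_flow_error nl m N Qt q T U R : m <> 0 -> 0 <= R ->
  admissible m N Qt q -> evolves nl m N T U ->
  (forall t, 0 <= t <= T -> wball wX (U t) R) ->
  exists c, 0 <= c /\ forall t0 s, 0 <= t0 -> 0 < s -> t0 + s <= T ->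
    wball w1 (fun k => (flow m (- s) (U (t0 + s)%R) k - U t0 k)%C) (c * s).
Proof.
  intros hm hR hadm hU hb. destruct (hadm R hR) as (C & hC & H).
  pose proof (smoothing_const_ge1 m hm).
  exists (smoothing_const m * C). split; [apply Rmult_le_pos; lra|].
  intros t0 s h0 hs hT.
  replace (smoothing_const m * C * s) with (smoothing_const m * C * (s - 0)) by ring.
  eapply wball_ext; [|apply (wball_mvt w1 (fun s k => (phase m (- s) k * U (t0 + s)%R k)%C)
    (fun s k => (phase m (- s) k * (symbB nl m k * N (U (t0 + s)%R) k))%C) 0 s)].
  - intros k; cbv beta. rewrite Ropp_0, phase_0, Rplus_0_r. unfold flow, multiplier. ring.
  - exact hs.
  - apply Rmult_le_pos; lra.
  - intros k. eapply ccont_filtered; eauto; lra.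
  - intros t k ht. eapply cder_filtered; eauto; lra.
  - intros t ht. apply (wball_flow w1 m (- t)); auto. apply wball_symbB; auto.
    apply wball_X_L, H, hb. lra.
Qed.

(** One step of the scheme, with the filtered product on the coefficient
    side. *)
Definition filtered_step (nl : nonlinearity) (m tau : R) (Qt : R -> distr -> distr)
    (u : distr) : distr :=
  flow m tau (fun k => (u k + symbB nl m k * (RtoC tau * Qt tau u k))%C).

(** The increments of the filtered solution and of the scheme are integrals over
    one step of [B] applied to two functions that differ by [O(s)] in L^2:
    first [U (t0 + s)] is replaced by [e^{s L} v], at the cost of
    [free_flow_error], then the flow is frozen on the products. *)
Lemma local_error nl m N Qt q T U R : m <> 0 -> 0 <= R ->
  admissible m N Qt q -> evolves nl m N T U ->
  (forall t, 0 <= t <= T -> wball wX (U t) R) ->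
  exists c, 0 <= c /\ forall t0 tau, 0 <= t0 -> 0 < tau -> t0 + tau <= T ->
    wball w1 (fun k => (U (t0 + tau)%R k - filtered_step nl m tau Qt (U t0) k)%C) (c * tau ^ 2).
Proof.
  intros hm hR hadm hU hb.
  destruct (free_flow_error nl m N Qt q T U R hm hR hadm hU hb) as (c1 & hc1 & Hfree).
  destruct (hadm R hR) as (C & hC & H).
  pose proof (smoothing_const_ge1 m hm) as hS. set (S := smoothing_const m) in *.
  assert (hc1C : 0 <= C * c1) by now apply Rmult_le_pos.
  exists (S * (C * c1 + C)). split; [apply Rmult_le_pos; lra|].
  intros t0 tau h0 ht hT. set (v := U t0).
  assert (hv : wball wX v R) by (apply hb; lra).
  destruct (H v hv) as (_ & _ & _ & _ & hq & hder).
  (* Difference of the filtered solution and the scheme after time [s], with its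
     derivative [dW]. *)
  set (W := fun s k => (phase m (- s) k * U (t0 + s)%R k
                        - (v k + symbB nl m k * (RtoC s * Qt s v k)))%C).
  set (dW := fun s k => (phase m (- s) k * (symbB nl m k * N (U (t0 + s)%R) k)
                         - symbB nl m k * q s v k)%C).
  assert (main : wball w1 (fun k => (W tau k - W 0 k)%C) (S * (C * c1 + C) * tau * (tau - 0))).
  { assert (hsch : forall k s, cder (fun s => (v k + symbB nl m k * (RtoC s * Qt s v k))%C) s
                      (symbB nl m k * q s v k)%C).
    { intros k s. apply cder_eq with (0 + symbB nl m k * q s v k)%C; [ring|].
      apply cder_plus; [apply cder_const|]. apply cder_scal, hder. }
    apply (wball_mvt w1 W dW); auto.
    - apply Rmult_le_pos; [apply Rmult_le_pos|]; lra.
    - intros k. apply ccont_minus; [eapply ccont_filtered; eauto; lra|].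
      eapply ccont_of_cder. intros; apply hsch.
    - intros s k hs. apply cder_minus; [eapply cder_filtered; eauto; lra|apply hsch].
    - intros s hs.
      assert (hUs : wball wX (U (t0 + s)) R) by (apply hb; lra).
      assert (hfs : wball wX (flow m s v) R) by (apply wball_flow; auto).
      assert (hd : wball wX (fun k => (U (t0 + s)%R k - flow m s v k)%C) (c1 * s)).
      { apply wball_1_X. eapply wball_ext;
          [|apply (wball_flow w1 m s _ _ w1_ge0 (Hfree t0 s h0 (proj1 hs) ltac:(lra)))].
        intros k. unfold v. unfold flow, multiplier.
        replace (phase m s k * (phase m (- s) k * U (t0 + s)%R k - U t0 k))%C
          with ((phase m (- s) k * phase m s k) * U (t0 + s)%R k - phase m s k * U t0 k)%C by ring.
        rewrite phase_inv. ring. }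
      destruct (H _ hUs) as (_ & _ & hlip & _).
      specialize (hlip _ _ hfs hd). specialize (hq s). rewrite Rabs_pos_eq in hq by lra.
      apply wball_le with (S * (C * (c1 * s) + C * s)).
      2:{ replace (S * (C * (c1 * s) + C * s)) with (S * (C * c1 + C) * s) by ring.
          apply Rmult_le_compat_l; [apply Rmult_le_pos|]; lra. }
      eapply wball_ext; [|apply (wball_symbB nl m _ _ hm
        (wball_plus wL _ _ _ _ wL_ge0 (wball_flow wL m (- s) _ _ wL_ge0 (wball_X_L _ _ hlip)) hq))].
      intros k. unfold dW, flow, multiplier. ring. }
  replace (S * (C * c1 + C) * tau ^ 2) with (S * (C * c1 + C) * tau * (tau - 0)) by ring.
  eapply wball_ext; [|apply (wball_flow w1 m tau _ _ w1_ge0 main)].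
  intros k. unfold W, filtered_step. fold v. unfold flow, multiplier.
  rewrite Ropp_0, phase_0, Rplus_0_r. fold v.
  replace (phase m tau k * (phase m (- tau) k * U (t0 + tau)%R k
      - (v k + symbB nl m k * (RtoC tau * Qt tau v k))
      - (1 * v k - (v k + symbB nl m k * (0 * Qt 0 v k)))))%C
    with ((phase m (- tau) k * phase m tau k) * U (t0 + tau)%R k
          - phase m tau k * (v k + symbB nl m k * (RtoC tau * Qt tau v k)))%C by ring.
  rewrite phase_inv. ring.
Qed.

(** The flow is an isometry, and the nonlinear term maps H^{3/4} to H^1 with a
    Lipschitz constant that depends on the size of its arguments. *)
Lemma step_stability nl m N Qt q R : m <> 0 -> 0 <= R -> admissible m N Qt q ->
  exists K, 0 <= K /\ forall tau a b e, 0 < tau -> wball wX a R -> wball wX b R ->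
    wball w1 (fun k => (a k - b k)%C) e ->
    wball w1 (fun k => (filtered_step nl m tau Qt a k - filtered_step nl m tau Qt b k)%C)
      ((1 + tau * K) * e).
Proof.
  intros hm hR hadm. destruct (hadm R hR) as (C & hC & H).
  pose proof (smoothing_const_ge1 m hm) as hS. set (S := smoothing_const m) in *.
  exists (S * C). split; [apply Rmult_le_pos; lra|].
  intros tau a b e ht ha hb he.
  destruct (H a ha) as (_ & _ & _ & hlip & _).
  specialize (hlip tau b e ht hb (wball_1_X _ _ he)).
  replace ((1 + tau * (S * C)) * e) with (e + Cmod tau * (S * (C * e)))
    by (rewrite Cmod_R, Rabs_pos_eq by lra; ring).
  eapply wball_ext; [|apply (wball_flow w1 m tau _ _ w1_ge0
    (wball_plus w1 _ _ _ _ w1_ge0 he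
      (wball_scal w1 (RtoC tau) _ _ w1_ge0 (wball_symbB nl m _ _ hm (wball_X_L _ _ hlip)))))].
  intros k. unfold filtered_step, flow, multiplier. ring.
Qed.

(** * Reduction to a first order system *)

Lemma continuous_H_eps s w T z t0 eps : 
  (forall k, Rpower (1 + IZR k ^ 2) s = w k ^ 2) -> (forall k, 0 <= w k) ->
  continuous_H s T z -> 0 <= t0 <= T -> 0 < eps ->
  exists delta, 0 < delta /\ forall t, 0 <= t <= T -> Rabs (t - t0) < delta ->
    wball w (fun k => (z t k - z t0 k)%C) eps.
Proof.
  intros hw w0 hz ht0 heps. destruct (hz t0 ht0) as [in0 lim].
  destruct (proj1 (filterlim_locally _ _) lim (mkposreal eps heps)) as [d hd].
  exists d. split; [apply cond_pos|]. intros t ht htd.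
  specialize (hd t htd ht).
  change (Rabs (norm_H s (fun k => (z t k - z t0 k)%C) - 0) < eps) in hd.
  rewrite Rminus_0_r in hd. apply Rabs_lt_between in hd.
  assert (B : wball w (fun k => (z t k - z t0 k)%C) (norm_H s (z t) + norm_H s (z t0))).
  { apply wball_minus; [exact w0|apply wball_of_in_H; auto..]. apply (hz t ht). }
  destruct (in_H_of_wball s w _ _ hw B) as [inD _].
  apply wball_le with (norm_H s (fun k => (z t k - z t0 k)%C)); [|lra].
  now apply wball_of_in_H.
Qed.

(** The norm is a continuous function of time on a compact interval. *)
Lemma continuous_H_bounded s w T z : 0 <= T ->
  (forall k, Rpower (1 + IZR k ^ 2) s = w k ^ 2) -> (forall k, 0 <= w k) ->
  continuous_H s T z -> exists M, forall t, 0 <= t <= T -> wball w (z t) M.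
Proof.
  intros hT hw w0 hz.
  assert (hB : forall t, 0 <= t <= T -> wball w (z t) (norm_H s (z t))).
  { intros t ht. apply wball_of_in_H; auto. apply (hz t ht). }
  assert (cont : contw 0 T (fun t => norm_H s (z t))).
  { apply contw_eps; [exact hT|]. intros t eps ht heps.
    destruct (continuous_H_eps s w T z t (eps / 2) hw w0 hz ht ltac:(lra)) as (d & hd & H).
    exists d. split; [exact hd|]. intros t' ht' hd'. specialize (H t' ht' hd').
    assert (up : norm_H s (z t') <= norm_H s (z t) + eps / 2).
    { apply (in_H_of_wball s w); auto.
      eapply wball_ext; [|apply (wball_plus w _ _ _ _ w0 (hB t ht) H)]. intros k; cbv beta; ring. }
    assert (dn : norm_H s (z t) <= norm_H s (z t') + eps / 2).
    { apply (in_H_of_wball s w); auto.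
      eapply wball_ext; [|apply (wball_minus w _ _ _ _ w0 (hB t' ht') H)]. intros k; cbv beta; ring. }
    apply Rabs_def1; lra. }
  destruct (continuity_ab_maj (fun t => norm_H s (z (clamp 0 T t))) 0 T hT) as (tm & hm & _).
  { intros t _. apply cont. }
  exists (norm_H s (z (clamp 0 T tm))). intros t ht.
  apply wball_le with (norm_H s (z t)); auto.
  specialize (hm t ht). cbv beta in hm. now rewrite (clamp_id 0 T t ht) in hm.
Qed.

Lemma ccont_continuous_H s w T z k : 0 <= T ->
  (forall k, Rpower (1 + IZR k ^ 2) s = w k ^ 2) -> (forall k, 0 < w k) ->
  continuous_H s T z -> ccont 0 T (fun t => z t k).
Proof.
  intros hT hw w0 hz.
  assert (main : forall t eps, 0 <= t <= T -> 0 < eps -> exists d, 0 < d /\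
            forall t', 0 <= t' <= T -> Rabs (t' - t) < d -> Cmod (z t' k - z t k) < eps).
  { intros t eps ht heps.
    assert (he : 0 < w k * (eps / 2)) by (apply Rmult_lt_0_compat; [apply w0|lra]).
    destruct (continuous_H_eps s w T z t _ hw (fun k => Rlt_le _ _ (w0 k)) hz ht he)
      as (d & hd & H).
    exists d. split; [exact hd|]. intros t' ht' hd'.
    pose proof (wball_term w _ _ k (fun k => Rlt_le _ _ (w0 k)) (H t' ht' hd')) as B.
    cbv beta in B. apply Rmult_le_reg_l in B; [lra|apply w0]. }
  split; apply contw_eps; auto; intros t eps ht heps;
    destruct (main t eps ht heps) as (d & hd & H); exists d; (split; [exact hd|]);
    intros t' ht' hd'; (eapply Rle_lt_trans; [|apply (H t' ht' hd')]).
  - rewrite <- Re_minus. apply Re_le_Cmod.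
  - rewrite <- Im_minus. apply Im_le_Cmod.
Qed.

Lemma derivative_H_eps T z dz t0 k eps : derivative_H (- 1 / 4) T z dz ->
  0 <= t0 <= T -> 0 < eps ->
  exists delta, 0 < delta /\ forall t, 0 <= t <= T -> t <> t0 -> Rabs (t - t0) < delta ->
    Cmod ((z t k - z t0 k) / (t - t0)%R - dz t0 k) < eps.
Proof.
  intros hz ht0 heps. destruct (hz t0 ht0) as [inR lim].
  assert (winv : forall j, 0 < / wt j) by (intros; apply Rinv_0_lt_compat, wt_pos).
  assert (he : 0 < / wt k * eps) by now apply Rmult_lt_0_compat.
  destruct (proj1 (filterlim_locally _ _) lim (mkposreal _ he)) as [d hd].
  exists d. split; [apply cond_pos|]. intros t ht hne htd.
  specialize (hd t htd hne ht).
  set (rem := fun k => ((z t k - z t0 k) / (t - t0)%R - dz t0 k)%C) in *.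
  change (Rabs (norm_H (- 1 / 4) rem - 0) < / wt k * eps) in hd.
  rewrite Rminus_0_r in hd. apply Rabs_lt_between in hd.
  pose proof (wball_of_in_H (- 1 / 4) (fun k => / wt k) rem sobolev_weight_neg (inR t ht hne)) as B.
  apply (wball_term _ _ _ k (fun k => Rlt_le _ _ (winv k))) in B. cbv beta in B.
  apply Rmult_lt_reg_l with (/ wt k); [apply winv|].
  change (/ wt k * Cmod (rem k) < / wt k * eps). lra.
Qed.

Lemma cder_derivative_H T z dz t k : derivative_H (- 1 / 4) T z dz -> 0 < t < T ->
  cder (fun s => z s k) t (dz t k).
Proof.
  intros hz ht.
  assert (main : forall eps, 0 < eps -> exists d, 0 < d /\ forall h, h <> 0 -> Rabs h < d ->
            Cmod ((z (t + h)%R k - z t k) * RtoC (/ h) - dz t k) < eps).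
  { intros eps heps.
    destruct (derivative_H_eps T z dz t k eps hz ltac:(lra) heps) as (d & hd & H).
    exists (Rmin d (Rmin t (T - t))). split.
    - repeat apply Rmin_glb_lt; lra.
    - intros h hn hh. pose proof (Rmin_l d (Rmin t (T - t))).
      pose proof (Rmin_r d (Rmin t (T - t))). pose proof (Rmin_l t (T - t)).
      pose proof (Rmin_r t (T - t)). pose proof (Rle_abs h). pose proof (Rle_abs (- h)) as n.
      rewrite Rabs_Ropp in n.
      specialize (H (t + h)). replace (t + h - t) with h in H by ring.
      unfold Cdiv in H. rewrite <- RtoC_inv in H by easy. apply H; lra. }
  split; apply is_derive_Reals; intros eps heps; destruct (main eps heps) as (d & hd & H);
    exists (mkposreal d hd); intros h hn hh; specialize (H h hn hh);
    (eapply Rle_lt_trans; [|exact H]).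
  - eapply Rle_trans; [|apply Re_le_Cmod]. right; f_equal. cbn; unfold Re; field; easy.
  - eapply Rle_trans; [|apply Im_le_Cmod]. right; f_equal. cbn; unfold Im; field; easy.
Qed.

(** Needed up to the end points, where only one-sided difference quotients
    exist. *)
Lemma real_derivative_H T z dz t : 0 < T -> derivative_H (- 1 / 4) T z dz ->
  (forall t, 0 <= t <= T -> real_valued (z t)) -> 0 <= t <= T -> real_valued (dz t).
Proof.
  intros hT hz hr ht k.
  (* Both sides are limits of the same difference quotients. *)
  assert (le : Cmod (conj_distr (dz t) k - dz t k) <= 0).
  { apply le_epsilon. intros eps heps.
    destruct (derivative_H_eps T z dz t k (eps / 2) hz ht ltac:(lra)) as (d1 & hd1 & H1).
    destruct (derivative_H_eps T z dz t (- k) (eps / 2) hz ht ltac:(lra)) as (d2 & hd2 & H2).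
    assert (ex : exists t', 0 <= t' <= T /\ t' <> t /\ Rabs (t' - t) < d1 /\ Rabs (t' - t) < d2).
    { set (d := Rmin d1 (Rmin d2 T) / 2).
      pose proof (Rmin_l d1 (Rmin d2 T)). pose proof (Rmin_r d1 (Rmin d2 T)).
      pose proof (Rmin_l d2 T). pose proof (Rmin_r d2 T).
      assert (0 < Rmin d1 (Rmin d2 T)) by (repeat apply Rmin_glb_lt; lra).
      destruct (Rle_dec t (T / 2)).
      - exists (t + d). unfold d in *. replace (t + _ - t) with (Rmin d1 (Rmin d2 T) / 2) by ring.
        rewrite Rabs_pos_eq by lra. repeat split; lra.
      - exists (t - d). unfold d in *. replace (t - _ - t) with (- (Rmin d1 (Rmin d2 T) / 2)) by ring.
        rewrite Rabs_Ropp, Rabs_pos_eq by lra. repeat split; lra. }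
    destruct ex as (t' & ht' & hne & hh1 & hh2).
    specialize (H1 t' ht' hne hh1). specialize (H2 t' ht' hne hh2).
    rewrite <- Cmod_conj in H2.
    assert (e : Cconj ((z t' (- k)%Z - z t (- k)%Z) / (t' - t)%R - dz t (- k)%Z)
                = ((z t' k - z t k) / (t' - t)%R - conj_distr (dz t) k)%C).
    { rewrite <- (hr t' ht' k), <- (hr t ht k). unfold conj_distr, Cdiv.
      rewrite <- RtoC_inv by lra.
      rewrite Cminus_conj, Cmult_conj, Cminus_conj.
      assert (c : Cconj (RtoC (/ (t' - t))) = RtoC (/ (t' - t)))
        by (apply injective_projections; cbn; ring).
      now rewrite c. }
    rewrite e in H2.
    replace (conj_distr (dz t) k - dz t k)%C
      with (((z t' k - z t k) / (t' - t)%R - dz t k)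
            + - ((z t' k - z t k) / (t' - t)%R - conj_distr (dz t) k))%C by ring.
    eapply Rle_trans; [apply Cmod_triangle|]. rewrite Cmod_opp. lra. }
  assert (z0 : (conj_distr (dz t) k - dz t k)%C = 0%C).
  { apply Cmod_eq_0. pose proof (Cmod_ge_0 (conj_distr (dz t) k - dz t k)). lra. }
  replace (conj_distr (dz t) k) with ((conj_distr (dz t) k - dz t k) + dz t k)%C by ring.
  rewrite z0; ring.
Qed.

(** The two projections are linear and continuous. *)
Lemma cder_of_is_derive (f : R -> C) t l :
  is_derive (K := R_AbsRing) (V := C_R_NormedModule) f t l -> cder f t l.
Proof.
  intros h. split.
  - apply (filterdiff_ext_lin (V := R_NormedModule) _ (fun y : R => fst (scal y l : C_R_NormedModule))).
    + apply (filterdiff_comp' (U := R_NormedModule) (V := C_R_NormedModule) (W := R_NormedModule)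
               f (fun z => fst z) t (fun y => scal y l) (fun z => fst z)); [exact h|].
      apply filterdiff_linear, is_linear_fst.
    + intros y; reflexivity.
  - apply (filterdiff_ext_lin (V := R_NormedModule) _ (fun y : R => snd (scal y l : C_R_NormedModule))).
    + apply (filterdiff_comp' (U := R_NormedModule) (V := C_R_NormedModule) (W := R_NormedModule)
               f (fun z => snd z) t (fun y => scal y l) (fun z => snd z)); [exact h|].
      apply filterdiff_linear, is_linear_snd.
    + intros y; reflexivity.
Qed.

Lemma conj_u_init m a b k : m <> 0 -> real_valued a -> real_valued b ->
  conj_distr (u_init m a b) k = (a k + Ci * (/ bracket m k * b k))%C.
Proof.
  intros hm ra rb. pose proof (bracket_pos m k hm).
  unfold conj_distr, u_init, multiplier. rewrite bracket_opp, <- RtoC_inv by lra.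
  rewrite <- (ra k), <- (rb k). unfold conj_distr.
  apply injective_projections; cbn; ring.
Qed.

Lemma Re_u_init m a b k : m <> 0 -> real_valued a -> real_valued b ->
  Re_distr (u_init m a b) k = a k.
Proof.
  intros hm ra rb. pose proof (bracket_pos m k hm). unfold Re_distr.
  rewrite conj_u_init by assumption. unfold u_init, multiplier. field.
  intros E. apply (f_equal Re) in E. cbn in E. lra.
Qed.

Lemma Im_u_init m a b k : m <> 0 -> real_valued a -> real_valued b ->
  (RtoC (bracket m k) * Im_distr (u_init m a b) k = - b k)%C.
Proof.
  intros hm ra rb. pose proof (bracket_pos m k hm). unfold Im_distr.
  rewrite conj_u_init by assumption. unfold u_init, multiplier. field.
  split; intros E.
  - apply (f_equal Re) in E. cbn in E. lra.
  - apply (f_equal Im) in E. cbn in E. lra.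
Qed.

(** The first order system and the second order equation have the same forcing:
    both sides are coefficients of multiples of one function, by
    [symbB_dot]. *)
Lemma symbB_forcing nl m N a zt R k : m <> 0 -> wball wX a R ->
  (forall j, Re_distr a j = zt j) -> summable (N a) ->
  (forall x, to_fun (N a) x = dot (map (fun f => f (to_fun a x)) (F nl))
                                  (map (fun g => g (to_fun (conj_distr a) x)) (G nl))) ->
  (symbB nl m k * N a k
   = - (Ci * / bracket m k) * fourier (fun x => RtoC (g nl (Re (to_fun zt x)))) k)%C.
Proof.
  intros hm ha hzt sN hN.
  pose proof (bracket_pos m k hm) as hb.
  assert (sa : summable a) by (eapply wball_X_summable; eauto).
  assert (sca : summable (conj_distr a))
    by (eapply wball_X_summable, wball_conj; eauto using wX_opp).
  (* Both sides are compared after division by the nonzero number [ga]. *)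
  set (ga := (- (Ci * / bracket m k))%C).
  assert (ga0 : ga <> 0%C).
  { intros E. apply (f_equal (fun w => w * RtoC (bracket m k))%C) in E. unfold ga in E.
    replace (- (Ci * / bracket m k) * bracket m k)%C with (- Ci)%C in E.
    - apply (f_equal Im) in E. cbn in E. lra.
    - field. intros E'. apply (f_equal Re) in E'. cbn in E'. lra. }
  assert (hz : forall x, Re (to_fun zt x) = Re (to_fun a x)).
  { intros x.
    assert (e : to_fun zt x = RtoC (Re (to_fun a x))).
    { rewrite <- half_plus_conj, <- to_fun_conj by exact sa.
      transitivity (to_fun (fun j => (/ 2 * (a j + conj_distr a j))%C) x).
      - apply to_fun_ext; intros j. rewrite <- hzt. unfold Re_distr, Cdiv. ring.
      - rewrite (to_fun_scal (/ 2) (fun j => (a j + conj_distr a j)%C))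
          by now apply summable_plus.
        rewrite to_fun_plus by assumption. unfold Cdiv; ring. }
    now rewrite e. }
  rewrite (fourier_ext _ (to_fun (fun j => (symbB nl m k / ga * N a j)%C))).
  - rewrite fourier_to_fun by now apply summable_scal. fold ga. field. exact ga0.
  - intros x. rewrite to_fun_scal by exact sN. rewrite hN, hz, to_fun_conj by exact sa.
    unfold Cdiv. rewrite <- Cmult_assoc, (Cmult_comm (/ ga)), Cmult_assoc.
    rewrite symbB_dot by exact hm. fold ga. field. exact ga0.
Qed.

Lemma step_eq nl m tau Qt u :
  (forall x, to_fun (Qt tau u) x = FphiG nl m tau u x) -> summable (Qt tau u) ->
  step nl m tau u = filtered_step nl m tau Qt u.
Proof.
  intros h sq. apply functional_extensionality; intros k.
  unfold step, filtered_step, flow, multiplier.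
  rewrite (fourier_ext _ (to_fun (Qt tau u)) k) by (intros; now rewrite h).
  rewrite fourier_to_fun by exact sq. unfold phase, symbL.
  replace (tau * (Ci * bracket m k))%C with (Ci * RtoC (tau * bracket m k))%C
    by (rewrite RtoC_mult; ring).
  ring.
Qed.

(** * Convergence of the scheme *)

Lemma solution_bounded nl m T u0 u1 z dz : m <> 0 -> 0 < T ->
  is_solution nl m T u0 u1 z dz ->
  exists R, 0 <= R /\ forall t, 0 <= t <= T -> wball wX (u_init m (z t) (dz t)) R.
Proof.
  intros hm hT (hz & _ & hdz & _).
  assert (winv : forall j, 0 <= / wt j)
    by (intros; apply Rlt_le, Rinv_0_lt_compat, wt_pos).
  destruct (continuous_H_bounded _ wX T z ltac:(lra) sobolev_weight_X wX_ge0 hz) as [A hA].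
  destruct (continuous_H_bounded _ (fun k => / wt k) T dz ltac:(lra) sobolev_weight_neg
              winv hdz) as [B hB].
  assert (A0 : 0 <= A) by (apply (wball_ge0 wX (z 0)), hA; lra).
  assert (B0 : 0 <= B) by (apply (wball_ge0 (fun k => / wt k) (dz 0)), hB; lra).
  pose proof (smoothing_const_ge1 m hm) as hS.
  exists (A + smoothing_const m * B).
  split; [apply Rplus_le_le_0_compat; [|apply Rmult_le_pos]; lra|].
  intros t ht. apply wball_minus; auto.
  apply wball_dom with (fun k => / wt k) (dz t); [lra| |now apply hB].
  intros k. unfold multiplier. pose proof (bracket_pos m k hm) as hb.
  pose proof (Rinv_0_lt_compat _ hb). pose proof (wt_pos k).
  rewrite !Cmod_mult, Cmod_Ci, <- RtoC_inv, Cmod_R, Rabs_pos_eq by lra.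
  pose proof (Cmod_ge_0 (dz t k)). rewrite Rmult_1_l, <- !Rmult_assoc.
  split; [repeat apply Rmult_le_pos; auto; lra|].
  apply Rmult_le_compat_r; [easy|].
  apply Rmult_le_reg_r with (wt k * bracket m k); [now apply Rmult_lt_0_compat|].
  replace (wX k * / bracket m k * (wt k * bracket m k)) with (wt k ^ 4)
    by (unfold wX; field; lra).
  replace (smoothing_const m * / wt k * (wt k * bracket m k))
    with (smoothing_const m * bracket m k) by (field; lra).
  now apply wt_pow4_le_bracket.
Qed.

(** Differentiate [z - i dz / bracket] and use [bracket^2 = k^2 + m^2]. *)
Lemma solution_evolves nl m T u0 u1 z dz N Qt q : m <> 0 -> 0 < T ->
  is_solution nl m T u0 u1 z dz -> admissible m N Qt q ->
  (forall a R, 0 <= R -> wball wX a R -> forall x,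
     to_fun (N a) x = dot (map (fun f => f (to_fun a x)) (F nl))
                          (map (fun g => g (to_fun (conj_distr a) x)) (G nl))) ->
  evolves nl m N T (fun t => u_init m (z t) (dz t)).
Proof.
  intros hm hT hsol hadm hN.
  destruct (solution_bounded nl m T u0 u1 z dz hm hT hsol) as (R & hR & hb).
  destruct hsol as (hz & hder & hdz & hreal & heq & _ & _).
  split.
  - intros k. unfold u_init, multiplier.
    apply ccont_minus; [|apply ccont_mult; [|apply ccont_mult]]; try apply ccont_const.
    + apply (ccont_continuous_H (3 / 4) wX); auto using sobolev_weight_X; lra.
    + apply (ccont_continuous_H (- 1 / 4) (fun k => / wt k)); auto using sobolev_weight_neg; [lra|].
      intros; apply Rinv_0_lt_compat, wt_pos.
  - intros t k ht. set (U := u_init m (z t) (dz t)).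
    assert (hU : wball wX U R) by (apply hb; lra).
    destruct (hadm R hR) as (C & _ & HC). destruct (HC U hU) as (hNU & _).
    rewrite (symbB_forcing nl m N U (z t) R k hm hU).
    + unfold U, u_init, multiplier. eapply cder_eq.
      2:{ apply cder_minus; [apply (cder_derivative_H T z dz t k hder ht)|].
          apply cder_scal, cder_scal, (cder_of_is_derive _ _ _ (heq t k ht)). }
      pose proof (bracket_pos m k hm) as hbk.
      assert (nz : RtoC (bracket m k) <> 0%C)
        by (intros E; apply (f_equal Re) in E; cbn in E; lra).
      assert (e : RtoC (IZR k ^ 2) = (RtoC (bracket m k) * RtoC (bracket m k) - RtoC (m ^ 2))%C).
      { rewrite <- RtoC_mult, <- RtoC_minus. f_equal. pose proof (bracket_sqr m k). lra. }
      assert (ci : (Ci * Ci = - (1))%C) by (apply injective_projections; cbn; ring).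
      rewrite e.
      transitivity (dz t k + Ci * bracket m k * z t k - Ci * / bracket m k *
         fourier (fun x => RtoC (g nl (Re (to_fun (z t) x)))) k)%C.
      * field. exact nz.
      * replace (Ci * bracket m k * (z t k - Ci * (/ bracket m k * dz t k)))%C
          with (Ci * bracket m k * z t k - (Ci * Ci) * dz t k)%C by (field; exact nz).
        rewrite ci. ring.
    + intros j. apply Re_u_init; auto; [apply hreal; lra|].
      apply (real_derivative_H T z dz t hT hder hreal); lra.
    + eapply wball_X_summable; eauto.
    + intros x. now apply hN with R.
Qed.

Lemma one_plus_le_exp x : 0 <= x -> 1 + x <= exp x.
Proof.
  intros [h| <-]; [left; now apply exp_ineq1; lra|]. rewrite exp_0; lra.
Qed.

(** Discrete Gronwall lemma with a stability constant [K] that is only known on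
    bounded sets of errors.  For small steps the conclusion itself keeps the
    error below 1, so that one [K] serves.  For the other steps the number of
    steps is bounded, and since [tau] is bounded below any uniform bound on the
    error is [O(tau)]. *)
Lemma error_recursion T c (err : R -> nat -> distr) : 0 < T -> 0 <= c ->
  (forall tau, wball w1 (err tau O) 0) ->
  (forall rho, 0 <= rho -> exists K, 0 <= K /\ forall tau n e,
     0 < tau -> INR (S n) * tau <= T -> 0 <= e <= rho -> wball w1 (err tau n) e ->
     wball w1 (err tau (S n)) ((1 + tau * K) * e + c * tau ^ 2)) ->
  exists C, 0 <= C /\ forall tau n, 0 < tau -> INR n * tau <= T ->
    wball w1 (err tau n) (C * tau).
Proof.
  intros hT hc h0 hstep.
  destruct (hstep 1 Rle_0_1) as (K & hK & H1).
  (* [C1] is the Gronwall constant that holds as long as the errors stay below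
     1; [tau0] is small enough for it to guarantee this. *)
  set (C1 := c * T * exp (K * T)).
  pose proof (exp_pos (K * T)).
  assert (hC1 : 0 <= C1) by (unfold C1; apply Rmult_le_pos; [apply Rmult_le_pos|]; lra).
  set (tau0 := / (C1 + 1)).
  assert (ht0 : 0 < tau0) by (apply Rinv_0_lt_compat; lra).
  assert (htau0 : C1 * tau0 <= 1).
  { unfold tau0. apply Rmult_le_reg_r with (C1 + 1); [lra|].
    rewrite Rmult_assoc, Rinv_l; lra. }
  assert (mono : forall tau n, 0 < tau -> INR (S n) * tau <= T -> INR n * tau <= T).
  { intros tau n ht hn. rewrite S_INR in hn. lra. }
  assert (grow : forall tau n, 0 < tau -> INR n * tau <= T ->
            c * (INR n * tau) * tau * exp (K * (INR n * tau)) <= C1 * tau).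
  { intros tau n ht hn. unfold C1.
    replace (c * T * exp (K * T) * tau) with (c * T * tau * exp (K * T)) by ring.
    assert (0 <= INR n * tau) by (apply Rmult_le_pos; [apply pos_INR|lra]).
    apply Rmult_le_compat.
    - apply Rmult_le_pos; [apply Rmult_le_pos|]; lra.
    - apply Rlt_le, exp_pos.
    - apply Rmult_le_compat_r; [lra|]. now apply Rmult_le_compat_l.
    - destruct (Rle_lt_or_eq_dec (K * (INR n * tau)) (K * T)) as [lt| ->];
        [now apply Rmult_le_compat_l|left; now apply exp_increasing|lra]. }
  assert (small : forall tau n, 0 < tau <= tau0 -> INR n * tau <= T ->
            wball w1 (err tau n) (c * (INR n * tau) * tau * exp (K * (INR n * tau)))).
  { intros tau n ht. induction n as [|n IH]; intros hn.
    - apply wball_le with 0; [apply h0|]. cbn [INR]. right; ring.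
    - specialize (IH (mono tau n (proj1 ht) hn)).
      set (e := c * (INR n * tau) * tau * exp (K * (INR n * tau))) in *.
      assert (he : 0 <= e <= 1).
      { split; [apply (wball_ge0 _ _ _ IH)|]. unfold e.
        eapply Rle_trans; [apply grow; [lra|now apply mono]|].
        apply Rle_trans with (C1 * tau0); [|exact htau0].
        now apply Rmult_le_compat_l. }
      apply wball_le with (1 := H1 tau n e (proj1 ht) hn he IH).
      assert (kt : 0 <= tau * K) by (apply Rmult_le_pos; lra).
      rewrite S_INR. replace (K * ((INR n + 1) * tau)) with (K * (INR n * tau) + tau * K) by ring.
      rewrite exp_plus. pose proof (one_plus_le_exp (tau * K) kt) as g1.
      assert (nt : 0 <= INR n * tau) by (apply Rmult_le_pos; [apply pos_INR|lra]).
      pose proof (one_plus_le_exp (K * (INR n * tau)) ltac:(now apply Rmult_le_pos)) as g2.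
      assert (0 <= K * (INR n * tau)) by now apply Rmult_le_pos.
      set (x := exp (K * (INR n * tau))) in *. set (y := exp (tau * K)) in *.
      assert (1 <= x * y) by nra.
      replace (c * ((INR n + 1) * tau) * tau * (x * y)) with (y * e + c * tau ^ 2 * (x * y))
        by (unfold e; fold x; ring).
      assert ((1 + tau * K) * e <= y * e) by (apply Rmult_le_compat_r; lra).
      assert (c * tau ^ 2 * 1 <= c * tau ^ 2 * (x * y)).
      { apply Rmult_le_compat_l; [|easy]. apply Rmult_le_pos; [easy|apply pow2_ge_0]. }
      lra. }
  assert (finite : forall N, exists M, 0 <= M /\ forall n tau, (n <= N)%nat -> 0 < tau ->
            INR n * tau <= T -> wball w1 (err tau n) M).
  { induction N as [|N (M & hM & IH)].
    - exists 0. split; [lra|]. intros n tau hn _ _. replace n with O by lia. apply h0.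
    - destruct (hstep M hM) as (K' & hK' & H').
      assert (hM' : 0 <= (1 + T * K') * M + c * T ^ 2).
      { apply Rplus_le_le_0_compat; apply Rmult_le_pos; auto.
        pose proof (Rmult_le_pos T K'); lra. }
      exists ((1 + T * K') * M + c * T ^ 2). split; [exact hM'|].
      intros [|n] tau hn ht hnT; [now apply wball_le with 0|].
      assert (tau <= T).
      { rewrite S_INR in hnT. pose proof (Rmult_le_pos _ tau (pos_INR n)). lra. }
      assert (hn' : wball w1 (err tau n) M) by (apply IH; auto; lia).
      apply wball_le with (1 := H' tau n M ht hnT (conj hM (Rle_refl M)) hn').
      apply Rplus_le_compat.
      + apply Rmult_le_compat_r; [easy|]. apply Rplus_le_compat_l.
        now apply Rmult_le_compat_r.
      + apply Rmult_le_compat_l; [easy|]. apply pow_incr; lra. }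
  destruct (INR_unbounded (T / tau0)) as [N hN].
  destruct (finite N) as (M & hM & HM).
  assert (hMt : 0 <= M / tau0).
  { apply Rmult_le_pos; [easy|]. apply Rlt_le, Rinv_0_lt_compat, ht0. }
  exists (C1 + M / tau0). split; [lra|]. intros tau n ht hn.
  destruct (Rle_dec tau tau0) as [le|gt].
  - eapply wball_le; [apply small; auto; lra|].
    eapply Rle_trans; [now apply grow|]. apply Rmult_le_compat_r; lra.
  - apply wball_le with M.
    + apply HM; auto. apply INR_le.
      apply Rle_trans with (T / tau0); [|lra].
      apply Rmult_le_reg_r with tau0; [easy|].
      unfold Rdiv. rewrite Rmult_assoc, Rinv_l, Rmult_1_r by lra.
      pose proof (Rmult_le_compat_l (INR n) tau0 tau (pos_INR n)). lra.
    + apply Rle_trans with (M / tau0 * tau0).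
      * unfold Rdiv. rewrite Rmult_assoc, Rinv_l; lra.
      * apply Rle_trans with (M / tau0 * tau).
        -- apply Rmult_le_compat_l; lra.
        -- apply Rmult_le_compat_r; lra.
Qed.

Lemma wball_Re_distr a M : wball w1 a M -> wball w1 (Re_distr a) M.
Proof.
  intros h. replace M with (Cmod (/ 2) * (M + M)).
  - eapply wball_ext; [|apply (wball_scal w1 (/ 2) _ _ w1_ge0
      (wball_plus w1 _ _ _ _ w1_ge0 h (wball_conj w1 _ _ w1_opp h)))].
    intros k. unfold Re_distr, Cdiv; cbv beta; ring.
  - rewrite <- RtoC_inv, Cmod_R, Rabs_pos_eq; lra.
Qed.

Lemma wball_Im_distr a M : wball w1 a M -> wball w1 (Im_distr a) M.
Proof.
  intros h. assert (nz : (2 * Ci)%C <> 0%C).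
  { intros E. apply (f_equal Im) in E. cbn in E. lra. }
  replace M with (Cmod (/ (2 * Ci)) * (M + M)).
  - eapply wball_ext; [|apply (wball_scal w1 (/ (2 * Ci)) _ _ w1_ge0
      (wball_minus w1 _ _ _ _ w1_ge0 h (wball_conj w1 _ _ w1_opp h)))].
    intros k. unfold Im_distr, Cdiv; cbv beta; ring.
  - rewrite Cmod_inv, Cmod_mult, Cmod_Ci, Cmod_R, Rabs_pos_eq by (easy || lra). lra.
Qed.

Lemma wball_bracket m a M : wball w1 a M ->
  wball wL (multiplier (fun k => RtoC (bracket m k)) a) ((1 + Rabs m) * M).
Proof.
  pose proof (Rabs_pos m). apply wball_dom; [lra|]. intros k.
  unfold multiplier, wL, w1.
  assert (0 <= bracket m k) by apply sqrt_pos.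
  rewrite Cmod_mult, Cmod_R, Rabs_pos_eq, Rmult_1_l by easy.
  pose proof (Cmod_ge_0 (a k)). split; [now apply Rmult_le_pos|].
  rewrite <- Rmult_assoc. apply Rmult_le_compat_r; [easy|].
  pose proof (bracket_le m k). pose proof (wt_pow4_ge_abs k).
  pose proof (pow_R1_Rle _ 4 (wt_ge1 k)). nra.
Qed.

Theorem corollary25 (m : R) (hm : m <> 0) (nl : nonlinearity)
  (u0 u1 : distr) (hu0 : in_H (3 / 4) u0) (hu1 : in_H (- 1 / 4) u1)
  (ru0 : real_valued u0) (ru1 : real_valued u1)
  (T : R) (hT : 0 < T) (z dz : R -> distr)
  (hz : is_solution nl m T u0 u1 z dz) :
  exists CT : R, 0 < CT /\
    forall (tau : R) (n : nat), 0 < tau -> INR n * tau <= T ->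
      let un := u_num nl m tau u0 u1 n in
      let t := INR n * tau in
      let err : distr := fun k => (z t k - Re_distr un k)%C in
      let derr : distr := fun k =>
        (dz t k + multiplier (fun j => RtoC (bracket m j)) (Im_distr un) k)%C in
      in_H 1 err /\ in_H 0 derr /\
      norm_H 1 err + norm_H 0 derr <= CT * tau.
Proof.
  destruct (tame_F m nl) as [Ps hPs]. destruct (tame_G m nl) as [Qs hQs].
  destruct (dot_operators m _ _ _ _ hm hPs hQs) as (N & Qt & q & hadm & hdot).
  set (U := fun t => u_init m (z t) (dz t)).
  destruct (solution_bounded nl m T u0 u1 z dz hm hT hz) as (R & hR & hb).
  assert (hU : evolves nl m N T U).
  { apply (solution_evolves nl m T u0 u1 z dz N Qt q); auto.
    intros a R' hR' ha. now apply (hdot a R' hR' ha). }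
  destruct (local_error nl m N Qt q T U R hm hR hadm hU hb) as (c & hc & hloc).
  set (un := fun tau n => u_num nl m tau u0 u1 n).
  set (e := fun tau n k => (U (INR n * tau)%R k - un tau n k)%C).
  destruct hz as (_ & hder & _ & hreal & _ & hz0 & hdz0).
  destruct (error_recursion T c e hT hc) as (C & hC & main).
  - intros tau. apply wball_ext with (2 := wball_zero w1). intros k.
    unfold e, un, U. cbn [INR u_num]. rewrite Rmult_0_l.
    unfold u_init, multiplier. rewrite hz0, hdz0. ring.
  - intros rho hrho.
    destruct (step_stability nl m N Qt q (R + rho) hm ltac:(lra) hadm) as (K & hK & hstab).
    exists K. split; [exact hK|]. intros tau n d ht hn hd he.
    rewrite S_INR, Rmult_plus_distr_r, Rmult_1_l in hn.
    assert (nt : 0 <= INR n * tau) by (apply Rmult_le_pos; [apply pos_INR|lra]).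
    assert (hUn : wball wX (U (INR n * tau)) R) by (apply hb; lra).
    assert (hun : wball wX (un tau n) (R + rho)).
    { apply wball_le with (R + d); [|lra].
      eapply wball_ext; [|apply (wball_minus wX _ _ _ _ wX_ge0 hUn (wball_1_X _ _ he))].
      intros k; unfold e; cbv beta; ring. }
    assert (es : step nl m tau (un tau n) = filtered_step nl m tau Qt (un tau n)).
    { apply step_eq.
      - intros x. now apply (hdot (un tau n) (R + rho) ltac:(lra) hun).
      - destruct (hadm (R + rho) ltac:(lra)) as (C' & _ & H').
        eapply wball_X_summable, (H' _ hun). exact ht. }
    assert (hUn' : wball wX (U (INR n * tau)) (R + rho)) by (apply wball_le with R; [easy|lra]).
    rewrite Rplus_comm.
    eapply wball_ext; [|apply (wball_plus w1 _ _ _ _ w1_ge0 (hloc _ tau nt ht hn)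
                              (hstab tau _ _ d ht hUn' hun he))].
    intros k. unfold e at 1. cbv beta.
    change (un tau (S n)) with (step nl m tau (un tau n)).
    rewrite es, S_INR, Rmult_plus_distr_r, Rmult_1_l. ring.
  - pose proof (Rabs_pos m).
    exists ((2 + Rabs m) * (C + 1)). split; [apply Rmult_lt_0_compat; lra|].
    intros tau n ht hn un' t err derr.
    specialize (main tau n ht hn).
    assert (nt : 0 <= t <= T)
      by (split; [apply Rmult_le_pos; [apply pos_INR|lra]|exact hn]).
    assert (rz : real_valued (z t)) by now apply hreal.
    assert (rdz : real_valued (dz t)) by now apply (real_derivative_H T z dz t hT hder hreal).
    assert (hre : wball w1 err (C * tau)).
    { apply wball_ext with (2 := wball_Re_distr _ _ main). intros k. unfold err.
      rewrite <- (Re_u_init m (z t) (dz t) k hm rz rdz).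
      unfold Re_distr, e, conj_distr. rewrite Cminus_conj. fold t. unfold U, Cdiv.
      change (un tau n) with un'. ring. }
    assert (him : wball wL derr ((1 + Rabs m) * (C * tau))).
    { eapply wball_same; [auto| |apply (wball_bracket m _ _ (wball_Im_distr _ _ main))].
      intros k. rewrite <- Cmod_opp. f_equal. unfold derr.
      replace (dz t k) with (- (- dz t k))%C by ring.
      rewrite <- (Im_u_init m (z t) (dz t) k hm rz rdz).
      unfold multiplier, Im_distr, e, conj_distr. rewrite Cminus_conj. fold t. unfold U, Cdiv.
      change (un tau n) with un'. ring. }
    destruct (in_H_of_wball 1 w1 _ _ sobolev_weight_1 hre) as [i1 n1].
    destruct (in_H_of_wball 0 wL _ _ sobolev_weight_0 him) as [i0 n0].
    split; [exact i1|]. split; [exact i0|].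
    assert (0 <= C * tau) by (apply Rmult_le_pos; lra).
    replace ((2 + Rabs m) * (C + 1) * tau)
      with (C * tau + (1 + Rabs m) * (C * tau) + (2 + Rabs m) * tau) by ring.
    assert (0 <= (2 + Rabs m) * tau) by (apply Rmult_le_pos; lra). lra.
Qed.
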